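(* Let $a\in(0,1)$ be irrational and let $\omega_1$ be the lower convex envelope of the sequence $(\sin^2(n\pi a))_{n\in\mathbb N}$. Set $\varphi(t)=\dfrac{\omega_1(t)}{t^2}$ for all $t>0$. Then there exists a constant $C=C(a)>0$ such that for any initial data $(u^0,u^1)\in\mathcal D(\mathcal A_1)$, the corresponding solution $u$ of $$u_{tt}-u_{xx}+\delta_a u_t(t,a)=0\ \text{ in }(0,\infty)\times(0,1),\quad u(t,0)=u(t,1)=0,\quad u(0,\cdot)=u^0,\ u_t(0,\cdot)=u^1,$$ satisfies $$\forall t\ge0,\quad\|(u(t),u_t(t))\|_{V_1\times L^2(0,1)}\le\frac{C}{\varphi^{-1}\left(\frac1{t+1}\right)}\|(u^0,u^1)\|_{\mathcal D(\mathcal A_1)}.$$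
   Context: Conventions: $\mathbb N=\{1,2,3,\dots\}$; ''decreasing'' is strict; $\delta_a$ is the Dirac mass at $a$. Lower convex envelope: for $(u_n)_{n\in\mathbb N}\subset(0,\infty)$ with $\liminf_{n\to\infty}u_n=0$, let $\mathcal C\subset[1,\infty)\times[0,\infty)$ be the closure of the convex hull of $\{(n,u_n):n\in\mathbb N\}$. The lower convex envelope of $(u_n)$ is the function $\omega_1$ on $[0,\infty)$ given by $\omega_1(t)=\min\{s:(t,s)\in\mathcal C\}$ for $t\ge1$, extended to $[0,1]$ (in an arbitrary fixed way) so that $\omega_1$ is decreasing, continuous and convex on $[0,\infty)$. Then $\varphi:(0,\infty)\to(0,\infty)$ is a decreasing bijection and $\varphi^{-1}$ is its inverse. Wave equation setting: $V_1=H^1_0(0,1)$ with norm $\|u\|_{V_1}=\|u_x\|_{L^2(0,1)}$ (also used as the norm of $H^1_0(0,1)$), $X_1=V_1\times L^2(0,1)$, $Y_1=(H^1_0(0,1)\cap H^2(0,a)\cap H^2(a,1))\times H^1_0(0,1)$, $$\mathcal D(\mathcal A_1)=\left\{(u,v)\in Y_1:\ \tfrac{du}{dx}(a_+)-\tfrac{du}{dx}(a_-)=v(a)\right\},$$ $$\|(u,v)\|^2_{\mathcal D(\mathcal A_1)}=\|u\|^2_{H^2(0,a)}+\|u\|^2_{H^2(a,1)}+\|v\|^2_{H^1_0(0,1)}.$$ The operator $\mathcal A_1(u,v)=(v,\,u_{xx}-v(a)\delta_a)$ ($u_{xx}$ in the distributional sense on $(0,1)$) with domain $\mathcal D(\mathcal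 A_1)$ generates a semigroup of contractions on $X_1$, and the solution with data $(u^0,u^1)$ is given by $(u(t),u_t(t))$ being the trajectory of this semigroup starting at $(u^0,u^1)$. *)

(* Defs.v *)
From HB Require Import structures.
From mathcomp Require Import all_boot all_order all_algebra.
From mathcomp Require Import all_classical all_reals all_analysis.

Set Implicit Arguments.
Unset Strict Implicit.
Unset Printing Implicit Defensive.

Import Order.TTheory GRing.Theory Num.Theory.
Import numFieldNormedType.Exports.

Local Open Scope classical_set_scope.
Local Open Scope ring_scope.

Section LowerConvexEnvelope.
Context {R : realType}.

(* The point at index 0 is excluded: sequences are indexed by n >= 1. *)
Definition closed_convex_hull (u : nat -> R) : set (R^o * R^o) :=
  closure (smallest (@convex_set R (R^o * R^o)%type)
    [set (n%:R, u n) | n in [set n | (0 < n)%N]]).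

(* A predicate, not a function, because the extension of the envelope from
   [1, +oo[ to [0, 1] is arbitrary. *)
Definition is_lower_convex_envelope (u : nat -> R) (w : R -> R) : Prop :=
  [/\ forall t : R, 1 <= t ->
        closed_convex_hull u (t, w t) /\
        (forall s : R, closed_convex_hull u (t, s) -> w t <= s),
      {in `[0, +oo[ &, {homo w : x y /~ x < y}},
      {within `[0, +oo[, continuous w} &
      @convex_function R R^o `[0, +oo[ w].

Definition phi (w : R -> R) (t : R) : R := w t / t ^+ 2.

Definition phi_inv (w : R -> R) : R -> R := 'pinv_(fun=> 0) `]0, +oo[ (phi w).

End LowerConvexEnvelope.

(* Functions on an interval ]c, d[ are represented by functions on R whose
   values outside ]c, d[ are irrelevant.  All the predicates and norms below are
   unchanged when a function is replaced by another measurable function that is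
   almost everywhere equal to it on the interval. *)
Section Sobolev.
Context {R : realType}.
Implicit Types (c d x : R) (f g u p : R -> R).

Local Notation mu := (@lebesgue_measure R).

Definition ae_eq_on c d f g : Prop :=
  {ae mu, forall x, x \in `]c, d[ -> f x = g x}.

Definition L2 c d : set (R -> R) :=
  [set f | f \_ `]c, d[ \in Lfun mu 2%:E].

Definition L2norm c d f : R := fine ('N[mu]_2%:E[EFin \o (f \_ `]c, d[)]).

Definition test_function c d p : Prop :=
  [/\ forall n x, derivable (derive1n n p) x 1,
      compact (closure [set x | p x != 0]) &
      closure [set x | p x != 0] `<=` `]c, d[].

Definition is_weak_derivative c d u g : Prop :=
  forall p, test_function c d p ->
    \int[mu]_(x in `]c, d[) (u x * derive1 p x) =
      - \int[mu]_(x in `]c, d[) (g x * p x).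

Definition H1 c d : set (R -> R) :=
  [set u | L2 c d u /\ exists2 g, L2 c d g & is_weak_derivative c d u g].

(* Junk value 0 outside of H1 c d. *)
Definition wderiv c d u : R -> R :=
  xget (fun=> 0) [set g | L2 c d g /\ is_weak_derivative c d u g].

(* The continuous representative of u on [c, d]; its values at c and d are the
   one-sided values u(c+) and u(d-). *)
Definition crep c d u : R -> R :=
  xget (fun=> 0)
    [set f | {within `[c, d], continuous f} /\ ae_eq_on c d f u].

Definition H10 c d : set (R -> R) :=
  [set u | [/\ H1 c d u, crep c d u c = 0 & crep c d u d = 0]].

Definition H10norm c d u : R := L2norm c d (wderiv c d u).

Definition H2 c d : set (R -> R) :=
  [set u | H1 c d u /\ H1 c d (wderiv c d u)].

Definition H2norm c d u : R :=
  Num.sqrt (L2norm c d u ^+ 2 + L2norm c d (wderiv c d u) ^+ 2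
            + L2norm c d (wderiv c d (wderiv c d u)) ^+ 2).

End Sobolev.

(* The normed space is the quotient of X : set E by the null vectors of the
   seminorm N; identities between elements of X are read modulo null vectors. *)
Section Semigroup.
Context {R : realType} {E : lmodType R} (X : set E) (N : E -> R).

Record contraction_semigroup (S : R -> E -> E) : Prop := {
  semigroup_stable : forall t U, 0 <= t -> X U -> X (S t U);
  semigroup_linear : forall t k U V, 0 <= t -> X U -> X V ->
    N (S t (k *: U + V) - (k *: S t U + S t V)) = 0;
  semigroup_0 : forall U, X U -> N (S 0 U - U) = 0;
  semigroup_add : forall s t U, 0 <= s -> 0 <= t -> X U ->
    N (S (s + t) U - S s (S t U)) = 0;
  semigroup_contraction : forall t U, 0 <= t -> X U -> N (S t U) <= N U;
  semigroup_continuous : forall U, X U ->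
    N (S h U - U) @[h --> (0 : R)^'+] --> (0 : R) }.

(* Graph of the infinitesimal generator. *)
Definition generator (S : R -> E -> E) (U W : E) : Prop :=
  [/\ X U, X W &
      N (h^-1 *: (S h U - U) - W) @[h --> (0 : R)^'+] --> (0 : R)].

Definition generates_contraction_semigroup
    (A : E -> E -> Prop) (S : R -> E -> E) : Prop :=
  contraction_semigroup S /\ forall U W, generator S U W <-> A U W.

End Semigroup.

Section Wave.
Context {R : realType}.

Local Notation mu := (@lebesgue_measure R).

Definition state : lmodType R := ((R -> R^o) * (R -> R^o))%type.

Implicit Types (a : R) (U W : state).

Definition X1 : set state := [set U | H10 0 1 U.1 /\ L2 0 1 U.2].

Definition X1norm U : R :=
  Num.sqrt (H10norm 0 1 U.1 ^+ 2 + L2norm 0 1 U.2 ^+ 2).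

Definition Y1 a : set state :=
  [set U | [/\ H10 0 1 U.1, H2 0 a U.1, H2 a 1 U.1 & H10 0 1 U.2]].

Definition DA1 a : set state :=
  [set U | Y1 a U /\
    crep a 1 (wderiv a 1 U.1) a - crep 0 a (wderiv 0 a U.1) a
      = crep 0 1 U.2 a].

Definition DA1norm a U : R :=
  Num.sqrt (H2norm 0 a U.1 ^+ 2 + H2norm a 1 U.1 ^+ 2
            + H10norm 0 1 U.2 ^+ 2).

(* g = u_xx - v(a) delta_a as distributions on ]0, 1[. *)
Definition is_A1_second_component a U (g : R -> R) : Prop :=
  forall p : R -> R, test_function 0 1 p ->
    \int[mu]_(x in `]0, 1[) (g x * p x) =
      \int[mu]_(x in `]0, 1[) (U.1 x * derive1n 2 p x) - crep 0 1 U.2 a * p a.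

(* Graph of the operator (u, v) |-> (v, u_xx - v(a) delta_a) on DA1 a. *)
Definition A1 a U W : Prop :=
  [/\ DA1 a U, X1 W, ae_eq_on 0 1 W.1 U.2 & is_A1_second_component a U W.2].

End Wave.

(* Main.v *)
(** Let u_m and v_m be the sine coefficients of the position and the velocity, and
    E(t) the energy, whose decrease is twice the integral of the squared velocity
    at a.  On [0, 2], one period of the undamped string, d'Alembert's formula
    expresses the trace of u at a as the trace of a free wave plus delayed copies of
    itself.  Taking Fourier coefficients in time and applying Bessel's inequality,
      sum_m sin(m pi a)^2 ((m pi u_m)^2 + v_m^2) <= 2 (E(0) - E(2)).
    If D bounds the norm of the data and of its image under the generator, and N is
    the norm of the solution at time t, then for any earlier state the modes beyond
    10 D / N carry at most half of the energy, while sin(m pi a)^2 >= w(10 D / N) on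
    the others.  Hence each time interval of length 2 before t consumes at least a
    fixed multiple of w(10 D / N) N^2, out of a total energy at most D^2.  This reads
    phi(10 D / N) <= 1 / (t + 1), that is N <= 10 D / phi^-1(1 / (t + 1)). *)

Require Import Defs.
From HB Require Import structures.
From mathcomp Require Import all_boot all_order all_algebra.
From mathcomp Require Import all_classical all_reals all_analysis.
From mathcomp Require Import measurable_realfun.
From mathcomp Require Import ring lra.

Set Implicit Arguments.
Unset Strict Implicit.
Unset Printing Implicit Defensive.

Import Order.TTheory GRing.Theory Num.Theory.
Import numFieldNormedType.Exports.

Local Open Scope classical_set_scope.
Local Open Scope ring_scope.

(** * L2 on an interval and primitives *)

Section InnerProduct.
Context {R : realType}.
Implicit Types (c d x : R) (f g h : R -> R).
Local Notation mu := (@lebesgue_measure R).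

(** Orbits starting in the domain are differentiable in time, but this is used only on scalar
    quantities: the sine modes and the value at [a], which are bounded functionals on the energy
    space, and the energy, reduced to such a functional by polarization. D'Alembert's formula is
    accordingly not derived from the equation; it is recognised by its sine coefficients, which
    requires the completeness of the sines, obtained here from Bernstein polynomials in a cosine.
    The obstacle to the tail estimate is the Dirac mass in u_xx: u_x jumps by v(a) at a, so its
    modes beyond M do not carry an energy of order (D / M)^2. The jump adds a term of order v(a)^2 /
    M. For a state of norm N, the interpolation v(a)^2 <= 2 N D turns it into N D / M, a small
    fraction of N^2 once M exceeds a large multiple of D / N, which is the threshold of the regular
    part as well. The emitted waves are expressed by the trace of u rather than by its velocity,
    through one integration by parts in time. All functions in d'Alembert's formula are then
    continuous, and differentiation in time is postponed to the scalar identity for the trace. *)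

Definition ip c d f g : R := \int[mu]_(x in `]c, d[) (f x * g x).

Lemma mu_itvoo_lty c d : (mu `]c, d[%classic < +oo)%E.
Proof.
rewrite lebesgue_measure_itv/=; case: ifP => // _.
by rewrite -EFinB ltry.
Qed.

Lemma L2P c d f : L2 c d f <->
  measurable_fun `]c, d[ f /\ mu.-integrable `]c, d[ (EFin \o (fun x => f x ^+ 2)).
Proof.
have sqE : (fun x => ((f \_ `]c, d[) x) ^+ 2) = (fun x => f x ^+ 2) \_ `]c, d[.
  by apply/funext => x; rewrite !patchE; case: ifP => // _; rewrite expr0n.
split.
  move=> fL; have /= h2 := Lfun2_integrable_sqr fL.
  move: fL; rewrite /L2 /= => /andP[mf _]; split.
    by apply/(measurable_restrictT _ _).2 => //; rewrite inE in mf.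
  by apply/integrable_mkcond => //; rewrite restrict_EFin -sqE.
move=> [mf if2]; rewrite /L2 /=.
have mfT : measurable_fun setT (f \_ `]c, d[) by apply/(measurable_restrictT _ _).1.
apply/andP; split; rewrite inE//= /finite_norm.
rewrite unlock poweR_lty//.
have -> : (\int[mu]_x (`|(EFin \o f \_ `]c, d[) x| `^ 2) =
  \int[mu]_x (((fun x => f x ^+ 2) \_ `]c, d[) x)%:E)%E.
  apply: eq_integral => x _; rewrite -sqE/= powR_mulrn//.
  by rewrite -normrX ger0_norm// sqr_ge0.
have := (integrable_mkcond (mu := mu) (EFin \o (fun x => f x ^+ 2)) (measurable_itv _)).1 if2.
by rewrite restrict_EFin => /integrable_lty; apply.
Qed.

Lemma L2_measurable c d f : L2 c d f -> measurable_fun `]c, d[ f.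
Proof. by move=> /L2P[]. Qed.

Lemma integrable_itv_le c d f g : measurable_fun `]c, d[ f ->
  mu.-integrable `]c, d[ (EFin \o g) ->
  (forall x, x \in `]c, d[ -> `|f x| <= g x) ->
  mu.-integrable `]c, d[ (EFin \o f).
Proof.
move=> mf ig fg; apply: (le_integrable _ _ _ ig) => //.
  exact/measurable_EFinP.
move=> x xcd /=; rewrite lee_fin; apply: (le_trans (fg _ xcd)).
exact: ler_norm.
Qed.

Lemma integrable_cst_itv c d k : mu.-integrable `]c, d[ (EFin \o cst k).
Proof.
apply: measurable_bounded_integrable => //; first exact: mu_itvoo_lty.
by exists `|k|; split; [exact: num_real|move=> y ky x _ /=; exact: ltW].
Qed.

Lemma ip_integrable c d f g : L2 c d f -> L2 c d g ->
  mu.-integrable `]c, d[ (EFin \o (fun x => f x * g x)).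
Proof.
move=> /L2P[mf f2] /L2P[mg g2].
apply: (@integrable_itv_le _ _ _ (fun x => f x ^+ 2 + g x ^+ 2)).
- exact: measurable_funM.
- have := integrableD (mu := mu) (measurable_itv _) f2 g2; apply: eq_integrable => //.
- move=> x _; rewrite normrM.
  have : 0 <= (`|f x| - `|g x|) ^+ 2 by exact: sqr_ge0.
  rewrite sqrrB !real_normK ?num_real//.
  have := mulr_ge0 (normr_ge0 (f x)) (normr_ge0 (g x)).
  lra.
Qed.

Lemma L2_le c d f g : measurable_fun `]c, d[ f -> L2 c d g ->
  (forall x, x \in `]c, d[ -> `|f x| <= `|g x|) -> L2 c d f.
Proof.
move=> mf /L2P[mg g2] fg; apply/L2P; split=> //.
apply: integrable_itv_le g2 _; first exact: measurable_funX.
move=> x xcd; rewrite normrX -[leRHS]ger0_norm ?sqr_ge0// normrX.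
by rewrite lerXn2r// ?nnegrE// fg.
Qed.

Lemma L2_cst c d k : L2 c d (cst k).
Proof.
apply/L2P; split=> //.
exact: (@integrable_cst_itv c d (k ^+ 2)).
Qed.

Lemma L2_bnd c d f k : measurable_fun `]c, d[ f ->
  (forall x, x \in `]c, d[ -> `|f x| <= k) -> L2 c d f.
Proof.
move=> mf fk; apply: (L2_le mf (@L2_cst c d k)) => x xcd.
exact: le_trans (fk _ xcd) (ler_norm _).
Qed.

Lemma L2D c d f g : L2 c d f -> L2 c d g -> L2 c d (fun x => f x + g x).
Proof.
move=> Lf Lg.
move: Lf Lg => /L2P[mf f2] /L2P[mg g2].
apply/L2P; split; first exact: measurable_funD.
apply: (@integrable_itv_le _ _ _ (fun x => (f x ^+ 2 + g x ^+ 2) + (f x ^+ 2 + g x ^+ 2))).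
- by apply: measurable_funX; exact: measurable_funD.
- have := integrableD (mu := mu) (measurable_itv _) f2 g2 => h.
  have := integrableD (mu := mu) (measurable_itv _) h h.
  by apply: eq_integrable.
- move=> x _; rewrite ger0_norm ?sqr_ge0//.
  have : 0 <= (f x - g x) ^+ 2 by exact: sqr_ge0.
  rewrite sqrrB sqrrD; lra.
Qed.

Lemma L2Z c d f k : L2 c d f -> L2 c d (fun x => k * f x).
Proof.
move=> /L2P[mf f2]; apply/L2P; split; first exact: measurable_funM.
have := integrableZl (mu := mu) (measurable_itv _) (k ^+ 2) f2; apply: eq_integrable => //.
by move=> x _ /=; rewrite -EFinM exprMn.
Qed.

Lemma L2N c d f : L2 c d f -> L2 c d (fun x => - f x).
Proof.
by move=> /(L2Z (-1)); under eq_fun do rewrite mulN1r.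
Qed.

Lemma L2B c d f g : L2 c d f -> L2 c d g -> L2 c d (fun x => f x - g x).
Proof. by move=> Lf Lg; apply: L2D => //; exact: L2N. Qed.

Lemma L2_Mbnd c d f g k : L2 c d f -> measurable_fun `]c, d[ g ->
  (forall x, x \in `]c, d[ -> `|g x| <= k) -> L2 c d (fun x => f x * g x).
Proof.
move=> Lf mg gk; apply: (L2_le _ (L2Z k Lf)).
  by apply: measurable_funM => //; exact: L2_measurable.
move=> x xcd; rewrite !normrM mulrC ler_wpM2r//.
exact: le_trans (gk _ xcd) (ler_norm _).
Qed.

Lemma L2_sub c d c' d' f : c <= c' -> d' <= d -> L2 c d f -> L2 c' d' f.
Proof.
move=> cc' dd' /L2P[mf f2].
have s : `]c', d'[ `<=` `]c, d[.
  by apply: subset_itv; rewrite bnd_simp.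
apply/L2P; split; first exact: measurable_funS mf.
exact: integrableS f2.
Qed.

Lemma L2_continuous c d f : {within `[c, d], continuous f} -> L2 c d f.
Proof.
move=> cf; have [cd|dc] := leP c d; last first.
  apply: (@L2_bnd _ _ _ 0).
    by rewrite set_itv_ge -?leNgt ?bnd_simp ?ltW//; exact: measurable_fun_set0.
  by move=> x; rewrite in_itv/= => /andP[/lt_trans h /h]; rewrite ltNge (ltW dc).
have mf : measurable_fun `[c, d] f by exact: subspace_continuous_measurable_fun.
have [k [_ kf]] := compact_bounded (continuous_compact cf (segment_compact (a := c) (b := d))).
apply: (@L2_bnd _ _ _ (k + 1)).
  by apply: measurable_funS mf => //; exact: subset_itv_oo_cc.
move=> x xcd; apply: kf; first by rewrite ltrDl.
by exists x => //; exact: subset_itv_oo_cc.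
Qed.

Lemma within_continuous c d f : continuous f -> {within `[c, d], continuous f}.
Proof. by move=> cf; exact: continuous_subspaceT. Qed.

Lemma continuous_L2 c d f : continuous f -> L2 c d f.
Proof. by move=> cf; apply: L2_continuous; exact: within_continuous. Qed.

Lemma L2_integrable c d f : L2 c d f -> mu.-integrable `]c, d[ (EFin \o f).
Proof.
move=> /ip_integrable /(_ (@L2_cst c d 1)).
by apply: eq_integrable => // x _ /=; rewrite mulr1.
Qed.

Lemma ipC c d f g : ip c d f g = ip c d g f.
Proof. by apply: eq_Rintegral => x _; rewrite mulrC. Qed.

Lemma ip1r c d f : ip c d f (cst 1) = \int[mu]_(x in `]c, d[) f x.
Proof. by apply: eq_Rintegral => x _; rewrite mulr1. Qed.

Lemma eq_ip c d f f' g g' : {in `]c, d[, f =1 f'} -> {in `]c, d[, g =1 g'} ->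
  ip c d f g = ip c d f' g'.
Proof.
move=> ff gg; apply: eq_Rintegral => x; rewrite inE/= => xcd.
by rewrite ff// gg.
Qed.

Lemma ipDl c d f g h : L2 c d f -> L2 c d g -> L2 c d h ->
  ip c d (fun x => f x + g x) h = ip c d f h + ip c d g h.
Proof.
move=> Lf Lg Lh; rewrite /ip -RintegralD//; try exact: ip_integrable.
by apply: eq_Rintegral => x _; rewrite mulrDl.
Qed.

Lemma ipZl c d k f h : L2 c d f -> L2 c d h ->
  ip c d (fun x => k * f x) h = k * ip c d f h.
Proof.
move=> Lf Lh; rewrite /ip -RintegralZl//; last exact: ip_integrable.
by apply: eq_Rintegral => x _; rewrite mulrA.
Qed.

Lemma ipNl c d f h : L2 c d f -> L2 c d h ->
  ip c d (fun x => - f x) h = - ip c d f h.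
Proof.
move=> Lf Lh; rewrite -mulN1r -ipZl//.
by apply: eq_ip => // x _; rewrite mulN1r.
Qed.

Lemma ip_lin c d k f g h : L2 c d f -> L2 c d g -> L2 c d h ->
  ip c d (fun x => k * f x + g x) h = k * ip c d f h + ip c d g h.
Proof. by move=> Lf Lg Lh; rewrite (ipDl (L2Z k Lf) Lg Lh) ipZl. Qed.

Lemma ipBl c d f g h : L2 c d f -> L2 c d g -> L2 c d h ->
  ip c d (fun x => f x - g x) h = ip c d f h - ip c d g h.
Proof. by move=> Lf Lg Lh; rewrite ipDl ?ipNl//; exact: L2N. Qed.

Lemma ipDr c d f g h : L2 c d f -> L2 c d g -> L2 c d h ->
  ip c d h (fun x => f x + g x) = ip c d h f + ip c d h g.
Proof. by move=> *; rewrite ipC ipDl// ![ip _ _ h _]ipC. Qed.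

Lemma ipBr c d f g h : L2 c d f -> L2 c d g -> L2 c d h ->
  ip c d h (fun x => f x - g x) = ip c d h f - ip c d h g.
Proof. by move=> *; rewrite ipC ipBl// ![ip _ _ h _]ipC. Qed.

Lemma ipZr c d k f h : L2 c d f -> L2 c d h ->
  ip c d h (fun x => k * f x) = k * ip c d h f.
Proof. by move=> *; rewrite ipC ipZl// [ip _ _ h _]ipC. Qed.

Lemma ipNr c d f h : L2 c d f -> L2 c d h ->
  ip c d h (fun x => - f x) = - ip c d h f.
Proof. by move=> *; rewrite ipC ipNl// [ip _ _ h _]ipC. Qed.

Lemma L2_sum c d (I : Type) (r : seq I) (F : I -> R -> R) :
  (forall i, L2 c d (F i)) -> L2 c d (fun x => \sum_(i <- r) F i x).
Proof.
move=> LF; elim: r => [|i r ih].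
  by under eq_fun do rewrite big_nil; exact: L2_cst.
by under eq_fun do rewrite big_cons; exact: L2D.
Qed.

Lemma ip_suml c d (I : Type) (r : seq I) (F : I -> R -> R) h :
  (forall i, L2 c d (F i)) -> L2 c d h ->
  ip c d (fun x => \sum_(i <- r) F i x) h = \sum_(i <- r) ip c d (F i) h.
Proof.
move=> LF Lh; elim: r => [|i r ih].
  rewrite big_nil; under [X in ip _ _ X _]eq_fun do rewrite big_nil.
  by rewrite /ip; under eq_Rintegral do rewrite mul0r; rewrite Rintegral_cst// mul0r.
rewrite big_cons -ih -ipDl//; last exact: L2_sum.
by apply: eq_ip => // x _; rewrite big_cons.
Qed.

Lemma ip_ge0 c d f : 0 <= ip c d f f.
Proof. by apply: Rintegral_ge0 => x _; rewrite -expr2 sqr_ge0. Qed.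

Lemma ip_CS c d f g : L2 c d f -> L2 c d g ->
  ip c d f g ^+ 2 <= ip c d f f * ip c d g g.
Proof.
move=> Lf Lg.
have H r : 0 <= ip c d f f + (ip c d f g *+ 2) * r + ip c d g g * r ^+ 2.
  have := @ip_ge0 c d (fun x => f x + r * g x).
  have Lrg := L2Z r Lg.
  rewrite ipDl//; last exact: L2D.
  rewrite !ipDr// !ipZl// !ipZr// (ipC _ _ g f).
  by rewrite expr2; lra.
(* If [g] is null, the nonnegative quadratic in [r] is affine, so its slope vanishes; otherwise it
   is evaluated at its minimum. *)
have := ip_ge0 c d g; rewrite le_eqVlt => /predU1P[g0|g0].
  rewrite -g0 mulr0; move: H; rewrite -g0 => H.
  have [-> |fg0] := eqVneq (ip c d f g) 0; first by rewrite expr0n.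
  have := H (- (ip c d f f + 1) / (ip c d f g *+ 2)).
  rewrite mulrCA divff ?mulrn_eq0// mulr1 mul0r; lra.
have := H (- ip c d f g / ip c d g g).
move: (ip c d f f) (ip c d f g) (ip c d g g) g0 => A B C C0.
have -> : A + B *+ 2 * (- B / C) + C * (- B / C) ^+ 2 = (A * C - B ^+ 2) / C.
  by field; rewrite gt_eqF.
by rewrite pmulr_lge0 ?invr_gt0// subr_ge0.
Qed.

Lemma ip_norm_le c d f g : L2 c d f -> L2 c d g ->
  `|ip c d f g| <= Num.sqrt (ip c d f f) * Num.sqrt (ip c d g g).
Proof.
move=> Lf Lg; rewrite -sqrtrM ?ip_ge0// -sqrtr_sqr ler_sqrt ?ip_CS//.
by rewrite mulr_ge0 ?ip_ge0.
Qed.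

Lemma L2normE c d f : L2 c d f -> L2norm c d f = Num.sqrt (ip c d f f).
Proof.
move=> Lf; rewrite /L2norm unlock.
have -> : (\int[mu]_x (`|(EFin \o f \_ `]c, d[) x| `^ 2) = (ip c d f f)%:E)%E.
  rewrite /ip /Rintegral fineK; last first.
    apply: integrable_fin_num => //; exact: ip_integrable.
  rewrite [RHS]integral_mkcond; apply: eq_integral => x _ /=.
  rewrite !patchE; case: ifPn => _; last first.
    by rewrite normr0 powR_mulrn// expr0n.
  by rewrite powR_mulrn// -normrX ger0_norm ?sqr_ge0// expr2.
by rewrite poweR_EFin/= powR12_sqrt// ip_ge0.
Qed.

Lemma L2norm_sqr c d f : L2 c d f -> L2norm c d f ^+ 2 = ip c d f f.
Proof. by move=> Lf; rewrite L2normE// sqr_sqrtr// ip_ge0. Qed.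

Lemma ae_imp (P Q : R -> Prop) : (forall x, P x -> Q x) ->
  {ae mu, forall x, P x} -> {ae mu, forall x, Q x}.
Proof. by move=> PQ; apply: filterS => //; exact: (ae_filter_ringOfSetsType mu). Qed.

Lemma ae_imp2 (P Q S : R -> Prop) : (forall x, P x -> Q x -> S x) ->
  {ae mu, forall x, P x} -> {ae mu, forall x, Q x} -> {ae mu, forall x, S x}.
Proof. by move=> PQ; apply: filterS2 => //; exact: (ae_filter_ringOfSetsType mu). Qed.

Lemma ae_eq_on_sym c d f g : ae_eq_on c d f g -> ae_eq_on c d g f.
Proof. by apply: ae_imp => x h /h. Qed.

Lemma ae_eq_on_trans c d f g h :
  ae_eq_on c d f g -> ae_eq_on c d g h -> ae_eq_on c d f h.
Proof. by apply: ae_imp2 => x h1 h2 xcd; rewrite h1// h2. Qed.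

Lemma eq_ae_eq_on c d f g : {in `]c, d[, f =1 g} -> ae_eq_on c d f g.
Proof. by move=> fg; apply/nearW => x /fg. Qed.

Lemma ae_eq_on_sub c d c' d' f g : c <= c' -> d' <= d ->
  ae_eq_on c d f g -> ae_eq_on c' d' f g.
Proof.
move=> cc dd; apply: ae_imp => x h xcd; apply: h.
by move: xcd; rewrite !in_itv/= => /andP[? ?]; apply/andP; split; lra.
Qed.

Lemma ae_eq_Rintegral c d f g : measurable_fun `]c, d[ f -> measurable_fun `]c, d[ g ->
  ae_eq_on c d f g ->
  \int[mu]_(x in `]c, d[) f x = \int[mu]_(x in `]c, d[) g x.
Proof.
move=> mf mg fg; rewrite /Rintegral; congr fine.
apply: ae_eq_integral => //; [exact/measurable_EFinP|exact/measurable_EFinP|].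
by move: fg; apply: ae_imp => x h /= xcd; rewrite h.
Qed.

Lemma ae_eq_ip c d f f' g g' : L2 c d f -> L2 c d f' -> L2 c d g -> L2 c d g' ->
  ae_eq_on c d f f' -> ae_eq_on c d g g' -> ip c d f g = ip c d f' g'.
Proof.
move=> /L2_measurable Lf /L2_measurable Lf' /L2_measurable Lg /L2_measurable Lg' ff gg.
apply: ae_eq_Rintegral; try exact: measurable_funM.
by move: ff gg; apply: ae_imp2 => x h1 h2 xcd; rewrite h1// h2.
Qed.

Lemma ae_eq_ipl c d f f' g : L2 c d f -> L2 c d f' -> L2 c d g ->
  ae_eq_on c d f f' -> ip c d f g = ip c d f' g.
Proof.
move=> Lf Lf' Lg ff'.
exact: (ae_eq_ip Lf Lf' Lg Lg ff' (eq_ae_eq_on (fun x _ => erefl (g x)))).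
Qed.

Lemma ip_eq0 c d f : L2 c d f -> ip c d f f = 0 -> ae_eq_on c d f (cst 0).
Proof.
move=> Lf f0; have Lff := ip_integrable Lf Lf.
have mf := L2_measurable Lf.
have h : (\int[mu]_(x in `]c, d[) `|(f x * f x)%:E| = 0)%E.
  have -> : (\int[mu]_(x in `]c, d[) `|(f x * f x)%:E| = \int[mu]_(x in `]c, d[) (f x * f x)%:E)%E.
    by apply: eq_integral => x _ /=; rewrite ger0_norm// -expr2 sqr_ge0.
  rewrite -[LHS]fineK; last exact: integrable_fin_num.
  by congr EFin.
have mff : measurable_fun `]c, d[ (EFin \o (fun x => f x * f x)).
  by apply/measurable_EFinP; exact: measurable_funM.
have := (ae_eq_integral_abs mu (measurable_itv _) mff).1 h.
apply: ae_imp => x /= hx xcd; have [] := hx xcd.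
by move/eqP; rewrite mulf_eq0 orbb => /eqP.
Qed.

End InnerProduct.

(** * Primitives of square integrable functions *)

Section Primitive.
Context {R : realType}.
Implicit Types (c d x y : R) (f g h : R -> R).
Local Notation mu := (@lebesgue_measure R).

(** As a function of [y], the indicator of ]-oo, x[. It represents the evaluation at [x] of a
    primitive as an inner product, and [1 - chi a] is the unit step at [a]. *)
Definition chi x y : R := (y < x)%R%:R.

(* The cutoff inside the integral makes the primitive total, and constant on
   both sides of [c, d]. *)
Definition prim c d f x : R := ip c d f (chi x).

Lemma measurable_chi x (D : set R) : measurable_fun D (chi x).
Proof.
apply: measurable_funTS; rewrite (_ : chi x = \1_(`]-oo, x[%classic)).
  by apply: measurable_indic; exact: measurable_itv.
by apply/funext => y; rewrite indicE /chi mem_setE in_itv/=.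
Qed.

Lemma L2_chi c d x : L2 c d (chi x).
Proof.
apply: (@L2_bnd _ _ _ _ 1); first exact: measurable_chi.
by move=> y _; rewrite /chi; case: (y < x); rewrite ?normr1 ?normr0.
Qed.

Lemma primD c d f g x : L2 c d f -> L2 c d g ->
  prim c d (fun y => f y + g y) x = prim c d f x + prim c d g x.
Proof. by move=> Lf Lg; rewrite /prim ipDl//; exact: L2_chi. Qed.

Lemma primB c d f g x : L2 c d f -> L2 c d g ->
  prim c d (fun y => f y - g y) x = prim c d f x - prim c d g x.
Proof. by move=> Lf Lg; rewrite /prim ipBl//; exact: L2_chi. Qed.

Lemma primZ c d k f x : L2 c d f ->
  prim c d (fun y => k * f y) x = k * prim c d f x.
Proof. by move=> Lf; rewrite /prim ipZl//; exact: L2_chi. Qed.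

Lemma prim_le c d f x : x <= c -> prim c d f x = 0.
Proof.
move=> xc; rewrite /prim (@eq_ip _ _ _ f f _ (cst 0))//.
  by rewrite /ip; under eq_Rintegral do rewrite mulr0; rewrite Rintegral_cst// mul0r.
by move=> y; rewrite in_itv/= => /andP[cy _]; rewrite /chi ltNge (le_trans xc (ltW cy)).
Qed.

Lemma prim_c c d f : prim c d f c = 0.
Proof. exact: prim_le. Qed.

Lemma prim_d c d f : prim c d f d = \int[mu]_(x in `]c, d[) f x.
Proof.
rewrite /prim -ip1r; apply: eq_ip => // y; rewrite in_itv/= => /andP[_ yd].
by rewrite /chi yd.
Qed.

Lemma ip_cstl c d k f : L2 c d f -> ip c d (cst k) f = k * prim c d f d.
Proof.
move=> Lf; rewrite prim_d -ip1r (ipC _ _ f) -ipZl//; last exact: L2_cst.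
by apply: eq_ip => // x _ /=; rewrite mulr1.
Qed.

Lemma prim_ge c d f x : d <= x -> prim c d f x = prim c d f d.
Proof.
move=> dx; apply: eq_ip => // y; rewrite in_itv/= => /andP[_ yd].
by rewrite /chi yd (lt_le_trans yd dx).
Qed.

Lemma primE c d f x : x <= d -> prim c d f x = \int[mu]_(y in `]c, x[) f y.
Proof.
move=> xd; rewrite /prim /ip.
have -> : `]c, x[%classic = `]c, d[ `&` [set y | y < x].
  apply/seteqP; split => y /=; rewrite !in_itv/=; first by move=> /andP[-> yx]; split=> //=; exact: lt_le_trans xd.
  by move=> [/andP[-> _] ->].
rewrite Rintegral_mkcondr; apply: eq_Rintegral => y _.
rewrite patchE /chi; case: ifPn; first by rewrite inE/= => ->; rewrite mulr1.
by rewrite notin_setE/= => /negP/negbTE ->; rewrite mulr0.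
Qed.

Lemma primB_int c d f x y : L2 c d f -> c <= x -> x <= y -> y <= d ->
  prim c d f y - prim c d f x = \int[mu]_(z in `]x, y[) f z.
Proof.
move=> Lf cx; rewrite le_eqVlt => /predU1P[<- _|xy yd].
  by rewrite subrr set_itvoo0 Rintegral_set0.
rewrite !primE ?(le_trans (ltW xy))//.
have iy := L2_integrable (L2_sub (lexx c) yd Lf).
have ix := L2_integrable (L2_sub (lexx c) (le_trans (ltW xy) yd) Lf).
by rewrite (Rintegral_itv_bndo_bndc ix) Rintegral_itvB.
Qed.

(** Cauchy-Schwarz against [chi y - chi x], the indicator of [x, y[, whose squared norm on ]c, d[ is
    at most y - x. *)
Lemma prim_lip c d f x y : L2 c d f -> x <= y ->
  (prim c d f y - prim c d f x) ^+ 2 <= ip c d f f * (y - x).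
Proof.
move=> Lf xy; rewrite /prim -ipBr//; try exact: L2_chi.
apply: le_trans (ip_CS Lf (L2B (L2_chi _ _ _) (L2_chi _ _ _))) _.
apply: ler_wpM2l; first exact: ip_ge0.
have -> : ip c d (fun z => chi y z - chi x z) (fun z => chi y z - chi x z)
   = fine (mu (`]c, d[ `&` `[x, y[)).
  rewrite /ip -[RHS]mul1r -Rintegral_cst; last by apply: measurableI; exact: measurable_itv.
  rewrite Rintegral_mkcondr; apply: eq_Rintegral => z _.
  rewrite patchE mem_setE in_itv/= /chi.
  case: (ltP z y) => zy; case: (ltP z x) => zx /=; rewrite ?subrr ?mul0r ?subr0 ?mulr1//.
  by move: (lt_le_trans zx xy); rewrite ltNge zy.
have h : (mu (`[x, y[%classic : set R) = (y - x)%:E)%E.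
  rewrite lebesgue_measure_itv/= lte_fin; case: ltP => // yx.
  by rewrite (@le_anti _ _ x y) ?subrr// xy yx.
have mI : measurable ((`]c, d[ `&` `[x, y[)%classic : set (measurableTypeR R)).
  by apply: measurableI; exact: measurable_itv.
have -> : y - x = fine (mu `[x, y[%classic) by rewrite h.
apply: fine_le.
- rewrite ge0_fin_numE//; apply: le_lt_trans (mu_itvoo_lty c d).
  by apply: le_measure; rewrite ?inE//; exact: measurable_itv.
- by rewrite h.
- by apply: le_measure; rewrite ?inE//; exact: measurable_itv.
Qed.

Lemma prim_holder c d f x y : L2 c d f ->
  (prim c d f x - prim c d f y) ^+ 2 <= ip c d f f * `|x - y|.
Proof.
move=> Lf; have [xy|yx] := leP x y.
  by rewrite distrC ger0_norm ?subr_ge0// -sqrrN opprB; exact: prim_lip.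
by rewrite ger0_norm ?subr_ge0 ?(ltW yx)//; apply: prim_lip => //; exact: ltW.
Qed.

Lemma prim_continuous c d f : L2 c d f -> continuous (prim c d f).
Proof.
move=> Lf x; apply/cvgrPdist_le => e e0.
set A := ip c d f f; have A0 : 0 <= A by exact: ip_ge0.
exists (e ^+ 2 / (A + 1)) => /=; first by rewrite divr_gt0 ?exprn_gt0// ltr_wpDl.
move=> y /=; rewrite ltr_pdivlMr ?ltr_wpDl// => xy.
rewrite -ler_sqr ?nnegrE ?normr_ge0 ?(ltW e0)// real_normK ?num_real//.
apply: (le_trans (prim_holder x y Lf)); rewrite -/A.
by move: xy; have := normr_ge0 (x - y); nra.
Qed.

Lemma L2_prim c d f c' d' : L2 c d f -> L2 c' d' (prim c d f).
Proof. by move=> Lf; apply: continuous_L2; exact: prim_continuous. Qed.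

Lemma integrable_patch c d f : L2 c d f ->
  mu.-integrable setT (EFin \o (f \_ `]c, d[)).
Proof.
move=> Lf; rewrite -restrict_EFin.
by apply: (integrable_mkcond (mu := mu) _ (measurable_itv _)).1; exact: L2_integrable.
Qed.

Lemma prim_patchE c d f x : L2 c d f ->
  prim c d f x = \int[mu]_(y in `]-oo, x]) (f \_ `]c, d[) y.
Proof.
move=> Lf; rewrite -Rintegral_itv_bndo_bndc; last first.
  by apply: (@integrableS _ _ _ mu setT) => //; exact: integrable_patch.
rewrite /prim /ip Rintegral_mkcond [RHS]Rintegral_mkcond.
apply: eq_Rintegral => y _; rewrite !patchE !mem_setE !in_itv/= /chi.
by case: (_ < _ < _); case: (y < x); rewrite ?mulr1 ?mulr0.
Qed.

Lemma prim_derive_ae c d f : L2 c d f ->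
  {ae mu, forall x, x \in `]c, d[ -> is_derive x (1 : R) (prim c d f) (f x)}.
Proof.
move=> Lf; have ig := integrable_patch Lf.
have h1 y : mu.-integrable `]-oo, y] (EFin \o (f \_ `]c, d[)).
  exact: integrableS ig.
have h2 : locally_integrable [set: R] (f \_ `]c, d[).
  by apply: integrable_locally => //; exact: L2_integrable.
have -> : prim c d f = (fun x => \int[mu]_(y in `]-oo, x]) (f \_ `]c, d[) y).
  by apply/funext => x; exact: prim_patchE.
move: (FTC1Ny h1 h2); apply: ae_imp => x [dF F'] xcd.
have := F'; rewrite patchE mem_setE xcd => <-.
by rewrite derive1E; exact/derivableP.
Qed.

Lemma prim_derive c d f x : L2 c d f -> x \in `]c, d[ ->
  {for x, continuous f} -> is_derive x (1 : R) (prim c d f) (f x).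
Proof.
move=> Lf xcd cf; have ig := integrable_patch Lf.
have -> : prim c d f = (fun x => \int[mu]_(y in `]-oo, x]) (f \_ `]c, d[) y).
  by apply/funext => y; exact: prim_patchE.
have h1 y : mu.-integrable `]-oo, y] (EFin \o (f \_ `]c, d[)).
  exact: integrableS ig.
have xx1 : x < x + 1 by rewrite ltrDl.
have cg : {for x, continuous (f \_ `]c, d[)}.
  rewrite /prop_for /continuous_at patchE mem_setE xcd.
  apply: cvg_trans cf; apply: near_eq_cvg.
  have := xcd; rewrite in_itv/= => /andP[cx xd].
  near=> y; rewrite patchE mem_setE ifT// in_itv/=; apply/andP; split; near: y.
    exact: lt_nbhsr.
  exact: lt_nbhsl.
have [dF F'] := continuous_FTC1 xx1 (h1 _) (ltNyr _) cg.
have := F'; rewrite patchE mem_setE xcd => <-.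
by rewrite derive1E; exact/derivableP.
Unshelve. all: by end_near. Qed.

(** The primitive has derivative 0 everywhere inside, being constant, and derivative [f] almost
    everywhere. *)
Lemma prim_eq0 c d f k : L2 c d f -> (forall x, x \in `]c, d[ -> prim c d f x = k) ->
  ae_eq_on c d f (cst 0).
Proof.
move=> Lf f0; move: (prim_derive_ae Lf); apply: ae_imp => x h xcd.
have dx := h xcd.
have cx : is_derive x (1 : R) (prim c d f) 0.
  have := xcd; rewrite in_itv/= => /andP[cx xd].
  apply: (@near_eq_is_derive _ _ _ (cst k)).
    near=> y; rewrite f0// in_itv/=; apply/andP; split; near: y.
      exact: lt_nbhsr.
    exact: lt_nbhsl.
by have /@derive_val <- := dx; have /@derive_val <- := cx.
Unshelve. all: by end_near. Qed.

Lemma ae_eq_prim c d f g : L2 c d f -> L2 c d g ->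
  (forall x, x \in `]c, d[ -> prim c d f x = prim c d g x) -> ae_eq_on c d f g.
Proof.
move=> Lf Lg fg.
have := @prim_eq0 c d (fun x => f x - g x) 0 (L2B Lf Lg).
have /[swap] /[apply] : forall x, x \in `]c, d[ -> prim c d (fun x => f x - g x) x = 0.
  by move=> x xcd; rewrite primB// fg// subrr.
by apply: ae_imp => x h /h /eqP; rewrite subr_eq0 => /eqP.
Qed.

Lemma prim_FTC c d f F x : {within `[c, d], continuous f} ->
  {within `[c, d], continuous F} ->
  (forall y, y \in `]c, d[ -> is_derive y (1 : R) F (f y)) ->
  x \in `[c, d] -> F x = F c + prim c d f x.
Proof.
move=> cf cF dF; rewrite in_itv/= => /andP[]; rewrite le_eqVlt => /predU1P[<- _|cx xd].
  by rewrite prim_c addr0.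
rewrite primE//.
have cf' : {within `[c, x], continuous f}.
  by apply: continuous_subspaceW cf => y /=; rewrite !in_itv/= => /andP[-> /le_trans ->].
have cF' : {within `[c, x], continuous F}.
  by apply: continuous_subspaceW cF => y /=; rewrite !in_itv/= => /andP[-> /le_trans ->].
have := @continuous_FTC2 _ f F c x cx cf'.
have sub y : y \in `]c, x[ -> y \in `]c, d[.
  by rewrite !in_itv/= => /andP[-> /lt_le_trans ->].
have dLR : derivable_oo_LRcontinuous F c x.
  have [_ F1 F2] := (continuous_within_itvP _ cx).1 cF'.
  by split => // y /sub /dF [].
have F'f : {in `]c, x[, derive1 F =1 f}.
  by move=> y /sub /dF h; rewrite derive1E (@derive_val _ _ _ _ _ _ _ h).
move=> /(_ dLR F'f) h.
have Lf := L2_continuous cf'.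
rewrite Rintegral_itv_bndo_bndc; last exact: L2_integrable.
rewrite Rintegral_itv_obnd_cbnd; last first.
  apply: integrableS (continuous_compact_integrable (segment_compact (a:=c) (b:=x)) cf') => //.
  by apply: subset_itv; rewrite bnd_simp.
by rewrite /Rintegral h/= addrCA subrr addr0.
Qed.

Lemma int_FTC c d f F : c <= d -> {within `[c, d], continuous f} ->
  {within `[c, d], continuous F} ->
  (forall y, y \in `]c, d[ -> is_derive y (1 : R) F (f y)) ->
  \int[mu]_(x in `]c, d[) f x = F d - F c.
Proof.
move=> cd cf cF dF; rewrite -prim_d (@prim_FTC c d f F d) ?in_itv/= ?cd ?lexx//.
by rewrite addrC addrA addNr add0r.
Qed.

(** Fubini for g(x) f(y) on the triangle y < x, both functions being extended by zero: integrating
    in y first gives the primitive of [f], in x first the increment of the primitive of [g] from y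
    to [d]. *)
Lemma prim_by_parts c d f g : c <= d -> L2 c d f -> L2 c d g ->
  ip c d (prim c d f) g + ip c d f (prim c d g) = prim c d f d * prim c d g d.
Proof.
move=> cd Lf Lg.
have Lpf := L2_prim c d Lf; have Lpg := L2_prim c d Lg.
pose D := (`]c, d[%classic : set (measurableTypeR R)).
have iF := integrable_patch Lf; have iG := integrable_patch Lg.
pose F := f \_ `]c, d[; pose G := g \_ `]c, d[.
rewrite -/F in iF; rewrite -/G in iG.
have mF : measurable_fun setT F by apply/measurable_EFinP; exact: (measurable_int mu).
have mG : measurable_fun setT G by apply/measurable_EFinP; exact: (measurable_int mu).
pose h (z : measurableTypeR R * measurableTypeR R) : \bar R :=
  (G z.1 * (F z.2 * chi z.1 z.2))%:E.
have mchi : measurable_fun setT (fun z : measurableTypeR R * measurableTypeR R => chi z.1 z.2).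
  have mb : measurable_fun setT
     (fun z : measurableTypeR R * measurableTypeR R => (z.2 < z.1)%R).
    by apply: measurable_fun_ltr; [exact: measurable_snd|exact: measurable_fst].
  rewrite (_ : (fun z => _) = (fun z : measurableTypeR R * measurableTypeR R =>
     if (z.2 < z.1)%R then 1 else 0)).
    exact: measurable_fun_ifT.
  by apply/funext => z; rewrite /chi; case: (_ < _).
have mh : measurable_fun setT h.
  apply/measurable_EFinP; apply: measurable_funM.
    by apply: (measurableT_comp mG); exact: measurable_fst.
  apply: measurable_funM => //.
  by apply: (measurableT_comp mF); exact: measurable_snd.
have ih : (mu \x mu)%E.-integrable setT h.
  pose k (z : measurableTypeR R * measurableTypeR R) : \bar R := (G z.1 * F z.2)%:E.
  have mk : measurable_fun setT k.
    apply/measurable_EFinP; apply: measurable_funM.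
      by apply: (measurableT_comp mG); exact: measurable_fst.
    by apply: (measurableT_comp mF); exact: measurable_snd.
  apply: (@le_integrable _ _ _ _ _ measurableT _ k) => //.
    move=> z _; rewrite /h /k /= lee_fin mulrA normrM -[leRHS]mulr1.
    by apply: ler_wpM2l => //; rewrite /chi; case: (_ < _); rewrite ?normr1 ?normr0.
  apply/(integrable12ltyP _ _ mk).
  have -> : (\int[mu]_x \int[mu]_y `|k (x, y)| =
      \int[mu]_x (`|(G x)%:E| * \int[mu]_y `|(F y)%:E|))%E.
    apply: eq_integral => x _; rewrite -ge0_integralZl//.
      by apply: eq_integral => y _; rewrite /k/= normrM EFinM.
    by apply: measurableT_comp => //; exact/measurable_EFinP.
  rewrite ge0_integralZr//.
  - apply: lte_mul_pinfty; first exact: integral_ge0.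
      by rewrite ge0_fin_numE ?integral_ge0//; case/integrableP: iG.
    by case/integrableP: iF.
  - by apply: measurableT_comp => //; exact/measurable_EFinP.
  - exact: integral_ge0.
have L2chi' y : L2 c d (fun x => chi x y).
  apply: (@L2_bnd _ _ _ _ 1).
    apply: measurable_funTS; rewrite (_ : (fun x => _) = \1_(`]y, +oo[%classic)).
      by apply: measurable_indic; exact: measurable_itv.
    by apply/funext => x; rewrite indicE /chi mem_setE in_itv/= andbT.
  by move=> x _; rewrite /chi; case: (_ < _); rewrite ?normr1 ?normr0.
have Gchi y : ip c d g (fun x => chi x y) = prim c d g d - prim c d g y.
  apply/eqP; rewrite -subr_eq opprK /prim -ipDr//; last exact: L2_chi.
  apply/eqP; rewrite -/(prim c d g d) prim_d -ip1r.
  (* The cutoffs y < x and x < y add up to 1 except at the single point x = y. *)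
  apply: ae_eq_ip => //; [by apply: L2D => //; exact: L2_chi|exact: L2_cst|exact: eq_ae_eq_on|].
  exists [set y]; split => //; first exact: lebesgue_measure_set1.
  move=> x /= hx; apply: contrapT => xy; apply: hx => _.
  rewrite /chi; case: (ltgtP x y) => [|//|/xy//]; by rewrite ?addr0 ?add0r.
have swap (u v : R -> R) : L2 c d u -> L2 c d v ->
    (\int[mu]_x ((u \_ `]c, d[) x * v x)%:E = (ip c d u v)%:E)%E.
  move=> Lu Lv; rewrite /ip /Rintegral fineK; last first.
    by apply: integrable_fin_num => //; exact: ip_integrable.
  rewrite [RHS]integral_mkcond; apply: eq_integral => x _.
  by rewrite !patchE; case: ifP; rewrite ?mul0r.
have iT (u v : R -> R) : L2 c d u -> L2 c d v ->
    mu.-integrable setT (fun x => ((u \_ `]c, d[) x * v x)%:E).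
  move=> Lu Lv; have := (integrable_mkcond (mu := mu) _ (measurable_itv _)).1 (ip_integrable Lu Lv).
  apply: eq_integrable => // x _; rewrite restrict_EFin/= !patchE.
  by case: ifP; rewrite ?mul0r.
have := Fubini ih.
have -> : (\int[mu]_x \int[mu]_y h (x, y) = (ip c d g (prim c d f))%:E)%E.
  rewrite -swap//; apply: eq_integral => x _.
  rewrite /h/=; under eq_integral do rewrite EFinM.
  by rewrite integralZl//; [rewrite swap//; exact: L2_chi|apply: iT => //; exact: L2_chi].
have -> : (\int[mu]_y \int[mu]_x h (x, y) =
    (ip c d f (fun y => prim c d g d - prim c d g y))%:E)%E.
  rewrite -swap//; last by apply: L2B => //; exact: L2_cst.
  apply: eq_integral => y _.
  rewrite /h/=; under eq_integral do rewrite mulrCA EFinM.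
  rewrite integralZl//; last exact: iT.
  by rewrite swap// Gchi.
move=> [] E; rewrite ipC E.
rewrite ipBr//; last exact: L2_cst.
by rewrite subrK ipC -[fun=> _]/(cst _) ip_cstl// mulrC.
Qed.

Lemma prim_by_parts0 c d f g : c <= d -> L2 c d f -> L2 c d g -> prim c d f d = 0 ->
  ip c d (prim c d f) g = - ip c d f (prim c d g).
Proof.
move=> cd Lf Lg f0; apply/eqP; rewrite -addr_eq0; apply/eqP.
by rewrite prim_by_parts// f0 mul0r.
Qed.

End Primitive.

(** * Smooth bump functions *)

Section DeriveR.
Context {R : realType}.
Implicit Types (f g : R -> R) (x a b : R).

Lemma is_derive_congr x f a b : is_derive x (1 : R) f a -> a = b -> is_derive x (1 : R) f b.
Proof. by move=> ? <-. Qed.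

Lemma derive1_val x f a : is_derive x (1 : R) f a -> derive1 f x = a.
Proof. by move=> h; rewrite derive1E (@derive_val _ _ _ _ _ _ _ h). Qed.

Lemma is_derive_derive1 x f : derivable f x 1 -> is_derive x (1 : R) f (derive1 f x).
Proof. by move=> df; rewrite derive1E; exact/derivableP. Qed.

Lemma is_derive_continuous x f a : is_derive x (1 : R) f a -> {for x, continuous f}.
Proof.
by move=> [df _]; apply: differentiable_continuous; apply/derivable1_diffP.
Qed.

Lemma is_derive_const x (k : R) : is_derive x (1 : R) (fun _ : R => k) 0.
Proof. exact: is_derive_cst. Qed.

Lemma is_derive_add x f g a b : is_derive x (1 : R) f a -> is_derive x (1 : R) g b ->
  is_derive x (1 : R) (fun y => f y + g y) (a + b).
Proof. exact: is_deriveD. Qed.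

Lemma is_derive_sub x f g a b : is_derive x (1 : R) f a -> is_derive x (1 : R) g b ->
  is_derive x (1 : R) (fun y => f y - g y) (a - b).
Proof. exact: is_deriveB. Qed.

Lemma is_derive_opp x f a : is_derive x (1 : R) f a ->
  is_derive x (1 : R) (fun y => - f y) (- a).
Proof. exact: is_deriveN. Qed.

Lemma is_derive_mul x f g a b : is_derive x (1 : R) f a -> is_derive x (1 : R) g b ->
  is_derive x (1 : R) (fun y => f y * g y) (a * g x + f x * b).
Proof.
move=> df dg; apply: is_derive_congr (is_deriveM df dg) _.
by rewrite /GRing.scale/= addrC (mulrC a).
Qed.

Lemma is_derive_scale x k f a : is_derive x (1 : R) f a ->
  is_derive x (1 : R) (fun y => k * f y) (k * a).
Proof. by move=> df; exact: is_deriveZ. Qed.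

Lemma is_derive_comp x f g a b : is_derive (g x) (1 : R) f a -> is_derive x (1 : R) g b ->
  is_derive x (1 : R) (fun y => f (g y)) (a * b).
Proof. by move=> df dg; exact: is_derive1_comp. Qed.

Lemma is_derive_var x : is_derive x (1 : R) (fun y : R => y) 1.
Proof. exact: is_derive_id. Qed.

Lemma is_derive_affine x k b : is_derive x (1 : R) (fun y => k * y + b) k.
Proof.
apply: is_derive_congr (is_derive_add (is_derive_scale k (is_derive_var x)) (is_derive_cst b x 1)) _.
by rewrite mulr1 addr0.
Qed.

Lemma is_derive_comp_affine x f k b a : is_derive (k * x + b) (1 : R) f a ->
  is_derive x (1 : R) (fun y => f (k * y + b)) (k * a).
Proof. by move=> df; rewrite mulrC; exact: is_derive_comp (is_derive_affine x k b). Qed.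

Lemma is_derive_near x f g a : (\near x, f x = g x) -> is_derive x (1 : R) f a ->
  is_derive x (1 : R) g a.
Proof. exact: near_eq_is_derive. Qed.

(** Two-sided differentiability from a modulus depending only on |s - t|, which is the form in which
    a semigroup controls its increments. *)
Lemma is_derive_modulus t f (rho : R -> R) b : rho h @[h --> 0^'+] --> (0 : R) ->
  (\forall s \near t, s != t -> `|f s - f t - b * (s - t)| <= `|s - t| * rho `|s - t|) ->
  is_derive t (1 : R) f b.
Proof.
move=> rho0 fr.
suff C : h^-1 *: (f (h *: 1 + t) - f t) @[h --> (0 : R)^'] --> b.
  by apply: DeriveDef; [apply: cvgP C|exact: cvg_lim C].
apply/cvgrPdist_lt => e e0.
have /cvgrPdist_lt/(_ _ e0) := rho0; rewrite near_withinE => /nbhs_ballP[d1 /= d10 Hd1].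
have /nbhs_ballP[d2 /= d20 Hd2] := fr.
rewrite near_withinE; apply/nbhs_ballP; exists (Num.min d1 d2); first by rewrite /= lt_min d10.
move=> h; rewrite /ball/= sub0r normrN lt_min => /andP[hd1 hd2] hn0.
have h0 : 0 < `|h| by rewrite normr_gt0.
have := Hd2 (h + t); rewrite /ball/= opprD addrCA subrr addr0 normrN => /(_ hd2).
rewrite -subr_eq0 addrK => /(_ hn0) le1.
have := Hd1 `|h|; rewrite /ball/= !sub0r !normrN normr_id => /(_ hd1 h0) lt1.
rewrite /GRing.scale/= mulr1.
have -> : b - h^-1 * (f (h + t) - f t) = - (h^-1 * (f (h + t) - f t - b * h)) by field.
rewrite normrN normrM normfV mulrC ltr_pdivrMr//; apply: (le_lt_trans le1).
rewrite mulrC ltr_pM2r//; apply: le_lt_trans lt1; exact: ler_norm.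
Qed.

Lemma is_derive0_quadratic x f C : (forall y, `|f y - f x| <= C * (y - x) ^+ 2) ->
  is_derive x (1 : R) f 0.
Proof.
move=> fC; apply: (@is_derive_modulus x f (fun h => C * h)).
  rewrite -[X in _ --> X](mulr0 C); apply: cvgM; first exact: cvg_cst.
  exact: cvg_at_right_filter cvg_id.
near=> y => _; rewrite mul0r subr0 mulrCA -expr2 real_normK ?num_real//; exact: fC.
Unshelve. all: by end_near. Qed.

End DeriveR.

Section Smooth.
Context {R : realType}.
Implicit Types (f g : R -> R) (x k b : R) (n : nat) (p : {poly R}).

(** Recursing on the derivative, instead of iterating [derive1n], lets closure under sums and
    products go by induction over all functions at once. *)
Fixpoint differentiable_upto n f : Prop :=
  if n is m.+1 then (forall x, derivable f x 1) /\ differentiable_upto m (derive1 f)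
  else True.

Definition smooth f := forall n, differentiable_upto n f.

Lemma differentiable_uptoW n f : differentiable_upto n.+1 f -> differentiable_upto n f.
Proof.
elim: n f => [//|n ih] f [df [df' h]]; split => //.
by apply: ih; split.
Qed.

Lemma derive1n_derive1 n f : derive1n n.+1 f = derive1n n (derive1 f).
Proof. by rewrite /derive1n iterSr. Qed.

Lemma smooth_derivable_n n f x : smooth f -> derivable (derive1n n f) x 1.
Proof.
move=> /(_ n.+1); elim: n f => [f [df _]|n ih f [_ h]]; first exact: df.
by rewrite derive1n_derive1; exact: ih.
Qed.

Lemma smooth_derivable f x : smooth f -> derivable f x 1.
Proof. exact: (@smooth_derivable_n 0%N). Qed.

Lemma smooth_continuous f : smooth f -> continuous f.
Proof.
move=> sf x; apply: differentiable_continuous; apply/derivable1_diffP.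
exact: smooth_derivable.
Qed.

Lemma smooth_of_derive1 f : (forall x, derivable f x 1) -> smooth (derive1 f) -> smooth f.
Proof. by move=> df sf [|n] //=; split. Qed.

Lemma differentiable_uptoD n f g : differentiable_upto n f -> differentiable_upto n g ->
  differentiable_upto n (f \+ g).
Proof.
elim: n f g => [//|n ih] f g [df hf] [dg hg]; split; first by move=> x; exact: derivableD.
rewrite (_ : derive1 (f \+ g) = derive1 f \+ derive1 g); first exact: ih.
by apply/funext => x; apply: derive1_val; apply: is_derive_add; exact: is_derive_derive1.
Qed.

Lemma differentiable_uptoM n f g : differentiable_upto n f -> differentiable_upto n g ->
  differentiable_upto n (f \* g).
Proof.
elim: n f g => [//|n ih] f g [df hf] [dg hg]; split; first by move=> x; exact: derivableM.
rewrite (_ : derive1 (f \* g) = (f \* derive1 g) \+ (g \* derive1 f)).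
  apply: differentiable_uptoD; apply: ih => //; apply: differentiable_uptoW; by split.
apply/funext => x; apply: derive1_val.
by apply: is_derive_congr (is_derive_mul (is_derive_derive1 (df x)) (is_derive_derive1 (dg x))) _; rewrite /= addrC mulrC; congr (_ + _); rewrite mulrC.
Qed.

Lemma smooth_cst k : smooth (cst k).
Proof.
move=> n; elim: n k => [//|n ih] c; split; first by move=> x; exact: derivable_cst.
by rewrite (_ : derive1 _ = cst 0)//; apply/funext => x; exact: derive1_cst.
Qed.

Lemma differentiable_upto_affine n f k b : differentiable_upto n f ->
  differentiable_upto n (fun x => f (k * x + b)).
Proof.
elim: n f => [//|n ih] f [df hf].
have D x : is_derive x (1 : R) (fun x => f (k * x + b)) (k * derive1 f (k * x + b)).
  by apply: is_derive_comp_affine; exact: is_derive_derive1.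
split; first by move=> x; have [] := D x.
rewrite (_ : derive1 _ = (cst k) \* (fun x => derive1 f (k * x + b))).
  by apply: differentiable_uptoM; [exact: smooth_cst|exact: ih].
by apply/funext => x; exact: derive1_val (D x).
Qed.

Lemma smoothD f g : smooth f -> smooth g -> smooth (f \+ g).
Proof. by move=> sf sg n; exact: differentiable_uptoD. Qed.

Lemma smoothM f g : smooth f -> smooth g -> smooth (f \* g).
Proof. by move=> sf sg n; exact: differentiable_uptoM. Qed.

Lemma smooth_affine f k b : smooth f -> smooth (fun x => f (k * x + b)).
Proof. by move=> sf n; exact: differentiable_upto_affine. Qed.

(** The classical flat function exp(-1/x), with a polynomial factor in 1/x that makes the family
    stable under differentiation. *)
Definition flat p x := if 0 < x then p.[x^-1] * expR (- x^-1) else 0.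

Lemma flat_npos p x : x <= 0 -> flat p x = 0.
Proof. by move=> x0; rewrite /flat ltNge x0. Qed.

Lemma flat_le p : exists2 C, 0 <= C & forall x, `|flat p x| <= C * x ^+ 2.
Proof.
(* With y = 1/x, the exponential series gives exp y >= y^(i+2) / (i+2)!; the two spare powers of y
   become the factor x^2, which makes [flat p] differentiable at 0. *)
have mono (i : nat) x : 0 < x -> x^-1 ^+ i * expR (- x^-1) <= (i.+2`!)%:R * x ^+ 2.
  move=> x0; rewrite expRN ler_pdivrMr ?expR_gt0//.
  have y0 : 0 < x^-1 by rewrite invr_gt0.
  have := expR_ge1Dxn i.+1 (ltW y0).
  move: (expR _) => E h.
  have : x^-1 ^+ i.+2 / i.+2`!%:R <= E by lra.
  rewrite ler_pdivrMr ?ltr0n ?fact_gt0// => {}h.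
  have -> : x^-1 ^+ i = x^-1 ^+ i.+2 * x ^+ 2.
    by rewrite !exprS; field; rewrite gt_eqF.
  by rewrite [leRHS]mulrAC ler_wpM2r ?sqr_ge0// [leRHS]mulrC.
exists (\sum_(i < size p) `|p`_i| * (i.+2`!)%:R).
  by apply: sumr_ge0 => i _; rewrite mulr_ge0.
move=> x; rewrite /flat; case: ifPn => x0; last first.
  by rewrite normr0 mulr_ge0 ?sqr_ge0//; apply: sumr_ge0 => i _; rewrite mulr_ge0.
rewrite horner_coef mulr_suml mulr_suml; apply: le_trans (ler_norm_sum _ _ _) _.
apply: ler_sum => i _; rewrite -!mulrA normrM ler_wpM2l//.
rewrite ger0_norm ?mono//.
by rewrite mulr_ge0 ?expR_ge0 ?exprn_ge0// invr_ge0 ltW.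
Qed.

Lemma flat_derive p x : is_derive x (1 : R) (flat p) (flat ('X^2 * (p - p^`())%R) x).
Proof.
have [x0|x0|<-] := ltrgtP 0 x.
- apply: (@is_derive_near _ _ (fun y => p.[y^-1] * expR (- y^-1))).
    near=> y; rewrite /flat ifT//; near: y; exact: lt_nbhsr.
  have d0 : is_derive x (1 : R) (fun y => y^-1) (- (x ^- 2)).
    have := @is_deriveV R id x 1 1; rewrite /= (gt_eqF x0) => /(_ isT (is_derive_var x)).
    by move=> h; apply: is_derive_congr h _; rewrite scaler1.
  have d1 := is_derive_comp (is_derive_poly p (x^-1)) d0.
  have d2 := is_derive_comp (g := fun y => - y^-1) (is_derive_expR (- x^-1)) (is_derive_opp d0).
  apply: is_derive_congr (is_derive_mul d1 d2) _.
  rewrite /flat x0 hornerM hornerXn hornerD hornerN exprVn opprK; ring.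
- rewrite (flat_npos _ (ltW x0)); apply: (@is_derive_near _ _ (fun=> 0)).
  by near=> y; rewrite flat_npos// ltW//; near: y; exact: lt_nbhsl.
- rewrite {2}/flat ltxx; have [C C0 pC] := flat_le p.
  by apply: (@is_derive0_quadratic _ _ _ C) => y; rewrite {2}/flat ltxx !subr0.
Unshelve. all: by end_near. Qed.

Lemma flat_smooth p : smooth (flat p).
Proof.
move=> n; elim: n p => [//|n ih] p; split; first by move=> x; have [] := flat_derive p x.
rewrite (_ : derive1 _ = flat ('X^2 * (p - p^`())%R)); first exact: ih.
by apply/funext => x; exact: derive1_val (flat_derive p x).
Qed.

(** The factor n + 1 steepens both flanks without moving the support or exceeding 1, so that these
    functions converge to the indicator of ]al, be[ under a fixed bound. *)
Definition bump al be n x := flat 1 (n.+1%:R * (x - al)) * flat 1 (n.+1%:R * (be - x)).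

Lemma bump_smooth al be n : smooth (bump al be n).
Proof.
apply: smoothM.
  rewrite (_ : (fun x => _) = fun x => flat 1 (n.+1%:R * x + - (n.+1%:R * al))).
    exact/smooth_affine/flat_smooth.
  by apply/funext => x; rewrite mulrBr.
rewrite (_ : (fun x => _) = fun x => flat 1 (- n.+1%:R * x + n.+1%:R * be)).
  exact/smooth_affine/flat_smooth.
by apply/funext => x; rewrite mulrBr addrC mulNr.
Qed.

Lemma flat1_ge0 x : 0 <= flat 1 x.
Proof. by rewrite /flat; case: ifP => // _; rewrite hornerC mul1r expR_ge0. Qed.

Lemma flat1_le1 x : flat 1 x <= 1.
Proof.
rewrite /flat; case: ifP => // x0; rewrite hornerC mul1r expR_le1 oppr_le0.
by rewrite invr_ge0 ltW.
Qed.

Lemma bump_ge0 al be n x : 0 <= bump al be n x.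
Proof. by rewrite mulr_ge0// flat1_ge0. Qed.

Lemma bump_norm_le1 al be n x : `|bump al be n x| <= 1.
Proof.
by rewrite ger0_norm ?bump_ge0// -[leRHS]mulr1 ler_pM// ?flat1_ge0// flat1_le1.
Qed.

Lemma bump_out al be n x : x \notin `[al, be] -> bump al be n x = 0.
Proof.
rewrite in_itv/= negb_and -!ltNge /bump => /orP[] h; [|rewrite mulrC];
  by rewrite flat_npos ?mul0r// pmulr_rle0// subr_le0 ltW.
Qed.

Lemma flat1_cvg x : 0 < x -> flat 1 (n.+1%:R * x) @[n --> \oo] --> (1 : R).
Proof.
move=> x0; have -> : (fun n => flat 1 (n.+1%:R * x)) = (fun n => expR (- (n.+1%:R^-1 * x^-1))).
  by apply/funext => n; rewrite /flat ifT ?mulr_gt0// hornerC mul1r invfM.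
have h : - (n.+1%:R^-1 * x^-1) @[n --> \oo] --> (0 : R).
  rewrite -[X in _ --> X]oppr0; apply: cvgN; rewrite -[X in _ --> X](mul0r x^-1).
  by apply: cvgMl; exact: cvg_harmonic.
have := cvg_comp _ _ h (@continuous_expR R 0).
by rewrite expR0.
Qed.

Lemma bump_cvg al be x : bump al be n x @[n --> \oo] --> (((al < x) && (x < be))%:R : R).
Proof.
case: (ltP al x) => [alx|xal] /=; last first.
  rewrite (_ : (fun n => _) = cst 0); first exact: cvg_cst.
  by apply/funext => n; rewrite /bump flat_npos ?mul0r// pmulr_rle0// subr_le0.
case: (ltP x be) => [xbe|bex] /=; last first.
  rewrite (_ : (fun n => _) = cst 0); first exact: cvg_cst.
  by apply/funext => n; rewrite /bump mulrC flat_npos ?mul0r// pmulr_rle0// subr_le0.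
rewrite -[X in _ --> X]mulr1; apply: cvgM; apply: flat1_cvg; by rewrite subr_gt0.
Qed.

End Smooth.

(** * The lemma of du Bois-Reymond *)

Section DuBoisReymond.
Context {R : realType}.
Implicit Types (c d x al be : R) (f g h p psi : R -> R).
Local Notation mu := (@lebesgue_measure R).

Definition supported al be f := forall x, x \notin `[al, be] -> f x = 0.

Lemma ip_bump_cvg c d h al be : L2 c d h -> c <= al -> al <= be -> be <= d ->
  ip c d h (bump al be n) @[n --> \oo] --> prim c d h be - prim c d h al.
Proof.
move=> Lh cal albe bed.
have -> : prim c d h be - prim c d h al =
    ip c d h (fun x => ((al < x) && (x < be))%:R).
  rewrite primB_int// /ip.
  have -> : `]al, be[%classic = `]c, d[ `&` [set x | (al < x) && (x < be)].
    apply/seteqP; split => x /=; rewrite !in_itv/=; last by case.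
    by move=> /andP[alx xbe]; rewrite alx xbe (le_lt_trans cal alx) (lt_le_trans xbe bed).
  rewrite Rintegral_mkcondr; apply: eq_Rintegral => x _; rewrite patchE.
  case: ifPn; first by rewrite inE/= => ->; rewrite mulr1.
  by rewrite notin_setE/= => /negP/negbTE ->; rewrite mulr0.
have mb n : measurable_fun `]c, d[ (bump al be n).
  apply: measurable_funTS; apply: continuous_measurable_fun.
  exact/smooth_continuous/bump_smooth.
have Lb n : L2 c d (bump al be n).
  by apply: (@L2_bnd _ _ _ _ 1) => // x _; exact: bump_norm_le1.
have mi : measurable_fun `]c, d[ (fun x => ((al < x) && (x < be))%:R : R).
  apply: measurable_funTS; rewrite (_ : (fun x => _) = \1_(`]al, be[%classic)).
    by apply: measurable_indic; exact: measurable_itv.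
  by apply/funext => x; rewrite indicE mem_setE in_itv.
have Li : L2 c d (fun x => ((al < x) && (x < be))%:R).
  by apply: (@L2_bnd _ _ _ _ 1) => // x _; case: (_ && _); rewrite ?normr1 ?normr0.
have mh := L2_measurable Lh.
have ih := L2_integrable Lh.
rewrite /ip /Rintegral; apply: fine_cvg; rewrite fineK; last first.
  by apply: integrable_fin_num => //; exact: ip_integrable.
have mhb n : measurable_fun `]c, d[ (fun x => h x * bump al be n x) := measurable_funM mh (mb n).
apply: (@dominated_cvg _ _ _ mu _ _ _ _ (fun x => `|(h x)%:E|)%E) => //.
- by move=> n; move/measurable_EFinP : (mhb n).
- move=> x _; apply: cvg_EFin; first exact: nearW.
  by apply: cvgMr; exact: bump_cvg.
- exact: integrable_abse.
- move=> n x _ /=; rewrite lee_fin normrM -[leRHS]mulr1 ler_wpM2l//.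
  exact: bump_norm_le1.
Qed.

(** The zero mean makes the primitive vanish again beyond [be], so its support stays inside ]c,
    d[. *)
Lemma test_function_prim c d al be psi : c < al -> al <= be -> be < d -> smooth psi ->
  supported al be psi -> \int[mu]_(x in `]c, d[) psi x = 0 ->
  test_function c d (prim c d psi) /\ derive1 (prim c d psi) = psi.
Proof.
move=> cal albe bed spsi psi0 int0.
have cpsi := smooth_continuous spsi.
have Lpsi := continuous_L2 c d cpsi.
have p0 x : x <= al -> prim c d psi x = 0.
  move=> xal; rewrite primE; last by lra.
  rewrite (@eq_Rintegral _ _ _ _ _ (cst 0)) ?Rintegral_cst ?mul0r// => y.
  by rewrite inE/= in_itv/= => /andP[? ?]; apply: psi0; rewrite in_itv/=; apply/negP; lra.
have p1 x : be <= x -> prim c d psi x = 0.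
  move=> bex; have [xd|dx] := leP x d; last by rewrite prim_ge ?prim_d ?int0// ltW.
  have := primB_int Lpsi (_ : c <= x) xd (lexx d).
  rewrite prim_d int0 sub0r (@eq_Rintegral _ _ _ _ _ (cst 0)) ?Rintegral_cst ?mul0r//.
    by move=> h; apply/eqP; rewrite -oppr_eq0; apply/eqP; apply: h; lra.
  by move=> y; rewrite inE/= in_itv/= => /andP[? ?]; apply: psi0; rewrite in_itv/=; apply/negP; lra.
have D x : is_derive x (1 : R) (prim c d psi) (psi x).
  have [xal|alx] := ltP x al.
    rewrite psi0; last by rewrite in_itv/= negb_and -ltNge xal.
    apply: (@is_derive_near _ _ (fun=> 0)).
    by near=> y; rewrite p0// ltW//; near: y; exact: lt_nbhsl.
  have [bex|xbe] := ltP be x.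
    rewrite psi0; last by rewrite in_itv/= negb_and -!ltNge bex orbT.
    apply: (@is_derive_near _ _ (fun=> 0)).
    by near=> y; rewrite p1// ltW//; near: y; exact: lt_nbhsr.
  by apply: (prim_derive Lpsi _ (cpsi x)); rewrite in_itv/=; apply/andP; split; lra.
have E : derive1 (prim c d psi) = psi by apply/funext => x; exact: derive1_val.
have sub : [set x | prim c d psi x != 0] `<=` `[al, be].
  move=> x /=; rewrite in_itv/= => px; apply/andP; split; rewrite leNgt; apply: contra px => ?; apply/eqP.
    by apply: p0; exact: ltW.
  by apply: p1; exact: ltW.
have csub : closure [set x | prim c d psi x != 0] `<=` `[al, be].
  rewrite [X in _ `<=` X](closure_id _).1; first exact: closureS.
  exact: itv_closed.
split=> //; split.
- move=> n x; apply: smooth_derivable_n; apply: smooth_of_derive1; last by rewrite E.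
  by move=> y; have [] := D y.
- apply: subclosed_compact (@segment_compact _ al be) csub; exact: closed_closure.
- apply: subset_trans csub _ => x /=; rewrite !in_itv/= => /andP[? ?]; apply/andP; split; lra.
Unshelve. all: by end_near. Qed.

Lemma smoothZ k f : smooth f -> smooth (fun x => k * f x).
Proof. by move=> sf; exact: (smoothM (smooth_cst k) sf). Qed.

(* Bump functions converging to indicators, corrected by a multiple of a fixed
   bump so as to have zero mean, are derivatives of test functions; this gives the
   increments of the primitive of h. *)
Lemma du_bois_reymond c d h : c < d -> L2 c d h ->
  (forall p, test_function c d p -> ip c d h (derive1 p) = 0) ->
  exists k, ae_eq_on c d h (cst k).
Proof.
move=> cd Lh h0.
pose a0 := c + (d - c) / 3; pose b0 := c + (d - c) * 2 / 3.
have [ca0 a0b0 b0d] : [/\ c < a0, a0 < b0 & b0 < d].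
  by rewrite /a0 /b0; split; lra.
have cb al be n : continuous (bump al be n) := smooth_continuous (@bump_smooth R al be n).
have Lb al be n : L2 c d (bump al be n).
  exact: continuous_L2.
have L1 := @L2_cst R c d 1.
(* The integrals of the bumps over the middle third converge to its length, so one of them is
   nonzero. *)
have [n0 m0] : exists n, ip c d (cst 1) (bump a0 b0 n) != 0.
  apply: contrapT => /forallNP H.
  have := ip_bump_cvg L1 (ltW ca0) (ltW a0b0) (ltW b0d).
  have -> : (fun n => ip c d (cst 1) (bump a0 b0 n)) = cst 0.
    by apply/funext => n; have /negP/negPn/eqP := H n.
  move=> /cvg_lim; rewrite lim_cst// => /(_ (@Rhausdorff R)).
  rewrite primB_int ?ltW// Rintegral_cst//= lebesgue_measure_itv/= lte_fin a0b0 /= mul1r.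
  by move=> /eqP; rewrite eq_sym subr_eq0 gt_eqF.
have [psi0 [spsi0 supp0 mpsi0]] : exists psi0,
    [/\ smooth psi0, supported a0 b0 psi0 & ip c d (cst 1) psi0 != 0].
  by exists (bump a0 b0 n0); split => //; [exact: bump_smooth|move=> x; exact: bump_out].
have Lp0 : L2 c d psi0 by apply: continuous_L2; exact: smooth_continuous.
move mE : (ip c d (cst 1) psi0) mpsi0 => m {}m0.
(* The only possible value of the constant: [h] and [kap] must have the same pairing with the fixed
   bump. *)
have [kap kapm] : exists kap, kap * m = ip c d h psi0.
  by exists (ip c d h psi0 / m); rewrite divfK.
exists kap.
have key al be n : c < al -> al < be -> be < d ->
    ip c d (fun x => h x - kap) (bump al be n) = 0.
  move=> cal albe bed.
  have [b [sb suppb Lbn] ->] : exists2 b, [/\ smooth b, supported al be b & L2 c d b] & bump al be n = b.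
    by exists (bump al be n) => //; split => //; [exact: bump_smooth|move=> x; exact: bump_out].
  have [q qm] : exists q, q * m = ip c d (cst 1) b.
    by exists (ip c d (cst 1) b / m); rewrite divfK.
  have Lqp : L2 c d (fun x => q * psi0 x) by exact: L2Z.
  have spsi : smooth (fun x => b x - q * psi0 x).
    rewrite (_ : (fun x => _) = b \+ (fun x => (- q) * psi0 x)).
      by apply: smoothD => //; exact: smoothZ.
    by apply/funext => x /=; rewrite mulNr.
  have supp : supported (Num.min al a0) (Num.max be b0) (fun x => b x - q * psi0 x).
    move=> x; rewrite in_itv/= negb_and -!ltNge lt_min gt_max => hx.
    rewrite suppb ?supp0 ?mulr0 ?subr0// in_itv/= negb_and -!ltNge.
      by case/orP: hx => /andP[h1 h2]; rewrite ?h1 ?h2 ?orbT.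
    by case/orP: hx => /andP[h1 h2]; rewrite ?h1 ?h2 ?orbT.
  have int0 : \int[mu]_(x in `]c, d[) (b x - q * psi0 x) = 0.
    by rewrite -ip1r ipC ipBr// ipZr// mE qm subrr.
  have cmin : c < Num.min al a0 by rewrite lt_min cal.
  have maxd : Num.max be b0 < d by rewrite gt_max bed.
  have minmax : Num.min al a0 <= Num.max be b0.
    by rewrite ge_min; apply/orP; left; rewrite le_max (ltW albe).
  have [T D] := test_function_prim cmin minmax maxd spsi supp int0.
  have := h0 _ T; rewrite D ipBr// ipZr// => /eqP; rewrite subr_eq0 => /eqP E.
  rewrite ipBl//; last exact: L2_cst.
  rewrite E (@eq_ip _ _ _ (cst kap) (fun x => kap * cst 1 x) _ b)//; last first.
    by move=> x _; rewrite mulr1.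
  by rewrite ipZl// -kapm -qm mulrCA subrr.
have Lhk : L2 c d (fun x => h x - kap) by apply: L2B => //; exact: L2_cst.
have P al be : c < al -> al < be -> be < d ->
    prim c d (fun x => h x - kap) be = prim c d (fun x => h x - kap) al.
  move=> cal albe bed; apply/eqP; rewrite -subr_eq0; apply/eqP.
  have := ip_bump_cvg Lhk (ltW cal) (ltW albe) (ltW bed).
  rewrite (_ : (fun n => _) = cst 0); last by apply/funext => n; exact: key.
  by move=> /cvg_lim; rewrite lim_cst// => /(_ (@Rhausdorff R)).
have : ae_eq_on c d (fun x => h x - kap) (cst 0).
  apply: (@prim_eq0 _ _ _ _ (prim c d (fun x => h x - kap) a0)) => //.
  move=> x; rewrite in_itv/= => /andP[cx xd].
  by have [xa|ax|->//] := ltgtP x a0; [rewrite (P x a0)// (lt_trans a0b0)|rewrite (P a0 x)].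
by apply: ae_imp => x hx /hx/eqP; rewrite subr_eq0 => /eqP.
Qed.

End DuBoisReymond.

(** * Weak derivatives on an interval *)

Section Sobolev1D.
Context {R : realType}.
Implicit Types (c d x k : R) (f g h u v p : R -> R).
Local Notation mu := (@lebesgue_measure R).

(** Both functions have the same primitive and are its derivative at interior points; the endpoints
    follow by one-sided limits. Hence [crep] does not depend on the representative chosen. *)
Lemma ae_eq_continuous c d f g x : c < d -> {within `[c, d], continuous f} ->
  {within `[c, d], continuous g} -> ae_eq_on c d f g -> x \in `[c, d] -> f x = g x.
Proof.
move=> cd cf cg fg.
have Lf := L2_continuous cf; have Lg := L2_continuous cg.
have [cfi cfc cfd] := (continuous_within_itvP _ cd).1 cf.
have [cgi cgc cgd] := (continuous_within_itvP _ cd).1 cg.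
have E y : prim c d f y = prim c d g y.
  by apply: ae_eq_ipl => //; exact: L2_chi.
have Ei y : y \in `]c, d[ -> f y = g y.
  move=> ycd; rewrite -(derive1_val (prim_derive Lf ycd (cfi y ycd))).
  rewrite -(derive1_val (prim_derive Lg ycd (cgi y ycd))).
  by rewrite (_ : prim c d f = prim c d g)//; apply/funext.
rewrite in_itv/= => /andP[]; rewrite le_eqVlt => /predU1P[<- _|cx].
  apply: (@cvg_unique _ (@Rhausdorff R) (f @ c^'+)) => //.
  apply: cvg_trans cgc; apply: near_eq_cvg; near=> y.
  by rewrite Ei// in_itv/=; apply/andP; split; near: y; [exact: nbhs_right_gt|exact: nbhs_right_lt].
rewrite le_eqVlt => /predU1P[->|xd]; last by apply: Ei; rewrite in_itv/= cx.
apply: (@cvg_unique _ (@Rhausdorff R) (f @ d^'-)) => //.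
apply: cvg_trans cgd; apply: near_eq_cvg; near=> y.
by rewrite Ei// in_itv/=; apply/andP; split; near: y; [exact: nbhs_left_gt|exact: nbhs_left_lt].
Unshelve. all: by end_near. Qed.

Lemma crepE c d u f x : c < d -> {within `[c, d], continuous f} ->
  ae_eq_on c d f u -> x \in `[c, d] -> crep c d u x = f x.
Proof.
move=> cd cf fu xcd; rewrite /crep.
have [cy yu] := xgetPex (fun=> 0) (ex_intro (fun h => {within `[c, d], continuous h} /\ ae_eq_on c d h u) f (conj cf fu)).
by apply: (ae_eq_continuous cd) => //; exact: ae_eq_on_trans yu (ae_eq_on_sym fu).
Qed.

Lemma test_functionP c d p : c < d -> test_function c d p ->
  [/\ forall x, is_derive x (1 : R) p (derive1 p x), continuous p,
      continuous (derive1 p), p c = 0 & p d = 0].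
Proof.
move=> cd [dp _ supp].
have D x : derivable p x 1 by exact: (dp 0%N).
have D1 x : derivable (derive1 p) x 1 by exact: (dp 1%N).
have out x : x \notin `]c, d[ -> p x = 0.
  move=> xcd; apply/eqP; apply: contraNT xcd => px.
  by apply: supp; apply: subset_closure.
split.
- by move=> x; exact: is_derive_derive1.
- by move=> x; apply: differentiable_continuous; exact/derivable1_diffP.
- by move=> x; apply: differentiable_continuous; exact/derivable1_diffP.
- by apply: out; rewrite in_itv/= ltxx.
- by apply: out; rewrite in_itv/= ltxx andbF.
Qed.

Lemma test_function_prim_derive1 c d p x : c < d -> test_function c d p ->
  x \in `[c, d] -> p x = prim c d (derive1 p) x.
Proof.
move=> cd /(test_functionP cd)[D cp cp' pc _] xcd.
rewrite (@prim_FTC _ c d (derive1 p) p)// ?pc ?add0r//; exact: within_continuous.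
Qed.

Lemma test_L2 c d p : c < d -> test_function c d p -> L2 c d p /\ L2 c d (derive1 p).
Proof.
move=> cd /(test_functionP cd)[_ cp cp' _ _].
by split; exact: continuous_L2.
Qed.

Lemma prim_test c d g p : c < d -> L2 c d g -> test_function c d p ->
  ip c d (prim c d g) (derive1 p) = - ip c d g p.
Proof.
move=> cd Lg tp; have [Lp Lp'] := test_L2 cd tp.
have [_ _ _ _ pd] := test_functionP cd tp.
have := prim_by_parts (ltW cd) Lg Lp'.
rewrite -[in RHS](test_function_prim_derive1 cd tp) ?in_itv/= ?lexx ?ltW// pd mulr0.
rewrite [X in _ + X](@eq_ip _ _ _ g g _ p)// => [/eqP|x xcd].
  by rewrite addr_eq0 => /eqP.
by rewrite -(test_function_prim_derive1 cd tp)//; exact: subset_itv_oo_cc.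
Qed.

Lemma cst_test c d k p : c < d -> test_function c d p -> ip c d (cst k) (derive1 p) = 0.
Proof.
move=> cd tp; have [_ Lp'] := test_L2 cd tp.
have [_ _ _ _ pd] := test_functionP cd tp.
by rewrite ip_cstl// -(test_function_prim_derive1 cd tp) ?pd ?mulr0// in_itv/= lexx ltW.
Qed.

(** The bridge from distributions to primitives: du Bois-Reymond applied to u minus the primitive of
    [g] in one direction, integration by parts against test functions in the other. Sobolev
    functions are handled as primitives from here on. *)
Lemma weak_derivativeP c d u g : c < d -> L2 c d u -> L2 c d g ->
  is_weak_derivative c d u g <-> exists k, ae_eq_on c d u (fun x => k + prim c d g x).
Proof.
move=> cd Lu Lg; have Lpg : L2 c d (prim c d g) by exact: L2_prim.
have Lk k : L2 c d (cst k) := @L2_cst R c d k.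
split.
  move=> wug.
  have [|k hk] := @du_bois_reymond _ c d (fun x => u x - prim c d g x) cd (L2B Lu Lpg).
    move=> p tp; have [Lp Lp'] := test_L2 cd tp.
    rewrite ipBl// prim_test// opprK -[ip c d u _]/(\int[mu]_(x in `]c, d[) (u x * derive1 p x)).
    by rewrite wug// addNr.
  by exists k; move: hk; apply: ae_imp => x /[swap] xcd /(_ xcd) /= <-; rewrite subrK.
move=> [k uk] p tp; have [Lp Lp'] := test_L2 cd tp.
rewrite -[LHS]/(ip c d u (derive1 p)) -[X in - X]/(ip c d g p) -prim_test//.
rewrite (ae_eq_ipl Lu (L2D (Lk k) Lpg) Lp' uk).
by rewrite ipDl// cst_test// add0r.
Qed.

Lemma within_add_prim c d k g : L2 c d g ->
  {within `[c, d], continuous (fun x => k + prim c d g x)}.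
Proof.
move=> Lg; apply: continuous_subspaceT => x; apply: cvgD; first exact: cvg_cst.
exact: prim_continuous.
Qed.

Lemma prim_ae_inj c d k k' g g' : c < d -> L2 c d g -> L2 c d g' ->
  ae_eq_on c d (fun x => k + prim c d g x) (fun x => k' + prim c d g' x) ->
  k = k' /\ ae_eq_on c d g g'.
Proof.
move=> cd Lg Lg' E.
have H x : x \in `[c, d] -> k + prim c d g x = k' + prim c d g' x.
  move=> xcd; have := (@ae_eq_continuous c d (fun x => k + prim c d g x) (fun x => k' + prim c d g' x) x cd (within_add_prim Lg) (within_add_prim Lg') E xcd); exact.
have kk : k = k'.
  by have := H c; rewrite !prim_c !addr0 in_itv/= lexx ltW// => /(_ isT).
split=> //; apply: ae_eq_prim => // x /subset_itv_oo_cc /H.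
by rewrite kk => /addrI.
Qed.

Lemma wderivP c d u : H1 c d u ->
  L2 c d (wderiv c d u) /\ is_weak_derivative c d u (wderiv c d u).
Proof.
move=> [_ [g Lg wg]]; rewrite /wderiv; exact: (xgetPex (fun=> 0) (ex_intro (fun g => L2 c d g /\ is_weak_derivative c d u g) g (conj Lg wg))).
Qed.

Lemma wderivE c d u g k : c < d -> L2 c d u -> L2 c d g ->
  ae_eq_on c d u (fun x => k + prim c d g x) ->
  H1 c d u /\ ae_eq_on c d (wderiv c d u) g.
Proof.
move=> cd Lu Lg ug.
have H : H1 c d u by split => //; exists g => //; apply/weak_derivativeP => //; exists k.
split => //; have [Lw ww] := wderivP H.
have [k' ug'] := (weak_derivativeP cd Lu Lw).1 ww.
by have [] := prim_ae_inj cd Lw Lg (ae_eq_on_trans (ae_eq_on_sym ug') ug).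
Qed.

Lemma H1_prim c d u : c < d -> H1 c d u -> let g := wderiv c d u in
  [/\ L2 c d u, L2 c d g, ae_eq_on c d u (fun x => crep c d u c + prim c d g x) &
      forall x, x \in `[c, d] -> crep c d u x = crep c d u c + prim c d g x].
Proof.
move=> cd Hu g; have Lu := Hu.1; have [Lg wg] := wderivP Hu.
have [k uk] := (weak_derivativeP cd Lu Lg).1 wg.
have C x : x \in `[c, d] -> crep c d u x = k + prim c d g x.
  by move=> xI; exact: (crepE cd (within_add_prim (k := k) Lg) (ae_eq_on_sym uk) xI).
have Ck : crep c d u c = k by rewrite C ?prim_c ?addr0// in_itv/= lexx ltW.
by split => //; rewrite Ck.
Qed.

Lemma H10_prim c d u : c < d -> H10 c d u -> let g := wderiv c d u in
  [/\ L2 c d u, L2 c d g, ae_eq_on c d u (prim c d g), prim c d g d = 0 &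
      forall x, x \in `[c, d] -> crep c d u x = prim c d g x].
Proof.
move=> cd [Hu uc ud] g; have [Lu Lg E C] := H1_prim cd Hu.
rewrite uc in E C; split => //.
- by move: E; apply: ae_imp => x h /h; rewrite add0r.
- by rewrite -[LHS]add0r -C ?ud// in_itv/= lexx ltW.
- by move=> x xI; rewrite C ?add0r.
Qed.

Lemma H10P c d u : c < d -> H10 c d u <->
  L2 c d u /\ exists g, [/\ L2 c d g, ae_eq_on c d u (prim c d g) & prim c d g d = 0].
Proof.
move=> cd; split=> [/(H10_prim cd)[Lu Lg E g1 _]|[Lu [g [Lg ug gd]]]].
  by split => //; exists (wderiv c d u).
have E : ae_eq_on c d u (fun x => 0 + prim c d g x).
  by move: ug; apply: ae_imp => x h /h ->; rewrite add0r.
have C x : x \in `[c, d] -> crep c d u x = 0 + prim c d g x.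
  by move=> xI; exact: (crepE cd (within_add_prim (k := 0) Lg) (ae_eq_on_sym E) xI).
have [H _] := wderivE cd Lu Lg E.
by split; rewrite ?C ?prim_c ?gd ?addr0// in_itv/= lexx ltW.
Qed.

Lemma wderiv_H10 c d u g : c < d -> L2 c d u -> L2 c d g ->
  ae_eq_on c d u (prim c d g) -> ae_eq_on c d (wderiv c d u) g.
Proof.
move=> cd Lu Lg ug; have [] := @wderivE c d u g 0 cd Lu Lg => //.
by move: ug; apply: ae_imp => x h /h ->; rewrite add0r.
Qed.

Lemma H10_lin c d k u v : c < d -> H10 c d u -> H10 c d v ->
  H10 c d (fun x => k * u x + v x) /\
  ae_eq_on c d (wderiv c d (fun x => k * u x + v x))
               (fun x => k * wderiv c d u x + wderiv c d v x).
Proof.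
move=> cd /(H10_prim cd)[Lu Lg ug g1 _] /(H10_prim cd)[Lv Lh vh h1 _].
have Lkg := L2Z k Lg; have Lku := L2Z k Lu.
have E : ae_eq_on c d (fun x => k * u x + v x)
    (prim c d (fun x => k * wderiv c d u x + wderiv c d v x)).
  move: ug vh; apply: ae_imp2 => x hu hv xcd.
  by rewrite primD// primZ// hu// hv.
split; last by apply: wderiv_H10 => //; exact: L2D.
apply/H10P => //; split; first exact: L2D.
exists (fun x => k * wderiv c d u x + wderiv c d v x); split => //; first exact: L2D.
by rewrite primD// primZ// g1 h1 mulr0 addr0.
Qed.

End Sobolev1D.

(** * Bernstein polynomials and trigonometric families *)

Section Bernstein.
Context {R : realType}.
Implicit Types (y : R) (phi psi : nat -> R) (n : nat).

(* The expectation of phi at a binomial variable with n trials of probability y. *)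
Fixpoint binomial_mean n phi y : R :=
  if n is m.+1 then
    y * binomial_mean m (fun k => phi k.+1) y + (1 - y) * binomial_mean m phi y
  else phi 0%N.

Lemma binomial_mean_ext n phi psi y : (forall k, (k <= n)%N -> phi k = psi k) ->
  binomial_mean n phi y = binomial_mean n psi y.
Proof.
elim: n phi psi => [|n ih] phi psi e /=; first exact: e.
by congr (_ * _ + _ * _); apply: ih => k kn; apply: e; rewrite // leqW.
Qed.

Lemma binomial_mean_affine n phi psi y (k l : R) :
  binomial_mean n (fun i => k * phi i + l * psi i) y =
  k * binomial_mean n phi y + l * binomial_mean n psi y.
Proof. by elim: n phi psi => [//|n ih] phi psi /=; rewrite !ih; ring. Qed.

Lemma binomial_mean_cst n y (k : R) : binomial_mean n (fun=> k) y = k.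
Proof. by elim: n => [//|n ih] /=; rewrite !ih; ring. Qed.

Lemma binomial_mean_le n phi psi y : 0 <= y <= 1 ->
  (forall k, (k <= n)%N -> phi k <= psi k) ->
  binomial_mean n phi y <= binomial_mean n psi y.
Proof.
move=> /andP[y0 y1]; elim: n phi psi => [|n ih] phi psi e /=; first exact: e.
apply: lerD; apply: ler_wpM2l; rewrite ?subr_ge0//; apply: ih => k kn; apply: e => //.
exact: leqW.
Qed.

(** The shift [k] is there for the induction: one more trial changes it by 1 - y or by - y. *)
Lemma binomial_variance n y (k : R) :
  binomial_mean n (fun i => (i%:R - n%:R * y + k) ^+ 2) y = n%:R * (y * (1 - y)) + k ^+ 2.
Proof.
elim: n k => [|n ih] k /=; first by rewrite !mul0r subr0 !add0r.
have -> : binomial_mean n (fun i => (i.+1%:R - n.+1%:R * y + k) ^+ 2) y =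
   binomial_mean n (fun i => (i%:R - n%:R * y + (1 - y + k)) ^+ 2) y.
  by apply: binomial_mean_ext => i _; rewrite !mulrS; ring.
have -> : binomial_mean n (fun i => (i%:R - n.+1%:R * y + k) ^+ 2) y =
   binomial_mean n (fun i => (i%:R - n%:R * y + (k - y)) ^+ 2) y.
  by apply: binomial_mean_ext => i _; rewrite !mulrS; ring.
by rewrite !ih !mulrS; ring.
Qed.

(** Bernstein's argument: the pointwise error is averaged, and the mean of (k/n - y)^2 is y (1 - y)
    / n, at most 1/n. *)
Lemma binomial_mean_approx n phi y (q e C : R) : (0 < n)%N -> 0 <= y <= 1 -> 0 <= C ->
  (forall k, (k <= n)%N -> `|phi k - q| <= e + C * (k%:R / n%:R - y) ^+ 2) ->
  `|binomial_mean n phi y - q| <= e + C / n%:R.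
Proof.
move=> n0 y01 C0 H.
have nR : 0 < n%:R :> R by rewrite ltr0n.
have V : binomial_mean n (fun k => (k%:R / n%:R - y) ^+ 2) y <= n%:R^-1.
  have -> : binomial_mean n (fun k => (k%:R / n%:R - y) ^+ 2) y =
      n%:R ^- 2 * binomial_mean n (fun i => (i%:R - n%:R * y + 0) ^+ 2) y.
    have := @binomial_mean_affine n (fun i => (i%:R - n%:R * y + 0) ^+ 2) (fun=> 0) y (n%:R ^- 2) 0.
    rewrite [X in _ + X]mul0r [X in _ = X]addr0 => <-; apply: binomial_mean_ext => k _.
    by rewrite mul0r !addr0; field; rewrite gt_eqF.
  rewrite binomial_variance expr0n addr0.
  have -> : n%:R ^- 2 * (n%:R * (y * (1 - y))) = n%:R^-1 * (y * (1 - y)).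
    by field; rewrite gt_eqF.
  by rewrite -[leRHS]mulr1 ler_wpM2l ?invr_ge0 ?ler0n//; case/andP: y01 => *; nra.
have U : binomial_mean n (fun k => e + C * (k%:R / n%:R - y) ^+ 2) y <= e + C / n%:R.
  have := @binomial_mean_affine n (fun=> 1) (fun k => (k%:R / n%:R - y) ^+ 2) y e C.
  rewrite binomial_mean_cst mulr1.
  rewrite (@binomial_mean_ext _ _ (fun k => e + C * (k%:R / n%:R - y) ^+ 2)) => [->|k _].
    by rewrite lerD2l ler_wpM2l.
  by rewrite ?mulr1.
(* The one-sided bound, to be applied to [phi] and to its opposite. *)
have up psi q' : (forall k, (k <= n)%N -> psi k - q' <= e + C * (k%:R / n%:R - y) ^+ 2) ->
    binomial_mean n psi y - q' <= e + C / n%:R.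
  move=> Hpsi; apply: le_trans U.
  have h := @binomial_mean_affine n psi (fun=> 1) y 1 (- q').
  rewrite binomial_mean_cst mulr1 mul1r in h.
  by rewrite -h; apply: binomial_mean_le => // k /Hpsi; rewrite mul1r.
have N := @binomial_mean_affine n phi (fun=> 0) y (-1) 0.
rewrite binomial_mean_cst mulr0 addr0 mulN1r in N.
rewrite ler_norml; apply/andP; split; last first.
  by apply: up => k /H; apply: le_trans; exact: ler_norm.
have := up (fun i => -1 * phi i + 0) (- q); rewrite N => {}up.
suff : - binomial_mean n phi y - - q <= e + C / n%:R by lra.
apply: up => k /H; apply: le_trans.
by rewrite mulN1r addr0 -opprD -normrN ler_norm.
Qed.

End Bernstein.

(** * Sines and cosines of frequency n pi *)

Section Trigonometric.
Context {R : realType}.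
Implicit Types (x y : R) (n m k : nat) (f g r : R -> R).
Local Notation mu := (@lebesgue_measure R).

Definition sn n x : R := sin (n%:R * pi * x).
Definition cn n x : R := cos (n%:R * pi * x).

Lemma is_derive_sn n x : is_derive x (1 : R) (sn n) (n%:R * pi * cn n x).
Proof.
have h := is_derive_comp_affine (k := n%:R * pi) (b := 0) (is_derive_sin (n%:R * pi * x + 0)).
rewrite addr0 in h; rewrite /sn (_ : (fun x => _) = fun y => sin (n%:R * pi * y + 0))//.
by apply/funext => y; rewrite addr0.
Qed.

Lemma is_derive_cn n x : is_derive x (1 : R) (cn n) (- (n%:R * pi * sn n x)).
Proof.
have h := is_derive_comp_affine (k := n%:R * pi) (b := 0) (is_derive_cos (n%:R * pi * x + 0)).
rewrite addr0 mulrN in h; rewrite /cn (_ : (fun x => _) = fun y => cos (n%:R * pi * y + 0))//.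
by apply/funext => y; rewrite addr0.
Qed.

Lemma continuous_sn n : continuous (sn n).
Proof. by move=> x; exact: is_derive_continuous (is_derive_sn n x). Qed.

Lemma continuous_cn n : continuous (cn n).
Proof. by move=> x; exact: is_derive_continuous (is_derive_cn n x). Qed.

Lemma L2_sn n c d : L2 c d (sn n).
Proof. by apply: continuous_L2; exact: continuous_sn. Qed.

Lemma L2_cn n c d : L2 c d (cn n).
Proof. by apply: continuous_L2; exact: continuous_cn. Qed.

Lemma sin_nat_pi n : sin (n%:R * pi) = 0 :> R.
Proof.
elim: n => [|n ih]; first by rewrite mul0r sin0.
by rewrite mulrS mulrDl mul1r addrC sinDpi ih oppr0.
Qed.

Lemma sn_nat n m : sn n m%:R = 0.
Proof. by rewrite /sn mulrAC -natrM sin_nat_pi. Qed.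

Lemma sn0 n : sn n 0 = 0.
Proof. exact: (sn_nat n 0). Qed.

Lemma cn0 n : cn n 0 = 1.
Proof. by rewrite /cn mulr0 cos0. Qed.

Lemma cn0n x : cn 0 x = 1.
Proof. by rewrite /cn !mul0r cos0. Qed.

Lemma sn0n x : sn 0 x = 0.
Proof. by rewrite /sn !mul0r sin0. Qed.

Lemma frequency_neq0 n : (0 < n)%N -> n%:R * pi != 0 :> R.
Proof. by move=> n0; rewrite mulf_neq0 ?pnatr_eq0 -?lt0n// gt_eqF// pi_gt0. Qed.

Lemma prim_sn n l x : (0 < n)%N -> x \in `[0, l] ->
  prim 0 l (sn n) x = (1 - cn n x) / (n%:R * pi).
Proof.
move=> n0 xl; have np := frequency_neq0 n0.
have D y : is_derive y (1 : R) (fun x => (- (n%:R * pi)^-1) * cn n x) (sn n y).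
  apply: is_derive_congr (is_derive_scale _ (is_derive_cn n y)) _.
  by rewrite mulrNN mulKf.
have h := @prim_FTC R 0 l (sn n) _ x (within_continuous (@continuous_sn n)) _ (fun y _ => D y) xl.
have := h _; rewrite cn0 => H.
have -> : (1 - cn n x) / (n%:R * pi) =
    - (n%:R * pi)^-1 * cn n x - - (n%:R * pi)^-1 * 1 by ring.
rewrite H; first by ring.
by apply: within_continuous => y; exact: is_derive_continuous (D y).
Qed.

Lemma prim_cn n l x : (0 < n)%N -> x \in `[0, l] ->
  prim 0 l (cn n) x = sn n x / (n%:R * pi).
Proof.
move=> n0 xl; have np := frequency_neq0 n0.
have D y : is_derive y (1 : R) (fun x => (n%:R * pi)^-1 * sn n x) (cn n y).
  by apply: is_derive_congr (is_derive_scale _ (is_derive_sn n y)) _; rewrite mulKf.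
have h := @prim_FTC R 0 l (cn n) _ x (within_continuous (@continuous_cn n)) _ (fun y _ => D y) xl.
have := h _; rewrite sn0 mulr0 add0r => <- //; first by rewrite mulrC.
by apply: within_continuous => y; exact: is_derive_continuous (D y).
Qed.

Lemma int_cn n m : (0 < n)%N -> \int[mu]_(x in `]0, m%:R[) cn n x = 0.
Proof. by move=> n0; rewrite -prim_d prim_cn ?sn_nat ?mul0r// in_itv/= lexx ler0n. Qed.

Lemma int_cnB n m l : (n <= m)%N ->
  \int[mu]_(x in `]0, l%:R[) cn (m - n) x = if n == m then l%:R else 0.
Proof.
move=> nm; case: eqP => [->|/eqP nm']; last by rewrite int_cn// subn_gt0 ltn_neqAle nm'.
rewrite subnn (@eq_Rintegral _ _ _ _ _ (cst 1)); last by move=> x _; rewrite cn0n.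
rewrite Rintegral_cst//= mul1r lebesgue_measure_itv/= lte_fin ltr0n.
by case: (posnP l) => [->|l0]//=; rewrite subr0.
Qed.

Lemma snM n m x : (n <= m)%N -> sn n x * sn m x = (cn (m - n) x - cn (n + m) x) / 2.
Proof.
move=> nm; rewrite /sn /cn natrB// natrD.
have -> : (m%:R - n%:R) * pi * x = m%:R * pi * x - n%:R * pi * x by ring.
have -> : (n%:R + m%:R) * pi * x = n%:R * pi * x + m%:R * pi * x by ring.
by rewrite cosB cosD; field.
Qed.

Lemma cnM n m x : (n <= m)%N -> cn n x * cn m x = (cn (m - n) x + cn (n + m) x) / 2.
Proof.
move=> nm; rewrite /sn /cn natrB// natrD.
have -> : (m%:R - n%:R) * pi * x = m%:R * pi * x - n%:R * pi * x by ring.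
have -> : (n%:R + m%:R) * pi * x = n%:R * pi * x + m%:R * pi * x by ring.
by rewrite cosB cosD; field.
Qed.

(** The length [l] is 1 for modes in space and 2 for modes in time. *)
Lemma ip_sn n m l : (0 < n)%N ->
  ip 0 l%:R (sn n) (sn m) = if n == m then l%:R / 2 else 0.
Proof.
wlog nm : n m / (n <= m)%N.
  move=> H n0; case: (leqP n m) => [|/ltnW mn]; first by move=> /H; exact.
  case: (posnP m) => [->|m0]; last by rewrite ipC H// eq_sym.
  rewrite gtn_eqF// /ip (@eq_Rintegral _ _ _ _ _ (cst 0)) ?Rintegral_cst ?mul0r// => x _.
  by rewrite sn0n mulr0.
move=> n0.
have E : ip 0 l%:R (sn n) (sn m) =
   2^-1 * \int[mu]_(x in `]0, l%:R[) (cn (m - n) x - cn (n + m) x).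
  rewrite -RintegralZl//.
    by apply: eq_Rintegral => x _; rewrite snM// mulrC.
  by apply: L2_integrable; apply: L2B; exact: L2_cn.
rewrite E RintegralB//; try by apply: L2_integrable; exact: L2_cn.
rewrite (int_cn _ (n := (n + m)%N)) ?addn_gt0 ?n0// subr0.
by rewrite int_cnB//; case: eqP => _; rewrite ?mulr0// mulrC.
Qed.

Lemma ip_cn n m l : (0 < n)%N ->
  ip 0 l%:R (cn n) (cn m) = if n == m then l%:R / 2 else 0.
Proof.
wlog nm : n m / (n <= m)%N.
  move=> H n0; case: (leqP n m) => [|/ltnW mn]; first by move=> /H; exact.
  case: (posnP m) => [->|m0]; last by rewrite ipC H// eq_sym.
  rewrite gtn_eqF//; transitivity (\int[mu]_(x in `]0, l%:R[) cn n x); last exact: int_cn.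
  by apply: eq_Rintegral => x _; rewrite cn0n mulr1.
move=> n0.
have E : ip 0 l%:R (cn n) (cn m) =
   2^-1 * \int[mu]_(x in `]0, l%:R[) (cn (m - n) x + cn (n + m) x).
  rewrite -RintegralZl//.
    by apply: eq_Rintegral => x _; rewrite cnM// mulrC.
  by apply: L2_integrable; apply: L2D; exact: L2_cn.
rewrite E RintegralD//; try by apply: L2_integrable; exact: L2_cn.
rewrite (int_cn _ (n := (n + m)%N)) ?addn_gt0 ?n0// addr0.
by rewrite int_cnB//; case: eqP => _; rewrite ?mulr0// mulrC.
Qed.

End Trigonometric.

(** * Fourier sums and Bessel's inequality *)

Section Bessel.
Context {R : realType}.
Implicit Types (c d kap : R) (f : R -> R) (F : nat -> R -> R) (n : nat).

(** The projection on the modes 1 to n, where [kap] is their common squared norm. The index 0 is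
    left out: [sn 0] is zero and [cn 0] has a different norm. *)
Definition fourier_sum c d kap f F n x : R :=
  \sum_(1 <= i < n.+1) (ip c d f (F i) / kap) * F i x.

Definition orthogonal_family c d kap F := forall i j, (0 < i)%N -> (0 < j)%N ->
  ip c d (F i) (F j) = if i == j then kap else 0.

Lemma L2_fourier_sum c d kap f F n : (forall i, L2 c d (F i)) ->
  L2 c d (fourier_sum c d kap f F n).
Proof. by move=> LF; apply: L2_sum => i; exact: L2Z. Qed.

Lemma ip_fourier_sum c d kap f F n g : (forall i, L2 c d (F i)) -> L2 c d g ->
  ip c d (fourier_sum c d kap f F n) g =
  \sum_(1 <= i < n.+1) (ip c d f (F i) / kap) * ip c d (F i) g.
Proof.
move=> LF Lg; rewrite ip_suml//; last by move=> i; exact: L2Z.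
by apply: eq_bigr => i _; rewrite ipZl.
Qed.

Lemma ip_fourier_sumF c d kap f F n k : kap != 0 -> (forall i, L2 c d (F i)) ->
  orthogonal_family c d kap F -> (0 < k <= n)%N ->
  ip c d (fourier_sum c d kap f F n) (F k) = ip c d f (F k).
Proof.
move=> kap0 LF oF /andP[k0 kn]; rewrite ip_fourier_sum//.
rewrite (bigD1_seq k)/= ?mem_index_iota ?iota_uniq ?k0//.
rewrite oF// eqxx divfK// big1_seq ?addr0// => i /andP[ik].
rewrite mem_index_iota => /andP[i0 _].
by rewrite oF// (negbTE ik) mulr0.
Qed.

Lemma fourier_residue c d kap f F n : kap != 0 -> (forall i, L2 c d (F i)) -> L2 c d f ->
  orthogonal_family c d kap F ->
  ip c d (fun x => f x - fourier_sum c d kap f F n x)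
         (fun x => f x - fourier_sum c d kap f F n x) =
  ip c d f f - \sum_(1 <= i < n.+1) ip c d f (F i) ^+ 2 / kap.
Proof.
move=> kap0 LF Lf oF; have LS := L2_fourier_sum kap f n LF.
have E : ip c d (fourier_sum c d kap f F n) f = \sum_(1 <= i < n.+1) ip c d f (F i) ^+ 2 / kap.
  rewrite ip_fourier_sum//; apply: eq_bigr => i _.
  by rewrite (ipC _ _ (F i)) expr2 mulrAC.
have E2 : ip c d (fourier_sum c d kap f F n) (fourier_sum c d kap f F n) =
   \sum_(1 <= i < n.+1) ip c d f (F i) ^+ 2 / kap.
  rewrite ip_fourier_sum// !big_nat; apply: eq_bigr => i /andP[i0 ik].
  by rewrite (ipC _ _ (F i)) ip_fourier_sumF ?i0// expr2 mulrAC.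
have Ld := L2B Lf LS.
by rewrite ipBl// !ipBr// E2 (ipC _ _ f) E subrr subr0.
Qed.

Lemma bessel c d kap f F n : 0 < kap -> (forall i, L2 c d (F i)) -> L2 c d f ->
  orthogonal_family c d kap F ->
  \sum_(1 <= i < n.+1) ip c d f (F i) ^+ 2 <= kap * ip c d f f.
Proof.
move=> kap0 LF Lf oF.
have := ip_ge0 c d (fun x => f x - fourier_sum c d kap f F n x).
rewrite fourier_residue ?gt_eqF// subr_ge0 -mulr_suml ler_pdivrMr//.
by rewrite mulrC.
Qed.

End Bessel.

(** * Completeness and tail estimates *)

Section InnerProductIntervals.
Context {R : realType}.
Implicit Types (c d e : R) (f g : R -> R).
Local Notation mu := (@lebesgue_measure R).

Lemma ip_cat c e d f g : L2 c d f -> L2 c d g -> c <= e -> e <= d ->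
  ip c d f g = ip c e f g + ip e d f g.
Proof.
move=> Lf Lg; rewrite le_eqVlt => /predU1P[<- _|ce].
  by rewrite {2}/ip set_itvoo0 Rintegral_set0 add0r.
rewrite le_eqVlt => /predU1P[<-|ed].
  by rewrite {3}/ip set_itvoo0 Rintegral_set0 addr0.
have ifg := ip_integrable Lf Lg.
have := Rintegral_itvB ifg (_ : (BRight c <= BRight e)%O) (_ : (BRight e <= BLeft d)%O).
rewrite !bnd_simp => /(_ (ltW ce) ed).
rewrite /ip => <-; rewrite [X in _ = X + _]Rintegral_itv_bndo_bndc; first by rewrite addrC subrK.
by apply: ip_integrable; [apply: L2_sub Lf|apply: L2_sub Lg]; rewrite ?lexx ?ltW.
Qed.

Lemma ip_itv_le c d c' d' f : L2 c d f -> c <= c' -> c' <= d' -> d' <= d ->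
  ip c' d' f f <= ip c d f f.
Proof.
move=> Lf cc cd dd.
have Lf' : L2 c' d f by exact: L2_sub Lf.
rewrite (ip_cat Lf Lf cc (le_trans cd dd)) (ip_cat Lf' Lf' cd dd).
have := ip_ge0 c c' f; have := ip_ge0 d' d f.
by move: (ip c c' f f) (ip d' d f f) (ip c' d' f f) => x y z *; lra.
Qed.

End InnerProductIntervals.

(** * Uniform approximation by cosine polynomials *)

Section CosineApproximation.
Context {R : realType}.
Implicit Types (x y : R) (n m k : nat) (f g r T Q : R -> R).
Local Notation mu := (@lebesgue_measure R).

(** Membership in the span of [cn 0], ..., [cn K], stated by duality so that no coefficients have to
    be carried along. *)
Definition cosine_span K T := L2 0 1 T /\ forall r, L2 0 1 r ->
  (forall k, (k <= K)%N -> ip 0 1 r (cn k) = 0) -> ip 0 1 r T = 0.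

Lemma cosine_spanD K f g : cosine_span K f -> cosine_span K g ->
  cosine_span K (fun x => f x + g x).
Proof.
move=> [Lf Hf] [Lg Hg]; split; first exact: L2D.
by move=> r Lr rK; rewrite ipDr// Hf// Hg// addr0.
Qed.

(** The cosine factor is moved onto [r]; by the product formula, this tests [r] against frequencies
    at most one higher. *)
Lemma cosine_spanM K T (k l : R) : cosine_span K T ->
  cosine_span K.+1 (fun x => (k + l * cn 1 x) * T x).
Proof.
move=> [LT HT].
have LM f : L2 0 1 f -> L2 0 1 (fun x => (k + l * cn 1 x) * f x).
  move=> Lf; under eq_fun do rewrite mulrC.
  apply: (@L2_Mbnd _ _ _ _ _ (`|k| + `|l|)) => //.
    by apply: L2_measurable; apply: L2D; [exact: L2_cst|apply: L2Z; exact: L2_cn].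
  move=> x _; apply: le_trans (ler_normD _ _) _; rewrite lerD2l normrM -[leRHS]mulr1.
  by rewrite ler_wpM2l//; exact: cos_max.
split; first exact: LM.
move=> r Lr rK.
have -> : ip 0 1 r (fun x => (k + l * cn 1 x) * T x) = ip 0 1 (fun x => (k + l * cn 1 x) * r x) T.
  by apply: eq_Rintegral => x _; rewrite mulrCA mulrA.
apply: HT; first exact: LM.
move=> j jK.
have -> : ip 0 1 (fun x => (k + l * cn 1 x) * r x) (cn j) =
   ip 0 1 r (fun x => k * cn j x + l * (cn 1 x * cn j x)).
  by apply: eq_Rintegral => x _; ring.
have L1 : L2 0 1 (fun x => cn 1 x * cn j x).
  apply: (@L2_Mbnd _ _ _ _ _ 1); [exact: L2_cn|exact: L2_measurable (L2_cn _ _ _)|].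
  by move=> x _; exact: cos_max.
rewrite ipDr//; try by apply: L2Z => //; exact: L2_cn.
rewrite !ipZr//; try exact: L2_cn.
rewrite rK ?mulr0 ?add0r; last exact: leqW.
case: j jK {L1} => [|j] jK.
  rewrite (@eq_ip _ _ _ r r _ (cn 1)) ?rK ?mulr0// => x _.
  by rewrite cn0n mulr1.
have -> : ip 0 1 r (fun x => cn 1 x * cn j.+1 x) = ip 0 1 r (fun x => 2^-1 * (cn j x + cn j.+2 x)).
  by apply: eq_Rintegral => x _; rewrite cnM// subn1/= add1n (mulrC 2^-1).
rewrite ipZr//; last by apply: L2D; exact: L2_cn.
rewrite ipDr//; try exact: L2_cn.
by rewrite !rK ?addr0 ?mulr0//; apply: ltnW; apply: ltnW.
Qed.

(* Bernstein polynomials in half_cos x are cosine polynomials, and half_cos is a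
   homeomorphism from [0, 1] onto [0, 1]. *)
Definition half_cos x : R := (1 - cn 1 x) / 2.

Lemma cosine_span_binomial n (phi : nat -> R) :
  cosine_span n (fun x => binomial_mean n phi (half_cos x)).
Proof.
elim: n phi => [|n ih] phi /=.
  split; first exact: L2_cst.
  move=> r Lr /(_ 0%N isT) r0.
  rewrite (@eq_ip _ _ _ r r _ (fun x => phi 0%N * cn 0 x))//; last first.
    by move=> x _; rewrite cn0n mulr1.
  by rewrite ipZr ?r0 ?mulr0//; exact: L2_cn.
apply: cosine_spanD.
  have := cosine_spanM 2^-1 (- 2^-1) (ih (fun k => phi k.+1)).
  rewrite (_ : (fun x => (2^-1 + _) * _) =
    (fun x => half_cos x * binomial_mean n (fun k => phi k.+1) (half_cos x)))//.
  by apply/funext => x; rewrite /half_cos; congr (_ * _); field.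
have := cosine_spanM 2^-1 2^-1 (ih phi).
rewrite (_ : (fun x => (2^-1 + _) * _) =
  (fun x => (1 - half_cos x) * binomial_mean n phi (half_cos x)))//.
by apply/funext => x; rewrite /half_cos; congr (_ * _); field.
Qed.

Lemma le_sin_middle (t0 t : R) : 0 < t0 -> t0 <= t -> t <= pi - t0 -> sin t0 <= sin t.
Proof.
have H (s0 s : R) : 0 < s0 -> s0 <= s -> s <= pi / 2 -> sin s0 <= sin s.
  move=> s00; rewrite le_eqVlt => /predU1P[-> //|s0s sp].
  by apply: ltW; rewrite ltr_sin// in_itv/=; apply/andP; split; lra.
move=> t00 t0t tp; have [h|h] := leP t (pi / 2); first exact: H.
have -> : sin t = sin (pi - t) by rewrite sinB sinpi cospi; ring.
by apply: H => //; lra.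
Qed.

(** Uniform injectivity: half_cos x - half_cos y = sin (pi (x + y) / 2) sin (pi (x - y) / 2), and
    when x - y >= de both angles stay at distance at least pi de / 2 from 0 and from pi. *)
Lemma half_cos_separation (de : R) : 0 < de -> de <= 1 ->
  exists2 eta : R, 0 < eta & forall x y, 0 <= x <= 1 -> 0 <= y <= 1 -> de <= `|x - y| ->
    eta <= `|half_cos x - half_cos y|.
Proof.
move=> de0 de1; have pi0 := @pi_gt0 R.
have s0 : 0 < sin (pi * de / 2) by apply: sin_gt0_pi; apply/andP; split; nra.
exists (sin (pi * de / 2) ^+ 2); first by rewrite exprn_gt0.
have H x y : 0 <= y -> y + de <= x -> x <= 1 -> sin (pi * de / 2) ^+ 2 <= `|half_cos x - half_cos y|.
  move=> y0 yx x1.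
  have -> : half_cos x - half_cos y = sin (pi * (x + y) / 2) * sin (pi * (x - y) / 2).
    rewrite /half_cos /cn !mul1r.
    have -> : pi * x = pi * (x + y) / 2 + pi * (x - y) / 2 by field.
    have -> : pi * y = pi * (x + y) / 2 - pi * (x - y) / 2 by field.
    by rewrite cosD cosB; field.
  rewrite expr2; apply: le_trans (ler_norm _).
  by apply: ler_pM; rewrite ?(ltW s0)//; apply: le_sin_middle; nra.
move=> x y /andP[x0 x1] /andP[y0 y1]; have [xy|yx] := leP x y.
  by rewrite ler0_norm ?subr_le0// => h; rewrite distrC; apply: H => //; lra.
by rewrite ger0_norm ?subr_ge0 ?(ltW yx)// => h; apply: H => //; lra.
Qed.

(** Bernstein approximation of [Q] in the variable [half_cos x]. Nodes near x are controlled by the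
    Hölder bound; at the others the oscillation of [Q], at most A + 1, is absorbed by the quadratic
    term, [half_cos] being separated there by [eta]. *)
Lemma cosine_approximation Q (A e : R) : 0 <= A ->
  (forall x y, (Q x - Q y) ^+ 2 <= A * `|x - y|) -> 0 < e ->
  exists n T, cosine_span n T /\ forall x, x \in `]0, 1[ -> `|T x - Q x| <= e.
Proof.
move=> A0 HQ e0; have pi0 := @pi_gt0 R.
have [e' e'0 ee] : exists2 e', 0 < e' & e = e' + e'.
  by exists (e / 2); [rewrite divr_gt0|field].
pose de := Num.min 1 (e' ^+ 2 / (A + 1)).
have A1 : 0 < A + 1 by lra.
have de0 : 0 < de by rewrite lt_min ltr01 divr_gt0// exprn_gt0.
have de1 : de <= 1 by rewrite ge_min lexx.
have de2 : A * de <= e' ^+ 2.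
  have : de <= e' ^+ 2 / (A + 1) by rewrite ge_min lexx orbT.
  rewrite ler_pdivlMr//; nra.
have [eta eta0 sep] := half_cos_separation de0 de1.
pose C := (A + 1) / eta ^+ 2.
have C0 : 0 <= C by rewrite divr_ge0 ?sqr_ge0// ltW.
have key x y : 0 <= x <= 1 -> 0 <= y <= 1 ->
    `|Q y - Q x| <= e' + C * (half_cos y - half_cos x) ^+ 2.
  move=> x01 y01; have [h|h] := ltP `|y - x| de.
    apply: (@le_trans _ _ e'); last by rewrite lerDl mulr_ge0// sqr_ge0.
    rewrite -ler_sqr ?nnegrE ?normr_ge0 ?(ltW e'0)// real_normK ?num_real//.
    apply: le_trans (HQ _ _) _; apply: le_trans de2; rewrite ler_wpM2l//; exact: ltW.
  have := sep _ _ y01 x01 h => h'.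
  apply: (@le_trans _ _ (C * (half_cos y - half_cos x) ^+ 2)); last by rewrite lerDr ltW.
  apply: (@le_trans _ _ (A + 1)).
    have := HQ y x; rewrite -(real_normK (num_real (Q y - Q x))).
    have : `|y - x| <= 1.
      by rewrite ler_norml; case/andP: x01; case/andP: y01 => *; apply/andP; split; lra.
    have := normr_ge0 (Q y - Q x); nra.
  rewrite /C mulrAC ler_pdivlMr ?exprn_gt0// ler_wpM2l ?(ltW A1)//.
  rewrite -(real_normK (num_real (half_cos y - half_cos x))).
  by rewrite ler_sqr ?nnegrE ?(ltW eta0)// normr_ge0.
have [n nC] : exists n, C / n.+1%:R <= e'.
  exists (Num.Def.trunc (C / e')).
  rewrite ler_pdivrMr ?ltr0n// mulrC -ler_pdivrMr//.
  by apply: ltW; apply: truncnS_gt.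
(* The preimage of k / (n + 1) under [half_cos]. *)
pose node (k : nat) : R := acos (1 - 2 * (k%:R / n.+1%:R)) / pi.
exists n.+1, (fun x => binomial_mean n.+1 (fun k => Q (node k)) (half_cos x)).
split; first exact: cosine_span_binomial.
move=> x xI; apply: (@le_trans _ _ (e' + C / n.+1%:R)); last by rewrite ee lerD2l.
have half01 : 0 <= half_cos x <= 1.
  rewrite /half_cos; have := @cos_le1 R (1%:R * pi * x); have := @cos_geN1 R (1%:R * pi * x).
  by rewrite -/(cn 1 x) => *; apply/andP; split; lra.
apply: binomial_mean_approx => // k kn.
have kI : -1 <= 1 - 2 * (k%:R / n.+1%:R : R) <= 1.
  have : (k%:R / n.+1%:R : R) <= 1 by rewrite ler_pdivrMr ?ltr0n// mul1r ler_nat.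
  have : 0 <= (k%:R / n.+1%:R : R) by rewrite divr_ge0.
  by move: (k%:R / n.+1%:R : R) => z *; apply/andP; split; lra.
have -> : k%:R / n.+1%:R = half_cos (node k).
  have h : cn 1 (node k) = 1 - 2 * (k%:R / n.+1%:R).
    by rewrite /cn mul1r /node (mulrC pi) divfK ?gt_eqF// acosK ?in_itv.
  by rewrite /half_cos h; move: (k%:R / n.+1%:R : R) => z; field.
apply: key.
  by move: xI; rewrite in_itv/= => /andP[/ltW -> /ltW ->].
rewrite /node divr_ge0 ?acos_ge0 ?(ltW pi0)//= ler_pdivrMr// mul1r.
exact: acos_lepi.
Qed.

End CosineApproximation.

(** * Parseval, Wirtinger and tail inequalities *)

Section Wirtinger.
Context {R : realType}.
Implicit Types (x y a e : R) (n m k L : nat) (f g r Q : R -> R).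
Local Notation mu := (@lebesgue_measure R).

Lemma orthogonal_cn m : orthogonal_family 0 m%:R (m%:R / 2 : R) cn.
Proof. by move=> i j i0 _; rewrite ip_cn. Qed.

Lemma orthogonal_sn m : orthogonal_family 0 m%:R (m%:R / 2 : R) sn.
Proof. by move=> i j i0 _; rewrite ip_sn. Qed.

Lemma ip_cst_cn n (k : R) : (0 < n)%N -> ip 0 1 (cst k) (cn n) = 0.
Proof. by move=> n0; rewrite ip_cstl ?prim_d ?(int_cn 1 n0) ?mulr0//; exact: L2_cn. Qed.

Local Notation partial_sum f F n := (fourier_sum 0 1 (1%:R / 2) f F n).

Lemma half_gt0 : 0 < (1%:R / 2 : R).
Proof. by rewrite divr_gt0. Qed.

Lemma fourier_residue01 f F n : (forall i, L2 0 1 (F i)) -> L2 0 1 f ->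
  orthogonal_family 0 1 (1%:R / 2) F ->
  ip 0 1 (fun x => f x - partial_sum f F n x) (fun x => f x - partial_sum f F n x) =
  ip 0 1 f f - 2 * (\sum_(1 <= i < n.+1) ip 0 1 f (F i) ^+ 2).
Proof.
move=> LF Lf oF; rewrite (fourier_residue n (lt0r_neq0 half_gt0) LF Lf oF).
by rewrite -mulr_suml mulrC; congr (_ - _ * _); field.
Qed.

Lemma ip_partial_sumF f F n k : (forall i, L2 0 1 (F i)) ->
  orthogonal_family 0 1 (1%:R / 2) F -> (0 < k <= n)%N ->
  ip 0 1 (partial_sum f F n) (F k) = ip 0 1 f (F k).
Proof. by move=> LF oF kn; rewrite ip_fourier_sumF// lt0r_neq0// half_gt0. Qed.

(** The residue Q - S is orthogonal to S and to the approximant T, so |Q - S|^2 = (Q - S, Q - T) and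
    Cauchy-Schwarz bounds it by |Q - T|^2 <= e. The zero mean of [Q] supplies the orthogonality to
    [cn 0], which is not among the modes of S. *)
Lemma cosine_parseval Q (A e : R) : 0 <= A -> L2 0 1 Q ->
  (forall x y, (Q x - Q y) ^+ 2 <= A * `|x - y|) -> ip 0 1 Q (cst 1) = 0 -> 0 < e ->
  exists n, ip 0 1 Q Q <= 2 * (\sum_(1 <= i < n.+1) ip 0 1 Q (cn i) ^+ 2) + e.
Proof.
move=> A0 LQ HQ Q0 e0.
have se0 : 0 < Num.sqrt e by rewrite sqrtr_gt0.
have [n [T [[LT HT] TQ]]] := cosine_approximation A0 HQ se0.
exists n.
have Lc i : L2 0 1 (cn i : R -> R) := L2_cn i 0 1.
set S := partial_sum Q cn n.
have LS : L2 0 1 S := L2_fourier_sum _ _ _ Lc.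
have := fourier_residue01 n Lc LQ (@orthogonal_cn 1).
rewrite -/S; set X := ip 0 1 _ _ => EX.
have LQS : L2 0 1 (fun x => Q x - S x) by exact: L2B.
have rcn k : (k <= n)%N -> ip 0 1 (fun x => Q x - S x) (cn k) = 0.
  move=> kn; rewrite ipBl//; case: (posnP k) => [->|k0].
    have c0 g : ip 0 1 g (cn 0) = ip 0 1 g (cst 1).
      by apply: eq_ip => // x _; rewrite cn0n.
    rewrite !c0 Q0 sub0r /S ip_fourier_sum//; last exact: L2_cst.
    rewrite big_nat big1 ?oppr0// => i /andP[i0 _].
    by rewrite (ipC _ _ (cn i)) ip_cst_cn ?mulr0.
  by rewrite /S ip_partial_sumF ?subrr ?k0//; exact: (@orthogonal_cn 1).
have XE : X = ip 0 1 (fun x => Q x - S x) (fun x => Q x - T x).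
  rewrite [RHS]ipBr// HT// subr0 /X ipBr//.
  suff -> : ip 0 1 (fun x => Q x - S x) S = 0 by rewrite subr0.
  rewrite ipC {1}/S ip_fourier_sum// big_nat big1// => i /andP[i0 ik].
  by rewrite (ipC _ _ (cn i)) rcn ?mulr0.
have QT : ip 0 1 (fun x => Q x - T x) (fun x => Q x - T x) <= e.
  have -> : e = \int[mu]_(x in `]0, 1[) cst e x.
    by rewrite Rintegral_cst//= lebesgue_measure_itv/= lte_fin ltr01/= subr0 mulr1.
  apply: le_Rintegral => //.
  - by apply: ip_integrable; exact: L2B.
  - exact: integrable_cst_itv.
  - move=> x xI; rewrite -expr2 -(real_normK (num_real (Q x - T x))) distrC -[leRHS](sqr_sqrtr (ltW e0)).
    by rewrite ler_sqr ?nnegrE ?normr_ge0 ?sqrtr_ge0// TQ.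
have X0 : 0 <= X by exact: ip_ge0.
have : X ^+ 2 <= X * e.
  rewrite {1}XE; apply: le_trans (ip_CS LQS (L2B LQ LT)) _.
  by rewrite -/X ler_wpM2l.
move=> h; have [X00|Xp] := eqVneq X 0; first by rewrite X00 in EX; lra.
have : X <= e by rewrite -(@ler_pM2l _ X) -?expr2// lt_neqAle eq_sym Xp.
by rewrite EX; lra.
Qed.

Lemma ip_prim_cn n f : (0 < n)%N -> L2 0 1 f ->
  ip 0 1 (prim 0 1 f) (cn n) = - (ip 0 1 f (sn n) / (n%:R * pi)).
Proof.
move=> n0 Lf; have c1 : prim 0 1 (cn n) 1 = 0 :> R by rewrite prim_d (int_cn 1 n0).
rewrite ipC -[LHS]opprK -(prim_by_parts0 ler01 (L2_cn n 0 1) Lf c1); congr (- _).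
rewrite mulrC -ipZr//; last exact: L2_sn.
by rewrite ipC; apply: eq_ip => // x /subset_itv_oo_cc x01; rewrite prim_cn// mulrC.
Qed.

Lemma ip_prim_sn n f : (0 < n)%N -> L2 0 1 f -> prim 0 1 f 1 = 0 ->
  ip 0 1 (prim 0 1 f) (sn n) = ip 0 1 f (cn n) / (n%:R * pi).
Proof.
move=> n0 Lf f0; rewrite (prim_by_parts0 ler01 Lf (L2_sn n 0 1) f0).
have L1 := @L2_cst R 0 1 1; have Lc := L2_cn n 0 1 : L2 0 1 (cn n : R -> R).
rewrite (@eq_ip _ _ _ f f (prim 0 1 (sn n)) (fun x => (n%:R * pi)^-1 * (cst 1 x - cn n x)))//.
  rewrite ipZr ?ipBr//; last exact: L2B.
  by rewrite ip1r -prim_d f0 sub0r mulrN opprK mulrC.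
by move=> x /subset_itv_oo_cc x01; rewrite prim_sn// mulrC.
Qed.

Definition mean f : R := ip 0 1 f (cst 1).

(** A primitive turns the sine coefficients of [f] into cosine coefficients of a Hölder function;
    subtracting its mean makes [cosine_parseval] applicable. *)
Lemma centered_prim f : L2 0 1 f -> let Q x := prim 0 1 f x - mean (prim 0 1 f) in
  [/\ L2 0 1 Q, forall x y, (Q x - Q y) ^+ 2 <= ip 0 1 f f * `|x - y|,
      ip 0 1 Q (cst 1) = 0 &
      forall n, (0 < n)%N -> ip 0 1 Q (cn n) = - (ip 0 1 f (sn n) / (n%:R * pi))].
Proof.
move=> Lf Q; have Lp : L2 0 1 (prim 0 1 f) by exact: L2_prim.
have Lc (k : R) : L2 0 1 (cst k) by exact: L2_cst.
split.
- exact: L2B Lp (Lc _).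
- move=> x y; rewrite (_ : Q x - Q y = prim 0 1 f x - prim 0 1 f y); last by rewrite /Q; ring.
  exact: prim_holder.
- rewrite /Q ipBl; [|exact: Lp|exact: Lc|exact: Lc].
  rewrite [X in _ - X]ip1r Rintegral_cst//= lebesgue_measure_itv/= lte_fin ltr01/=.
  by rewrite subr0 mulr1 subrr.
- move=> n n0; rewrite /Q ipBl; [|exact: Lp|exact: Lc|exact: L2_cn].
  by rewrite ip_cst_cn// subr0 ip_prim_cn.
Qed.

(** Every cosine coefficient of the centered primitive vanishes, so by Parseval the primitive is
    constant. *)
Lemma sine_uniqueness f : L2 0 1 f ->
  (forall n, (0 < n)%N -> ip 0 1 f (sn n) = 0) -> ae_eq_on 0 1 f (cst 0).
Proof.
move=> Lf f0; have [LQ HQ Q0 Qn] := centered_prim Lf.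
set Q := (fun x => _) in LQ HQ Q0 Qn.
have A0 := ip_ge0 0 1 f.
have QQ0 : ip 0 1 Q Q = 0.
  apply/eqP; rewrite eq_le ip_ge0 andbT; apply/ler_addgt0Pr => e e0.
  have [n] := cosine_parseval A0 LQ HQ Q0 e0.
  rewrite big_nat big1 ?mulr0// => i /andP[i0 _].
  by rewrite Qn// f0// mul0r oppr0 expr0n.
apply: (@prim_eq0 _ _ _ _ (mean (prim 0 1 f))) => // x /subset_itv_oo_cc x01.
apply: (@ae_eq_continuous _ 0 1 (prim 0 1 f) (cst (mean (prim 0 1 f))) x) => //.
- by apply: within_continuous; exact: prim_continuous.
- by apply: within_continuous => y; exact: cvg_cst.
- by move: (ip_eq0 LQ QQ0); apply: ae_imp => y h /h /eqP; rewrite subr_eq0 => /eqP.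
Qed.

(** With f the primitive of [r] and Q the centered primitive of f, Parseval for Q and Bessel for f
    give |Q|^2 <= q |f|^2. Integration by parts gives |f|^2 = - (Q, r), so |f|^4 <= q |f|^2
    |r|^2. *)
Lemma high_frequency_wirtinger r L : L2 0 1 r -> prim 0 1 r 1 = 0 ->
  (forall n, (0 < n <= L)%N -> ip 0 1 (prim 0 1 r) (sn n) = 0) ->
  ip 0 1 (prim 0 1 r) (prim 0 1 r) <= ip 0 1 r r / (L.+1%:R * pi) ^+ 2.
Proof.
move=> Lr r1 rL; set f := prim 0 1 r; have Lf : L2 0 1 f by exact: L2_prim.
have pi0 := @pi_gt0 R.
have [LQ HQ Q0 Qn] := centered_prim Lf.
set Q := (fun x => _) in LQ HQ Q0 Qn.
have A0 := ip_ge0 0 1 f.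
set q := ((L.+1%:R * pi) ^+ 2)^-1.
have q0 : 0 < q by rewrite invr_gt0 exprn_gt0// mulr_gt0// ltr0n.
have QQ : ip 0 1 Q Q <= q * ip 0 1 f f.
  apply/ler_addgt0Pr => e e0.
  have [n] := cosine_parseval A0 LQ HQ Q0 e0 => /le_trans; apply; rewrite lerD2r.
  have := bessel n half_gt0 (fun i => L2_sn i 0 1) Lf (@orthogonal_sn 1).
  rewrite -(ler_pM2l q0) => h.
  apply: (@le_trans _ _ (2 * (q * \sum_(1 <= i < n.+1) ip 0 1 f (sn i) ^+ 2))); last first.
    by move: h; rewrite mulrCA mul1r; lra.
  rewrite ler_wpM2l// mulr_sumr !big_nat; apply: ler_sum => i /andP[i0 iL].
  rewrite Qn// sqrrN exprMn mulrC; case: (leqP i L) => [iL'|Li].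
    by rewrite rL ?i0// expr0n !mulr0.
  rewrite ler_wpM2r ?sqr_ge0// /q -exprVn ler_sqr ?nnegrE ?invr_ge0 ?mulr_ge0 ?(ltW pi0)//.
  by rewrite lef_pV2 ?posrE ?mulr_gt0 ?ltr0n// ler_pM2r// ler_nat.
have ff : ip 0 1 f f = - ip 0 1 Q r.
  rewrite (prim_by_parts0 ler01 Lr Lf r1) (ipC _ _ r) /Q ipBl//; [|exact: L2_prim|exact: L2_cst].
  by rewrite -[fun=> mean _]/(cst _) ip_cstl// r1 mulr0 subr0.
have f4 : ip 0 1 f f ^+ 2 <= (q * ip 0 1 f f) * ip 0 1 r r.
  rewrite {1}ff sqrrN; apply: le_trans (ip_CS LQ Lr) _.
  by rewrite ler_wpM2r// ip_ge0.
have [f00|fp] := eqVneq (ip 0 1 f f) 0.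
  by rewrite f00 mulr_ge0 ?ip_ge0// ltW.
have {}fp : 0 < ip 0 1 f f by rewrite lt_neqAle eq_sym fp.
by rewrite -(ler_pM2l fp) -expr2; apply: le_trans f4 _; rewrite -/q (mulrC (ip 0 1 r r)) mulrCA mulrA.
Qed.

(** For f the primitive of [r], f(x)^2 is twice the integral of f r over [0, x]. This interpolation
    later bounds the velocity at [a]. *)
Lemma prim_sqr_le r x : L2 0 1 r -> x \in `[0, 1] ->
  prim 0 1 r x ^+ 2 <=
  2 * Num.sqrt (ip 0 1 (prim 0 1 r) (prim 0 1 r)) * Num.sqrt (ip 0 1 r r).
Proof.
move=> Lr; rewrite in_itv/= => /andP[x0 x1].
have Lr' := L2_sub (lexx 0) x1 Lr.
have Lp : L2 0 1 (prim 0 1 r) by exact: L2_prim.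
have E y : y <= x -> prim 0 x r y = prim 0 1 r y.
  by move=> yx; rewrite !primE// (le_trans yx).
have h := prim_by_parts x0 Lr' Lr'.
rewrite E// (ipC _ _ r) -expr2 in h; rewrite -h.
have -> : ip 0 x (prim 0 x r) r = ip 0 x (prim 0 1 r) r.
  by apply: eq_ip => // y; rewrite in_itv/= => /andP[_ /ltW /E].
have Lp' := L2_sub (lexx 0) x1 Lp.
have := ip_norm_le Lp' Lr'; move=> /(le_trans (ler_norm _)) h2.
apply: (@le_trans _ _ (2 * ip 0 x (prim 0 1 r) r)); first by rewrite mulr_natl mulr2n.
rewrite -mulrA ler_wpM2l//; apply: le_trans h2 _.
by apply: ler_pM; rewrite ?sqrtr_ge0// ler_sqrt ?ip_ge0//; apply: ip_itv_le.
Qed.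

(* Splitting off the first L frequencies of a primitive leaves a function to
   which the high frequency Wirtinger inequality applies. *)
Lemma sine_tail r L : L2 0 1 r -> prim 0 1 r 1 = 0 ->
  ip 0 1 (prim 0 1 r) (prim 0 1 r) <=
    2 * (\sum_(1 <= i < L.+1) ip 0 1 (prim 0 1 r) (sn i) ^+ 2)
    + ip 0 1 r r / (L.+1%:R * pi) ^+ 2.
Proof.
move=> Lr r1; set f := prim 0 1 r; have Lf : L2 0 1 f by exact: L2_prim.
have Lc i : L2 0 1 (cn i : R -> R) := L2_cn i 0 1.
have Ls i : L2 0 1 (sn i : R -> R) := L2_sn i 0 1.
pose S := partial_sum f sn L.
pose C := partial_sum r cn L.
have LC : L2 0 1 C by exact: L2_fourier_sum.
have LS : L2 0 1 S by exact: L2_fourier_sum.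
have SC x : x \in `[0, 1] -> S x = prim 0 1 C x.
  move=> x01; rewrite /S /C /fourier_sum /prim ip_suml; last exact: L2_chi.
    rewrite !big_nat; apply: eq_bigr => i /andP[i0 _].
    rewrite ipZl//; last exact: L2_chi.
    rewrite -/(prim 0 1 (cn i) x) prim_cn// /f ip_prim_sn//; ring.
  by move=> i; exact: L2Z.
have LrC : L2 0 1 (fun x => r x - C x) by exact: L2B.
have fS x : x \in `[0, 1] -> f x - S x = prim 0 1 (fun x => r x - C x) x.
  by move=> x01; rewrite SC// primB.
have one01 : (1 : R) \in `[0, 1] by rewrite in_itv/= ler01 lexx.
have rC1 : prim 0 1 (fun x => r x - C x) 1 = 0.
  rewrite -fS// /f r1 /S /fourier_sum big1 ?subr0// => i _.
  by rewrite (_ : sn i 1 = 0) ?mulr0// -(sn_nat i 1).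
have E : ip 0 1 (fun x => f x - S x) (fun x => f x - S x) =
    ip 0 1 (prim 0 1 (fun x => r x - C x)) (prim 0 1 (fun x => r x - C x)).
  by apply: eq_ip => x /subset_itv_oo_cc x01; rewrite fS.
have := @high_frequency_wirtinger _ L LrC rC1.
rewrite -E fourier_residue01//; last exact: (@orthogonal_sn 1).
move=> H; rewrite -lerBlDl; apply: le_trans (H _) _.
  move=> n nL; rewrite (@eq_ip _ _ _ _ (fun x => f x - S x) _ (sn n))//; last first.
    by move=> x /subset_itv_oo_cc x01; rewrite fS.
  rewrite ipBl// /S ip_partial_sumF ?subrr//; exact: (@orthogonal_sn 1).
rewrite ler_wpM2r ?invr_ge0 ?sqr_ge0// fourier_residue01//; last exact: (@orthogonal_cn 1).
by rewrite gerBl mulr_ge0// sumr_ge0// => i _; exact: sqr_ge0.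
Qed.

(** The residue [rho] satisfies |rho|^2 = (rho, r). Integrating by parts, the regular part of [r]
    meets the primitive of [rho] in norm and the jump meets it at [a]. Wirtinger's inequality gives
    this primitive a norm at most q |rho| and, by interpolation, a squared value at [a] at most 2 q
    |rho|^2: the jump costs a factor q where the regular part costs q^2. *)
Lemma cosine_tail r g a c al q L : q = (L.+1%:R * pi)^-1 -> 0 <= a <= 1 -> L2 0 1 r -> L2 0 1 g ->
  prim 0 1 r 1 = 0 ->
  ae_eq_on 0 1 r (fun x => c + prim 0 1 g x + al * (1 - chi a x)) ->
  ip 0 1 r r <= 2 * (\sum_(1 <= i < L.+1) ip 0 1 r (cn i) ^+ 2)
    + 2 * q ^+ 2 * ip 0 1 g g + 4 * q * al ^+ 2.
Proof.
move=> qE /andP[a0 a1] Lr Lg r1 rE; have pi0 := @pi_gt0 R.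
have q0 : 0 < q by rewrite qE invr_gt0 mulr_gt0// ltr0n.
have Lc i : L2 0 1 (cn i : R -> R) := L2_cn i 0 1.
pose C := partial_sum r cn L.
have LC : L2 0 1 C by exact: L2_fourier_sum.
have := fourier_residue01 L Lc Lr (@orthogonal_cn 1).
rewrite -/C => EX.
have LrC : L2 0 1 (fun x => r x - C x) by exact: L2B.
have [rho [Lrho rhoE]] : exists rho, L2 0 1 rho /\ rho = (fun x => r x - C x) by exists (fun x => r x - C x).
rewrite -rhoE in EX.
have rhoc n : (0 < n <= L)%N -> ip 0 1 rho (cn n) = 0.
  move=> nL; rewrite rhoE ipBl// /C ip_partial_sumF ?subrr//; exact: (@orthogonal_cn 1).
have L1 := @L2_cst R 0 1 1.
have rho1 : prim 0 1 rho 1 = 0.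
  rewrite rhoE primB// r1 sub0r /C prim_d -ip1r ip_fourier_sum// big_nat big1 ?oppr0// => i /andP[i0 _].
  by rewrite (ipC _ _ (cn i)) ip_cst_cn// mulr0.
have W : ip 0 1 (prim 0 1 rho) (prim 0 1 rho) <= ip 0 1 rho rho * q ^+ 2.
  rewrite qE exprVn; apply: high_frequency_wirtinger => // n nL.
  by rewrite ip_prim_sn ?rhoc ?mul0r//; case/andP: nL.
have LRho : L2 0 1 (prim 0 1 rho) by exact: L2_prim.
have X : ip 0 1 rho rho = - ip 0 1 (prim 0 1 rho) g - al * prim 0 1 rho a.
  have -> : ip 0 1 rho rho = ip 0 1 rho r.
    rewrite {2}rhoE ipBr// (ipC _ _ rho C) /C ip_fourier_sum// big_nat big1 ?subr0// => i /andP[i0 iL].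
    by rewrite (ipC _ _ (cn i)) rhoc ?mulr0// i0.
  have Lpg : L2 0 1 (prim 0 1 g) by exact: L2_prim.
  have La : L2 0 1 (fun x => 1 - chi a x) by apply: L2B => //; exact: L2_chi.
  have aeE : ae_eq_on 0 1 r (fun x => (c * cst 1 x + prim 0 1 g x) + al * (1 - chi a x)).
    by move: rE; apply: ae_imp => x h /h ->; rewrite mulr1.
  have L3 := L2D (L2D (L2Z c L1) Lpg) (L2Z al La).
  rewrite ipC (ae_eq_ipl Lr L3 Lrho aeE) ipC.
  rewrite ipDr//; [|by apply: L2D => //; exact: L2Z|exact: L2Z].
  rewrite ipDr//; last exact: L2Z.
  rewrite !ipZr// ip1r -prim_d rho1 mulr0 add0r ipBr//; last exact: L2_chi.
  rewrite ip1r -prim_d rho1 sub0r -/(prim 0 1 rho a) mulrN; congr (_ - _).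
  by rewrite (prim_by_parts0 ler01 Lrho Lg rho1) opprK.
have X0 := ip_ge0 0 1 rho; have g0 := ip_ge0 0 1 g.
have a01 : a \in `[0, 1] by rewrite in_itv/= a0.
have A2 := prim_sqr_le Lrho a01.
have CS := ip_CS LRho Lg.
suff : ip 0 1 rho rho <= 2 * q ^+ 2 * ip 0 1 g g + 4 * q * al ^+ 2.
  rewrite EX; move: (\sum_(_ <= _ < _) _) (ip 0 1 r r) (2 * q ^+ 2 * _) (4 * q * _).
  by move=> *; lra.
move: (ip 0 1 rho rho) (ip 0 1 g g) (prim 0 1 rho a) (ip 0 1 (prim 0 1 rho) g)
  (ip 0 1 (prim 0 1 rho) (prim 0 1 rho)) W X X0 g0 A2 CS (ip_ge0 0 1 (prim 0 1 rho)).
(* [V], [G] and [Z] are the squared norms of [rho], [g] and the primitive of [rho]; [P] is the value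
   of that primitive at [a], and [D] its pairing with [g]. *)
move=> {EX rhoc rho1} V G P D Z W X X0 g0 A2 CS Z0.
have sV : Num.sqrt Z <= q * Num.sqrt V.
  apply: (@le_trans _ _ (Num.sqrt (q ^+ 2 * V))); first by apply: ler_wsqrtr; rewrite mulrC.
  by rewrite sqrtrM ?sqr_ge0// sqrtr_sqr ger0_norm// ltW.
have P2 : P ^+ 2 <= 2 * q * V.
  apply: le_trans A2 _; rewrite -mulrA -[X in _ <= X]mulrA ler_wpM2l//.
  rewrite -[X in _ <= _ * X](sqr_sqrtr X0) expr2 mulrA ler_wpM2r ?sqrtr_ge0//; exact: sV.
have D2 : D ^+ 2 <= (q ^+ 2 * V) * G.
  by apply: le_trans CS _; rewrite ler_wpM2r// mulrC.
have [V0|Vp] := eqVneq V 0.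
  rewrite V0; apply: addr_ge0; apply: mulr_ge0 => //; last exact: sqr_ge0.
    by apply: mulr_ge0 => //; exact: sqr_ge0.
  by apply: mulr_ge0 => //; exact: ltW.
have {}Vp : 0 < V by rewrite lt_neqAle eq_sym Vp.
(* Convexity of the square; dividing by [V] at the end leaves the constants 2 and 4. *)
have h1 : V ^+ 2 <= 2 * D ^+ 2 + 2 * (al * P) ^+ 2.
  rewrite {1}X; have : 0 <= (D - al * P) ^+ 2 by exact: sqr_ge0.
  move: (al * P) => y; rewrite !expr2; lra.
have h2 : (al * P) ^+ 2 <= al ^+ 2 * (2 * q * V) by rewrite exprMn ler_wpM2l// sqr_ge0.
rewrite -(ler_pM2l Vp) -expr2; apply: le_trans h1 _.
move: D2 h2; move: (D ^+ 2) ((al * P) ^+ 2) => y z D2 h2.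
apply: (@le_trans _ _ (2 * (q ^+ 2 * V * G) + 2 * (al ^+ 2 * (2 * q * V)))); first lra.
by rewrite le_eqVlt; apply/orP; left; apply/eqP; ring.
Qed.

End Wirtinger.

(** * The domain of the generator *)

Section Gluing.
Context {R : realType}.
Implicit Types (a c d x : R) (f g : R -> R).
Local Notation mu := (@lebesgue_measure R).

Lemma ae_eq_on_glue c a d f g : ae_eq_on c a f g -> ae_eq_on a d f g ->
  ae_eq_on c d f g.
Proof.
move=> h1 h2; have h3 : {ae mu, forall x, x != a}.
  exists [set a]; split => //; first exact: lebesgue_measure_set1.
  by move=> x /= /negP; rewrite negbK => /eqP.
move: (ae_imp2 (fun x => @conj _ _) h1 h2) h3; apply: ae_imp2 => x [p1 p2] xa.
rewrite in_itv/= => /andP[cx xd]; have [lt|gt|e] := ltgtP x a.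
- by apply: p1; rewrite in_itv/= cx.
- by apply: p2; rewrite in_itv/= gt.
- by rewrite e eqxx in xa.
Qed.

Definition glue c a d f g x : R := (f \_ `]c, a[) x + (g \_ `]a, d[) x.

Lemma L2_patch c d c' d' f : c <= c' -> d' <= d -> L2 c' d' f -> L2 c d (f \_ `]c', d'[).
Proof.
move=> cc dd; rewrite /L2/= (_ : (f \_ `]c', d'[) \_ `]c, d[ = f \_ `]c', d'[)//.
apply/funext => x; rewrite !patchE !mem_setE !in_itv/=.
case: ifPn => // /negP h; case: ifPn => // /andP[h1 h2]; exfalso; apply: h.
by rewrite (le_lt_trans cc h1) (lt_le_trans h2 dd).
Qed.

Lemma L2_glue c a d f g : c <= a -> a <= d -> L2 c a f -> L2 a d g -> L2 c d (glue c a d f g).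
Proof. by move=> ca ad Lf Lg; apply: L2D; exact: L2_patch. Qed.

Lemma glue_l c a d f g x : x \in `]c, a[ -> glue c a d f g x = f x.
Proof.
move=> xca; rewrite /glue !patchE !mem_setE xca ifF ?addr0//.
by move: xca; rewrite !in_itv/= => /andP[_ /ltW xa]; rewrite ltNge xa.
Qed.

Lemma glue_r c a d f g x : x \in `]a, d[ -> glue c a d f g x = g x.
Proof.
move=> xad; rewrite /glue !patchE !mem_setE xad ifF ?add0r//.
by move: xad; rewrite !in_itv/= => /andP[/ltW ax _]; rewrite [x < a]ltNge ax andbF.
Qed.

Lemma ip_glue c a d f g : c <= a -> a <= d -> L2 c a f -> L2 a d g ->
  ip c d (glue c a d f g) (glue c a d f g) = ip c a f f + ip a d g g.
Proof.
move=> ca ad Lf Lg; have L := L2_glue ca ad Lf Lg.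
rewrite (ip_cat L L ca ad); congr (_ + _).
  by apply: eq_ip => x h; rewrite glue_l.
by apply: eq_ip => x h; rewrite glue_r.
Qed.

Lemma eq_prim c d f g x : {in `]c, d[, f =1 g} -> prim c d f x = prim c d g x.
Proof. by move=> fg; exact: eq_ip. Qed.

Lemma prim_sub_l c a d f x : x <= a -> a <= d -> prim c d f x = prim c a f x.
Proof. by move=> xa ad; rewrite !primE// (le_trans xa). Qed.

Lemma prim_sub_r c a d f x : L2 c d f -> c <= a -> a <= x -> x <= d ->
  prim c d f x = prim c d f a + prim a d f x.
Proof.
move=> Lf ca ax xd; apply/eqP; rewrite addrC -subr_eq; apply/eqP.
by rewrite primB_int// primE.
Qed.

End Gluing.

(** * The operator in terms of primitives *)

Section Generator.
Context {R : realType}.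
Implicit Types (a x : R) (f g p u v : R -> R) (U W : @state R).
Local Notation mu := (@lebesgue_measure R).

Lemma test_function_derive1 c d p : test_function c d p -> test_function c d (derive1 p).
Proof.
move=> [dp cp sp].
have sub : [set x | derive1 p x != 0] `<=` closure [set x | p x != 0].
  move=> x /= px; apply: contrapT => xs.
  have : \forall y \near x, ~ closure [set x | p x != 0] y.
    by apply: open_nbhs_nbhs; split => //; apply: closed_openC; exact: closed_closure.
  move=> nx; have : is_derive x (1 : R) p 0.
    apply: (@is_derive_near _ _ (fun=> 0)).
    near=> y; apply/esym/eqP; apply: contrapT => /negP py.
    by apply: (near nx y) => //; exact: subset_closure.
  by move=> /derive1_val E; rewrite E eqxx in px.
have csub : closure [set x | derive1 p x != 0] `<=` closure [set x | p x != 0].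
  by rewrite [X in _ `<=` X](closure_id _).1; [exact: closureS|exact: closed_closure].
split.
- by move=> n x; have := dp n.+1 x; rewrite derive1n_derive1.
- by apply: (subclosed_compact _ cp csub); exact: closed_closure.
- exact: subset_trans csub sp.
Unshelve. all: by end_near. Qed.

Lemma L2_jump a c d : L2 c d (fun x => 1 - chi a x).
Proof. by apply: L2B; [exact: (@L2_cst _ _ _ 1)|exact: L2_chi]. Qed.

(* Pairing with p'' and integrating by parts once turns the Dirac mass into a
   jump of the first derivative. *)
Lemma second_component_weak a U g : 0 < a < 1 -> H10 0 1 U.1 -> L2 0 1 g ->
  is_A1_second_component a U g <->
  is_weak_derivative 0 1 (fun x => wderiv 0 1 U.1 x - crep 0 1 U.2 a * (1 - chi a x)) g.
Proof.
move=> /andP[a0 a1] HU Lg; have [Lu Lux uE ux1 _] := H10_prim ltr01 HU.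
set ux := wderiv 0 1 U.1 in Lux uE ux1 *; set al := crep 0 1 U.2 a.
have a01 : a \in `[0, 1] by rewrite in_itv/= !ltW.
have key p : test_function 0 1 p ->
    ip 0 1 U.1 (derive1n 2 p) - al * p a =
    - ip 0 1 (fun x => ux x - al * (1 - chi a x)) (derive1 p).
  move=> tp; have tp' := test_function_derive1 tp.
  have [Lp Lp'] := test_L2 ltr01 tp; have [_ Lp''] := test_L2 ltr01 tp'.
  have -> : ip 0 1 U.1 (derive1n 2 p) = ip 0 1 (prim 0 1 ux) (derive1 (derive1 p)).
    by apply: ae_eq_ip => //; [exact: L2_prim|exact: eq_ae_eq_on].
  rewrite (prim_test ltr01)// ipBl//; last by apply: L2Z; exact: L2_jump.
  rewrite ipZl//; last exact: L2_jump.
  rewrite ipBl; [|exact: (@L2_cst _ _ _ 1)|exact: L2_chi|exact: Lp'].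
  rewrite -[ip 0 1 (fun=> 1) _]/(ip 0 1 (cst 1) (derive1 p)) (cst_test 1 ltr01 tp) sub0r.
  rewrite (test_function_prim_derive1 ltr01 tp a01) /prim (ipC _ _ (chi a)); ring.
split=> H p tp.
  rewrite -[LHS]/(ip 0 1 _ (derive1 p)).
  by have := H p tp; have := key p tp; rewrite /ip => -> ->; rewrite opprK.
have := H p tp; have := key p tp; rewrite /ip => -> ->.
by rewrite opprK.
Qed.

(* For U = (u, v) in the domain and W its image under the operator: u and v are the
   primitives of ux and vx, al = v(a), and ux jumps by al at a. *)
Record generator_data a U W (ux vx : R -> R) (al c : R) : Prop := {
  gd_L2u : L2 0 1 U.1; gd_L2v : L2 0 1 U.2;
  gd_L2w : L2 0 1 W.1; gd_L2g : L2 0 1 W.2;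
  gd_L2ux : L2 0 1 ux; gd_L2vx : L2 0 1 vx;
  gd_u : ae_eq_on 0 1 U.1 (prim 0 1 ux); gd_u1 : prim 0 1 ux 1 = 0;
  gd_v : ae_eq_on 0 1 U.2 (prim 0 1 vx); gd_v1 : prim 0 1 vx 1 = 0;
  gd_w : ae_eq_on 0 1 W.1 (prim 0 1 vx);
  gd_al : al = prim 0 1 vx a;
  gd_ux : ae_eq_on 0 1 ux (fun x => c + prim 0 1 W.2 x + al * (1 - chi a x));
  gd_uxE : ux = wderiv 0 1 U.1; gd_vxE : vx = wderiv 0 1 W.1;
  gd_alE : al = crep 0 1 W.1 a }.

(** The constant [c] comes from [weak_derivativeP] and is u_x(0+). The velocity at [a] is read on
    [W.1], equal to v almost everywhere, because evaluation at [a] is bounded on first components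
    only. *)
Lemma A1_data a U W : 0 < a < 1 -> A1 a U W -> exists ux vx al c,
  generator_data a U W ux vx al c.
Proof.
move=> a01 [[[HU _ _ HU2] _] [HW LW2] WU2 SC].
have [Lu Lux uE ux1 _] := H10_prim ltr01 HU.
have [Lw Lvx wE vx1 crepW] := H10_prim ltr01 HW.
have [Lv _ _ _ _] := H10_prim ltr01 HU2.
have a01' : a \in `[0, 1] by move: a01; rewrite in_itv/= => /andP[/ltW -> /ltW ->].
have alE : crep 0 1 U.2 a = prim 0 1 (wderiv 0 1 W.1) a.
  apply: (@crepE _ 0 1) => //; first by apply: within_continuous; exact: prim_continuous.
  exact: ae_eq_on_trans (ae_eq_on_sym wE) WU2.
have Lj : L2 0 1 (fun x => wderiv 0 1 U.1 x - crep 0 1 U.2 a * (1 - chi a x)).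
  by apply: L2B => //; apply: L2Z; exact: L2_jump.
have := (second_component_weak a01 HU LW2).1 SC.
move=> /(weak_derivativeP ltr01 Lj LW2)[c cE].
have vE := ae_eq_on_trans (ae_eq_on_sym WU2) wE.
have uxE : ae_eq_on 0 1 (wderiv 0 1 U.1)
    (fun x => c + prim 0 1 W.2 x + crep 0 1 U.2 a * (1 - chi a x)).
  by move: cE; apply: ae_imp => x h xI; rewrite -(h xI) subrK.
have crepE' : crep 0 1 U.2 a = crep 0 1 W.1 a by rewrite crepW.
exists (wderiv 0 1 U.1), (wderiv 0 1 W.1), (crep 0 1 U.2 a), c.
exact: (Build_generator_data Lu Lv Lw LW2 Lux Lvx uE ux1 vE vx1 wE alE uxE erefl erefl crepE').
Qed.

Lemma X1norm_sqr U : X1 U -> X1norm U ^+ 2 =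
  ip 0 1 (wderiv 0 1 U.1) (wderiv 0 1 U.1) + ip 0 1 U.2 U.2.
Proof.
move=> [HU LU2]; have [Lu Lux _ _ _] := H10_prim ltr01 HU.
rewrite /X1norm sqr_sqrtr ?addr_ge0 ?sqr_ge0//.
by rewrite /H10norm !L2norm_sqr.
Qed.

Lemma X1norm_ge0 U : 0 <= X1norm U.
Proof. exact: sqrtr_ge0. Qed.

(** Wirtinger's inequality with no frequency removed, its constant 1 / pi^2 being relaxed to 1. *)
Lemma poincare (u r : R -> R) : L2 0 1 u -> L2 0 1 r ->
  ae_eq_on 0 1 u (prim 0 1 r) -> prim 0 1 r 1 = 0 -> ip 0 1 u u <= ip 0 1 r r.
Proof.
move=> Lu Lr uE r1; have Lp : L2 0 1 (prim 0 1 r) by exact: L2_prim.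
rewrite (ae_eq_ip Lu Lp Lu Lp uE uE).
have := @high_frequency_wirtinger R r 0 Lr r1.
have H n : (0 < n <= 0)%N -> ip 0 1 (prim 0 1 r) (sn n) = 0.
  by case: n.
move=> /(_ H) /le_trans; apply; rewrite mul1r ler_pdivrMr ?exprn_gt0 ?pi_gt0//.
have p1 : 1 <= pi ^+ 2 :> R by rewrite expr_ge1// (le_trans _ (pi_ge2 _))// ler1n.
by rewrite -[leLHS]mulr1 ler_wpM2l// ip_ge0.
Qed.

(** The image is (v, g), where g glues the second derivatives of u on both sides of [a]; both energy
    norms are then bounded by pieces of the domain norm. *)
Lemma DA1_image a U : 0 < a < 1 -> DA1 a U ->
  exists W, [/\ A1 a U W, X1 U, X1norm W <= DA1norm a U & X1norm U <= DA1norm a U].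
Proof.
move=> a01 DU; have [[HU H2l H2r HU2] J] := DU.
have /andP[a0 a1] := a01.
have [Lu Lux uE ux1 _] := H10_prim ltr01 HU.
have [Lv Lvx vE vx1 _] := H10_prim ltr01 HU2.
have a0' := ltW a0; have a1' := ltW a1.
have [H1l H1dl] := H2l; have [H1r H1dr] := H2r.
have [Lul Ldl ulE _] := H1_prim a0 H1l.
have [Lur Ldr urE _] := H1_prim a1 H1r.
have [_ Lddl dlE dlC] := H1_prim a0 H1dl.
have [_ Lddr drE _] := H1_prim a1 H1dr.
set ux := wderiv 0 1 U.1 in Lux uE ux1.
set dl := wderiv 0 a U.1 in H1dl Ldl ulE Lddl dlE dlC J.
set dr := wderiv a 1 U.1 in H1dr Ldr urE Lddr drE J.
set ddl := wderiv 0 a dl in Lddl dlE dlC; set ddr := wderiv a 1 dr in Lddr drE.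
(* The weak derivatives taken on each side agree with the one taken on ]0, 1[. *)
have uxl : ae_eq_on 0 a dl ux.
  have Luxl := L2_sub (lexx 0) a1' Lux.
  apply: (wderivE a0 Lul Luxl (k := 0) _).2.
  move: (ae_eq_on_sub (lexx 0) a1' uE); apply: ae_imp => x h xI; rewrite h// add0r.
  by apply: prim_sub_l => //; move: xI; rewrite in_itv/= => /andP[_ /ltW].
have uxr : ae_eq_on a 1 dr ux.
  have Luxr := L2_sub a0' (lexx 1) Lux.
  apply: (wderivE a1 Lur Luxr (k := prim 0 1 ux a) _).2.
  move: (ae_eq_on_sub a0' (lexx 1) uE); apply: ae_imp => x h xI; rewrite h//.
  by move: xI; rewrite in_itv/= => /andP[/ltW ax /ltW x1]; exact: prim_sub_r.
pose g := glue 0 a 1 ddl ddr.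
have Lg : L2 0 1 g by exact: L2_glue.
pose al := crep 0 1 U.2 a.
have crepl := dlC a; rewrite in_itv/= a0' lexx in crepl; have {}crepl := crepl isT.
have Lj : L2 0 1 (fun x => ux x - al * (1 - chi a x)).
  by apply: L2B => //; apply: L2Z; exact: L2_jump.
have gE : ae_eq_on 0 1 (fun x => ux x - al * (1 - chi a x))
    (fun x => crep 0 a dl 0 + prim 0 1 g x).
  apply: (@ae_eq_on_glue _ 0 a 1).
    move: (ae_eq_on_trans (ae_eq_on_sym uxl) dlE); apply: ae_imp => x h xI; rewrite h//.
    move: xI; rewrite in_itv/= => /andP[x0 xa]; rewrite /chi xa subrr mulr0 subr0.
    congr (_ + _); rewrite (prim_sub_l _ _ (ltW xa) a1').
    by apply: eq_prim => y yI; rewrite /g glue_l.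
  move: (ae_eq_on_trans (ae_eq_on_sym uxr) drE); apply: ae_imp => x h xI; rewrite h//.
  move: xI; rewrite in_itv/= => /andP[/ltW ax /ltW x1].
  rewrite (prim_sub_r Lg a0' ax x1) (prim_sub_l _ _ (lexx a) a1').
  rewrite (@eq_prim _ a 1 g ddr); last by move=> y yI; rewrite /g glue_r.
  rewrite (@eq_prim _ 0 a g ddl); last by move=> y yI; rewrite /g glue_l.
  (* Subtracting the jump given by [J] continues the left-hand primitive across [a] with the same
     constant. *)
  rewrite /chi ltNge ax/= subr0 mulr1 /al -J crepl; ring.
exists (U.2, g); split => //.
- split => //; first exact: eq_ae_eq_on.
  apply/second_component_weak => //; apply/weak_derivativeP => //.
  by exists (crep 0 a dl 0).
- rewrite /X1norm /DA1norm ler_sqrt ?addr_ge0 ?sqr_ge0//= addrC lerD2r.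
  rewrite L2norm_sqr// ip_glue// -!L2norm_sqr// /H2norm !sqr_sqrtr ?addr_ge0 ?sqr_ge0//.
  by rewrite lerD// lerDr addr_ge0 ?sqr_ge0.
- rewrite /X1norm /DA1norm ler_sqrt ?addr_ge0 ?sqr_ge0//=; apply: lerD.
    rewrite /H10norm L2norm_sqr// (ip_cat Lux Lux a0' a1').
    have -> : ip 0 a ux ux = ip 0 a dl dl.
      have Luxl := L2_sub (lexx 0) a1' Lux.
      by apply: ae_eq_ip => //; exact: ae_eq_on_sym.
    have -> : ip a 1 ux ux = ip a 1 dr dr.
      have Luxr := L2_sub a0' (lexx 1) Lux.
      by apply: ae_eq_ip => //; exact: ae_eq_on_sym.
    rewrite -!L2norm_sqr// /H2norm !sqr_sqrtr ?addr_ge0 ?sqr_ge0//.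
    by apply: lerD; rewrite -addrA addrCA lerDl addr_ge0 ?sqr_ge0.
  rewrite /H10norm !L2norm_sqr//.
  exact: (poincare Lv Lvx vE vx1).
Qed.

End Generator.

(** * Orbits of a contraction semigroup on a seminormed space *)

Section Orbits.
Context {R : realType} {E : lmodType R} (X : set E) (N : E -> R).
Implicit Types (U V W : E) (k t s h : R) (l : E -> R).

(** [X1norm] vanishes on pairs that are null almost everywhere and may involve default values
    outside [X1]; the algebraic laws are therefore claimed on [X] only. *)
Record seminorm_on : Prop := {
  seminorm0 : X 0;
  seminorm_lin : forall k U V, X U -> X V -> X (k *: U + V);
  seminorm_ge0 : forall U, 0 <= N U;
  seminorm_triangle : forall U V, X U -> X V -> N (U + V) <= N U + N V;
  seminorm_scale : forall k U, X U -> N (k *: U) = `|k| * N U }.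

(** Orbits are differentiated only through such functionals, which keeps all calculus on real
    functions of time. *)
Definition bounded_functional l C := [/\ 0 <= C,
  forall k U V, X U -> X V -> l (k *: U + V) = k * l U + l V &
  forall U, X U -> `|l U| <= C * N U].

Context (HN : seminorm_on).

Lemma semiX_add U V : X U -> X V -> X (U + V).
Proof. by move=> HU HV; rewrite -[U]scale1r; exact: seminorm_lin. Qed.

Lemma semiX_scale k U : X U -> X (k *: U).
Proof. by move=> HU; rewrite -[k *: U]addr0; apply: seminorm_lin => //; exact: seminorm0. Qed.

Lemma semiX_opp U : X U -> X (- U).
Proof. by move=> HU; rewrite -scaleN1r; exact: semiX_scale. Qed.

Lemma semiX_sub U V : X U -> X V -> X (U - V).
Proof. by move=> HU HV; apply: semiX_add => //; exact: semiX_opp. Qed.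

Lemma seminormN U : X U -> N (- U) = N U.
Proof. by move=> HU; rewrite -scaleN1r seminorm_scale// normrN1 mul1r. Qed.

Lemma seminormB U V : X U -> X V -> N (U - V) = N (V - U).
Proof. by move=> HU HV; rewrite -seminormN ?opprB//; exact: semiX_sub. Qed.

Lemma seminorm_dist U V W : X U -> X V -> X W -> N (U - W) <= N (U - V) + N (V - W).
Proof.
move=> HU HV HW; have -> : U - W = (U - V) + (V - W) by rewrite addrA subrK.
by apply: seminorm_triangle => //; exact: semiX_sub.
Qed.

Lemma seminorm_le U V : X U -> X V -> N U <= N V + N (U - V).
Proof.
move=> HU HV; rewrite -{1}(subrK V U) addrC; apply: seminorm_triangle => //.
exact: semiX_sub.
Qed.

Lemma seminorm_zero : N 0 = 0.
Proof. by rewrite -[0 : E](scale0r 0) seminorm_scale ?normr0 ?mul0r//; exact: seminorm0. Qed.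

(* Equality in the quotient by the null vectors. *)
Definition null_eq U V := [/\ X U, X V & N (U - V) = 0].

Lemma null_refl U : X U -> null_eq U U.
Proof. by move=> HU; split => //; rewrite subrr seminorm_zero. Qed.

Lemma null_sym U V : null_eq U V -> null_eq V U.
Proof. by move=> [HU HV e]; split => //; rewrite seminormB. Qed.

Lemma null_trans U V W : null_eq U V -> null_eq V W -> null_eq U W.
Proof.
move=> [HU HV e] [_ HW f]; split => //; apply/eqP; rewrite eq_le seminorm_ge0// andbT.
by apply: (le_trans (seminorm_dist HU HV HW)); rewrite e f addr0.
Qed.

Lemma null_sub U V U' V' : null_eq U V -> null_eq U' V' -> null_eq (U - U') (V - V').
Proof.
move=> [HU HV e] [HU' HV' f]; split; [exact: semiX_sub|exact: semiX_sub|].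
apply/eqP; rewrite eq_le seminorm_ge0// andbT.
have -> : U - U' - (V - V') = (U - V) + (V' - U').
  by rewrite opprB addrACA [RHS]addrACA [- U' - V]addrC.
apply: (le_trans (seminorm_triangle HN (semiX_sub HU HV) (semiX_sub HV' HU'))).
by rewrite e seminormB// f addr0.
Qed.

Lemma null_scale k U V : null_eq U V -> null_eq (k *: U) (k *: V).
Proof.
move=> [HU HV e]; split; [exact: semiX_scale|exact: semiX_scale|].
by rewrite -scalerBr seminorm_scale ?e ?mulr0//; exact: semiX_sub.
Qed.

Lemma null_norm U V : null_eq U V -> N U = N V.
Proof.
move=> [HU HV e]; apply/eqP; rewrite eq_le.
have := seminorm_le HU HV; have := seminorm_le HV HU.
by rewrite (seminormB HV HU) e !addr0 => -> ->.
Qed.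

Lemma functionalB l C U V : bounded_functional l C -> X U -> X V ->
  l (U - V) = l U - l V.
Proof.
move=> [_ lin _] HU HV; have -> : U - V = -1 *: V + U by rewrite scaleN1r addrC.
by rewrite lin// mulN1r addrC.
Qed.

Lemma functionalZ l C k U : bounded_functional l C -> X U -> l (k *: U) = k * l U.
Proof.
move=> [_ lin _] HU; have X0 := seminorm0 HN.
have l0 : l 0 = 0 by have := lin (-1) 0 0 X0 X0; rewrite scaler0 addr0 mulN1r addNr.
by rewrite -[k *: U]addr0 lin// l0 addr0.
Qed.

Context (S : R -> E -> E) (HS : contraction_semigroup X N S).

Lemma semigroupB t U V : 0 <= t -> X U -> X V ->
  null_eq (S t (U - V)) (S t U - S t V).
Proof.
move=> t0 HU HV; have st := semigroup_stable HS t0.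
split; [exact/st/semiX_sub|by apply: semiX_sub; exact: st|].
have := semigroup_linear HS (-1) t0 HV HU.
by rewrite !scaleN1r (addrC (- V)) (addrC (- S t V)).
Qed.

Lemma semigroupZ t k U : 0 <= t -> X U -> null_eq (S t (k *: U)) (k *: S t U).
Proof.
move=> t0 HU; have st := semigroup_stable HS t0; have X0 := seminorm0 HN.
have H1 : null_eq 0 (S t 0).
  split => //; first exact: st.
  apply/eqP; rewrite sub0r seminormN ?eq_le ?seminorm_ge0//; last exact: st.
  by rewrite andbT -seminorm_zero; exact: (semigroup_contraction HS).
apply: (@null_trans _ (k *: S t U + S t 0)).
  split; [exact/st/semiX_scale| |].
    by apply: semiX_add; [apply: semiX_scale|]; exact: st.
  by rewrite -{1}[k *: U]addr0; exact: (semigroup_linear HS).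
have [_ Xt0 e] := H1; split; [apply: semiX_add => //| |]; try by apply: semiX_scale; exact: st.
by rewrite addrAC subrr add0r -seminormN// -sub0r.
Qed.

Lemma semigroupD t h U : 0 <= t -> 0 <= h -> X U -> null_eq (S (t + h) U) (S t (S h U)).
Proof.
move=> t0 h0 HU; have st := semigroup_stable HS.
split; [exact: st (addr_ge0 t0 h0) HU|exact: st (st _ _ h0 HU)|exact: (semigroup_add HS)].
Qed.

Lemma orbit_difference t h U : 0 <= t -> 0 <= h -> X U ->
  null_eq (S (t + h) U - S t U) (S t (S h U - U)).
Proof.
move=> t0 h0 HU; have st := semigroup_stable HS.
apply: null_trans (null_sub (semigroupD t0 h0 HU) (null_refl (st _ _ t0 HU))) _.
by apply/null_sym/semigroupB => //; exact: st.
Qed.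

(** Contractivity transfers the continuity at time 0 to all times, with the same modulus. *)
Lemma orbit_dist t h U : 0 <= t -> 0 <= h -> X U ->
  N (S (t + h) U - S t U) <= N (S h U - U).
Proof.
move=> t0 h0 HU; rewrite (null_norm (orbit_difference t0 h0 HU)).
by apply: (semigroup_contraction HS) => //; apply: semiX_sub => //; exact: (semigroup_stable HS).
Qed.

Lemma orbit_dist_abs t s U : 0 <= t -> 0 <= s -> X U ->
  N (S s U - S t U) <= N (S `|s - t| U - U).
Proof.
move=> t0 s0 HU; have st := semigroup_stable HS.
case: (leP t s) => ts.
  have h0 : 0 <= s - t by rewrite subr_ge0.
  by rewrite ger0_norm// -{1}(subrKC t s); exact: orbit_dist.
have h0 : 0 <= t - s by rewrite subr_ge0 ltW.
rewrite ltr0_norm ?subr_lt0// opprB seminormB; [|exact: st|exact: st].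
by rewrite -{1}(subrKC s t); exact: orbit_dist.
Qed.

Lemma max0_lipschitz s t : `|Num.max t 0 - Num.max s 0| <= `|t - s|.
Proof.
case: (leP t 0) => t0; case: (leP s 0) => s0; rewrite ?subrr ?normr0//.
  by rewrite ltr0_norm ?subr_lt0 ?ler0_norm; lra.
by rewrite subr0 !gtr0_norm; lra.
Qed.

Lemma orbit_modulus U e : X U -> 0 < e -> exists2 d, 0 < d &
  forall s t, `|t - s| < d -> N (S (Num.max t 0) U - S (Num.max s 0) U) < e.
Proof.
move=> HU e0.
have /cvgrPdist_lt/(_ _ e0) := semigroup_continuous HS HU.
rewrite near_withinE => /nbhs_ballP[d /= d0 Hd]; exists d => // s t ds.
have m0 (x : R) : 0 <= Num.max x 0 by rewrite le_max lexx orbT.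
set h := `|Num.max t 0 - Num.max s 0|.
have hd : h < d by apply: le_lt_trans ds; exact: max0_lipschitz.
have [->|hn0] := eqVneq (Num.max t 0) (Num.max s 0).
  by rewrite subrr -[0 : E](scale0r U) seminorm_scale// normr0 mul0r.
have h0 : 0 < h by rewrite normr_gt0 subr_eq0.
have := Hd h; rewrite /ball/= !sub0r !normrN [ `|h|]gtr0_norm// => /(_ hd h0).
rewrite ger0_norm; last exact: seminorm_ge0.
exact: le_lt_trans (orbit_dist_abs (m0 s) (m0 t) HU).
Qed.

Lemma orbit_continuous l C U : bounded_functional l C -> X U ->
  continuous (fun t => l (S (Num.max t 0) U)).
Proof.
move=> bl HU t; have [C0 _ lb] := bl; have st := semigroup_stable HS.
apply/cvgrPdist_lt => e e0.
have Cp : 0 < C + 1 by rewrite ltr_wpDl.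
have [d d0 Hd] := orbit_modulus HU (divr_gt0 e0 Cp).
apply/nbhs_ballP; exists d => //= s; rewrite /ball/= => ds.
have m0 (x : R) : 0 <= Num.max x 0 by rewrite le_max lexx orbT.
have Xs := st _ _ (m0 s) HU; have Xt := st _ _ (m0 t) HU.
rewrite -(functionalB bl)//; apply: (le_lt_trans (lb _ (semiX_sub Xt Xs))).
have := Hd _ _ ds; rewrite ltr_pdivlMr//; apply: le_lt_trans; rewrite mulrC ler_wpM2l//.
  exact: seminorm_ge0.
by rewrite lerDl.
Qed.

Lemma orbit_norm_continuous U : X U -> continuous (fun t => N (S (Num.max t 0) U)).
Proof.
move=> HU t; have st := semigroup_stable HS.
apply/cvgrPdist_lt => e e0; have [d d0 Hd] := orbit_modulus HU e0.
apply/nbhs_ballP; exists d => //= s; rewrite /ball/= => ds.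
have m0 (x : R) : 0 <= Num.max x 0 by rewrite le_max lexx orbT.
have Xs := st _ _ (m0 s) HU; have Xt := st _ _ (m0 t) HU.
apply: le_lt_trans (Hd _ _ ds); rewrite ler_norml.
have := seminorm_le Xs Xt; rewrite (seminormB Xs Xt); have := seminorm_le Xt Xs.
move: (N _) (N _) (N _) => p q r; lra.
Qed.

Context (U W : E) (HG : generator X N S U W).

(** Up to null vectors [S t] commutes with difference quotients, so by contractivity their error at
    time t is at most the error at time 0. *)
Lemma orbit_generator t : 0 <= t -> generator X N S (S t U) (S t W) /\
  forall h, 0 < h -> N (S (t + h) U - S t U - h *: S t W) <=
    h * N (h^-1 *: (S h U - U) - W).
Proof.
move=> t0; have [HU HW G] := HG; have st := semigroup_stable HS.
have HtU := st _ _ t0 HU; have HtW := st _ _ t0 HW.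
have key h : 0 < h -> N (h^-1 *: (S (t + h) U - S t U) - S t W) <=
    N (h^-1 *: (S h U - U) - W).
  move=> h0; have h0' := ltW h0.
  have H1 := semiX_sub (st _ _ h0' HU) HU; have H2 := semiX_scale h^-1 H1.
  apply: le_trans (semigroup_contraction HS t0 (semiX_sub H2 HW)).
  rewrite -(@null_norm (S t (h^-1 *: (S h U - U) - W)))//.
  apply: (null_trans (semigroupB t0 H2 HW)); apply: null_sub (null_refl HtW).
  apply: (null_trans (semigroupZ h^-1 t0 H1)); apply: null_scale.
  exact: null_sym (orbit_difference t0 h0' HU).
split.
  split => //; apply: (@squeeze_cvgr _ _ _ _ (fun=> 0) (fun h => N (h^-1 *: (S h U - U) - W))).
  - near=> h; have h0 : 0 < h by near: h; exact: nbhs_right_gt.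
    rewrite seminorm_ge0//=; apply: le_trans (key h h0).
    have e := null_scale h^-1 (null_sub (semigroupD (ltW h0) t0 HU) (null_refl HtU)).
    by rewrite (addrC t) (null_norm (null_sub e (null_refl HtW))).
  - exact: cvg_cst.
  - exact: G.
move=> h h0; have hn0 : h != 0 by rewrite gt_eqF.
have := key h h0; rewrite -(ler_pM2l h0); apply: le_trans.
have H1 := semiX_sub (st _ _ (addr_ge0 t0 (ltW h0)) HU) HtU.
have H2 := semiX_sub (semiX_scale h^-1 H1) HtW.
have -> : h * N (h^-1 *: (S (t + h) U - S t U) - S t W) =
    N (h *: (h^-1 *: (S (t + h) U - S t U) - S t W)).
  by rewrite seminorm_scale// gtr0_norm.
by rewrite [in leRHS]scalerBr scalerA divff// scale1r.
Unshelve. all: by end_near. Qed.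

(** A backward increment is expanded at the earlier time s; replacing [S s W] by [S t W] costs the
    second summand of [rho]. *)
Lemma orbit_expansion : exists rho : R -> R, [/\ rho h @[h --> 0^'+] --> (0 : R),
    forall h, 0 < h -> 0 <= rho h &
    forall s t, 0 <= s -> 0 <= t -> s != t ->
      N (S s U - S t U - (s - t) *: S t W) <= `|s - t| * rho `|s - t|].
Proof.
have [HU HW G] := HG; have st := semigroup_stable HS.
exists (fun h => N (h^-1 *: (S h U - U) - W) + N (S h W - W)); split.
- rewrite -[X in _ --> X](addr0 (0 : R)); apply: cvgD; first exact: G.
  exact: (semigroup_continuous HS HW).
- by move=> h _; rewrite addr_ge0// seminorm_ge0.
move=> s t s0 t0 st'; case: (ltP t s) => ts.
  have h0 : 0 < s - t by rewrite subr_gt0.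
  have := (orbit_generator t0).2 _ h0; rewrite subrKC gtr0_norm// => /le_trans; apply.
  by rewrite ler_wpM2l ?(ltW h0)// lerDl seminorm_ge0.
have {st'}ts : s < t by rewrite lt_neqAle st' ts.
have h0 : 0 < t - s by rewrite subr_gt0.
rewrite ltr0_norm ?subr_lt0// opprB.
have := (orbit_generator s0).2 _ h0; rewrite subrKC => le1.
have XtU := st _ _ t0 HU; have XsU := st _ _ s0 HU.
have XtW := st _ _ t0 HW; have XsW := st _ _ s0 HW.
have -> : S s U - S t U - (s - t) *: S t W =
    - (S t U - S s U - (t - s) *: S s W) + (t - s) *: (S t W - S s W).
  rewrite -(opprB t s) scaleNr opprK scalerBr !opprB [LHS]addrC.
  by rewrite [RHS]addrAC subrKC.
have H1 := semiX_sub (semiX_sub XtU XsU) (semiX_scale (t - s) XsW).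
have H2 := semiX_sub XtW XsW.
apply: (le_trans (seminorm_triangle HN (semiX_opp H1) (semiX_scale (t - s) H2))).
rewrite seminormN// mulrDr; apply: lerD => //.
rewrite seminorm_scale// gtr0_norm// ler_wpM2l ?(ltW h0)//.
by have := orbit_dist_abs s0 t0 HW; rewrite gtr0_norm.
Qed.

Lemma is_derive_orbit l C t : bounded_functional l C -> 0 < t ->
  is_derive t (1 : R) (fun s => l (S s U)) (l (S t W)).
Proof.
move=> bl t0; have [C0 _ lb] := bl; have [HU HW _] := HG; have st := semigroup_stable HS.
have [rho [rho0 _ Hr]] := orbit_expansion.
apply: (@is_derive_modulus _ _ _ (fun h => C * rho h)).
  by rewrite -[X in _ --> X](mulr0 C); apply: cvgM; [exact: cvg_cst|].
near=> s; move=> sn; have s0 : 0 <= s by apply: ltW; near: s; exact: lt_nbhsr.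
have t0' := ltW t0.
have XtU := st _ _ t0' HU; have XsU := st _ _ s0 HU; have XtW := st _ _ t0' HW.
have E1 : l (S s U) - l (S t U) - l (S t W) * (s - t) = l (S s U - S t U - (s - t) *: S t W).
  rewrite (functionalB bl); [|exact: semiX_sub|exact: semiX_scale].
  by rewrite (functionalB bl)// (functionalZ _ bl)// [(s - t) * _]mulrC.
rewrite E1; have H1 := semiX_sub (semiX_sub XsU XtU) (semiX_scale (s - t) XtW).
by apply: (le_trans (lb _ H1)); rewrite mulrCA ler_wpM2l//; exact: Hr.
Unshelve. all: by end_near. Qed.

(** Squared increments are o(|s - t|), which disposes of the quadratic term when the energy is
    differentiated. *)
Lemma orbit_lipschitz_near t : 0 < t -> exists rho : R -> R, rho h @[h --> 0^'+] --> (0 : R) /\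
  \forall s \near t, s != t -> N (S s U - S t U) ^+ 2 <= `|s - t| * rho `|s - t|.
Proof.
move=> t0; have [HU HW _] := HG; have st := semigroup_stable HS.
have [rho [rho0 rhop Hr]] := orbit_expansion.
exists (fun h => h * (rho h + N W) ^+ 2); split.
  rewrite -[X in _ --> X](mul0r ((0 + N W) ^+ 2)).
  apply: cvgM; first exact: cvg_at_right_filter cvg_id.
  by rewrite expr2; apply: cvgM; apply: cvgD => //; exact: cvg_cst.
near=> s; move=> sn; have s0 : 0 <= s by apply: ltW; near: s; exact: lt_nbhsr.
have t0' := ltW t0.
have XtU := st _ _ t0' HU; have XsU := st _ _ s0 HU; have XtW := st _ _ t0' HW.
have h0 : 0 < `|s - t| by rewrite normr_gt0 subr_eq0.
rewrite mulrA -expr2 -exprMn ler_sqr ?nnegrE ?seminorm_ge0//; last first.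
  by rewrite mulr_ge0 ?addr_ge0 ?seminorm_ge0 ?rhop.
have H1 := semiX_scale (s - t) XtW.
apply: (le_trans (seminorm_le (semiX_sub XsU XtU) H1)); rewrite addrC mulrDr lerD//.
  exact: Hr.
by rewrite seminorm_scale// ler_wpM2l//; exact: (semigroup_contraction HS).
Unshelve. all: by end_near. Qed.

Lemma orbit_contraction t : 0 <= t -> N (S t W) <= N W /\ N (S t U) <= N U.
Proof.
by move=> t0; have [HU HW _] := HG; split; exact: (semigroup_contraction HS).
Qed.

End Orbits.

(** * The energy space *)

Section Energy.
Context {R : realType}.
Implicit Types (a k : R) (f g : R -> R) (U V W Z : @state R).
Local Notation mu := (@lebesgue_measure R).

Definition energy_form U V : R :=
  ip 0 1 (wderiv 0 1 U.1) (wderiv 0 1 V.1) + ip 0 1 U.2 V.2.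

Lemma X1_L2 U : X1 U -> [/\ L2 0 1 U.1, L2 0 1 U.2 & L2 0 1 (wderiv 0 1 U.1)].
Proof. by move=> [HU L]; have [Lu Lux _ _ _] := H10_prim ltr01 HU. Qed.

Lemma X1_lin k U V : X1 U -> X1 V -> X1 (k *: U + V).
Proof.
move=> [HU LU] [HV LV]; split; first exact: (H10_lin k ltr01 HU HV).1.
exact: L2D (L2Z k LU) LV.
Qed.

Lemma ip_wderiv_lin k U V g : X1 U -> X1 V -> L2 0 1 g ->
  ip 0 1 (wderiv 0 1 (k *: U + V).1) g =
  k * ip 0 1 (wderiv 0 1 U.1) g + ip 0 1 (wderiv 0 1 V.1) g.
Proof.
move=> XU XV Lg; have [_ _ Lux] := X1_L2 XU; have [_ _ Lvx] := X1_L2 XV.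
have [_ _ Lx] := X1_L2 (X1_lin k XU XV).
have E := (H10_lin k ltr01 XU.1 XV.1).2.
rewrite (ae_eq_ipl Lx (L2D (L2Z k Lux) Lvx) Lg E); exact: ip_lin.
Qed.

Lemma energy_form_lin k U V Z : X1 U -> X1 V -> X1 Z ->
  energy_form (k *: U + V) Z = k * energy_form U Z + energy_form V Z.
Proof.
move=> XU XV XZ; have [_ LU _] := X1_L2 XU; have [_ LV _] := X1_L2 XV.
have [_ LZ LZx] := X1_L2 XZ.
rewrite /energy_form ip_wderiv_lin// (ip_lin k LU LV LZ).
move: (ip _ _ _ _) (ip _ _ _ _) (ip _ _ _ _) (ip _ _ _ _) => p q r s; ring.
Qed.

Lemma energy_formC U V : energy_form U V = energy_form V U.
Proof. by rewrite /energy_form ipC [X in _ + X]ipC. Qed.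

Lemma cauchy_schwarz_add (x y p q r s : R) : 0 <= p -> 0 <= q -> 0 <= r -> 0 <= s ->
  x ^+ 2 <= p * q -> y ^+ 2 <= r * s -> (x + y) ^+ 2 <= (p + r) * (q + s).
Proof.
move=> p0 q0 r0 s0 xpq yrs.
suff : x * y *+ 2 <= p * s + r * q.
  rewrite sqrrD mulrDl !mulrDr; move: xpq yrs.
  move: (x ^+ 2) (y ^+ 2) (_ *+ 2) (p * q) (p * s) (r * q) (r * s) => *; lra.
have h0 : 0 <= p * s + r * q by rewrite addr_ge0// mulr_ge0.
rewrite (le_trans (ler_norm _))// -ler_sqr ?nnegrE// -normrX ger0_norm ?sqr_ge0//.
have h : (x * y) ^+ 2 <= p * q * (r * s).
  by rewrite exprMn; apply: ler_pM => //; exact: sqr_ge0.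
have e : (x * y *+ 2) ^+ 2 = 4 * (x * y) ^+ 2 by ring.
rewrite e; have := sqr_ge0 (p * s - r * q).
have -> : (p * s - r * q) ^+ 2 = (p * s + r * q) ^+ 2 - 4 * (p * q * (r * s)) by ring.
lra.
Qed.

Lemma energy_form_le U V : X1 U -> X1 V ->
  `|energy_form U V| <= X1norm U * X1norm V.
Proof.
move=> XU XV; have [_ LU LUx] := X1_L2 XU; have [_ LV LVx] := X1_L2 XV.
rewrite -ler_sqr ?nnegrE ?mulr_ge0 ?X1norm_ge0// exprMn !X1norm_sqr//.
rewrite -normrX ger0_norm ?sqr_ge0//.
by apply: cauchy_schwarz_add; try exact: ip_ge0; exact: ip_CS.
Qed.

Lemma X1norm_form U : X1 U -> X1norm U ^+ 2 = energy_form U U.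
Proof. exact: X1norm_sqr. Qed.

Lemma X1_0 : X1 (0 : @state R).
Proof.
have L0 : L2 0 1 (fun=> 0 : R) by exact: (@L2_cst _ _ _ 0).
split; last exact: L0.
apply/(H10P _ ltr01); split; first exact: L0.
have p0 x : prim 0 1 (fun=> 0 : R) x = 0.
  by rewrite /prim -[fun=> 0]/(cst 0) ip_cstl ?mul0r//; exact: L2_chi.
exists (fun=> 0); split => //.
by apply: eq_ae_eq_on => x _; rewrite p0.
Qed.

Lemma X1_seminorm : seminorm_on (X1 : set (@state R)) X1norm.
Proof.
split.
- exact: X1_0.
- exact: X1_lin.
- exact: X1norm_ge0.
- move=> U V XU XV; rewrite -[U]scale1r; have XS := X1_lin 1 XU XV.
  rewrite -ler_sqr ?nnegrE ?addr_ge0 ?X1norm_ge0// X1norm_form// scale1r sqrrD.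
  rewrite (X1norm_form XU) (X1norm_form XV).
  have := energy_form_lin 1 XU XV XS; rewrite scale1r mul1r => ->.
  rewrite scale1r in XS.
  rewrite (energy_formC U) (energy_formC V).
  have := energy_form_lin 1 XU XV XU; rewrite scale1r mul1r => ->.
  have := energy_form_lin 1 XU XV XV; rewrite scale1r mul1r => ->.
  rewrite (energy_formC V U).
  have := le_trans (ler_norm _) (energy_form_le XU XV).
  move: (energy_form U U) (energy_form U V) (energy_form V V) (_ * _) => p q r s; lra.
- move=> k U XU; have XkU := X1_lin k XU X1_0; rewrite addr0 in XkU.
  apply/eqP; rewrite -(eqrXn2 (_ : 0 < 2)%N) ?mulr_ge0 ?X1norm_ge0//; apply/eqP.
  rewrite exprMn X1norm_form// (X1norm_form XU) real_normK ?num_real//.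
  have e0 Z : X1 Z -> energy_form 0 Z = 0.
    move=> XZ; have := energy_form_lin (-1) X1_0 X1_0 XZ.
    by rewrite scaler0 addr0 mulN1r addNr.
  have e Z : X1 Z -> energy_form (k *: U) Z = k * energy_form U Z.
    by move=> XZ; have := energy_form_lin k XU X1_0 XZ; rewrite e0// !addr0.
  by rewrite e// energy_formC e// mulrA expr2.
Qed.

Lemma bounded_energy_form V : X1 V ->
  bounded_functional X1 X1norm (fun U => energy_form U V) (X1norm V).
Proof.
move=> XV; split; first exact: X1norm_ge0.
- by move=> k U Z XU XZ; exact: energy_form_lin.
- by move=> U XU; rewrite mulrC; exact: energy_form_le.
Qed.

Lemma X1norm_ge_snd U : X1 U -> Num.sqrt (ip 0 1 U.2 U.2) <= X1norm U.
Proof.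
move=> XU; rewrite -[leRHS]ger0_norm ?X1norm_ge0// -sqrtr_sqr X1norm_sqr//.
by rewrite ler_sqrt ?addr_ge0 ?ip_ge0// lerDr ip_ge0.
Qed.

Lemma X1norm_ge_wderiv U : X1 U ->
  Num.sqrt (ip 0 1 (wderiv 0 1 U.1) (wderiv 0 1 U.1)) <= X1norm U.
Proof.
move=> XU; rewrite -[leRHS]ger0_norm ?X1norm_ge0// -sqrtr_sqr X1norm_sqr//.
by rewrite ler_sqrt ?addr_ge0 ?ip_ge0// lerDl ip_ge0.
Qed.

Lemma X1norm_ge_fst U : X1 U -> Num.sqrt (ip 0 1 U.1 U.1) <= X1norm U.
Proof.
move=> XU; apply: le_trans (X1norm_ge_wderiv XU).
have [Lu Lux uE ux1 _] := H10_prim ltr01 XU.1.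
by rewrite ler_sqrt ?ip_ge0//; exact: (poincare Lu Lux uE ux1).
Qed.

Lemma bounded_ip_snd g : L2 0 1 g ->
  bounded_functional X1 X1norm (fun U => ip 0 1 U.2 g) (Num.sqrt (ip 0 1 g g)).
Proof.
move=> Lg; split; first exact: sqrtr_ge0.
- by move=> k U V [_ LU] [_ LV]; exact: ip_lin.
- move=> U XU; apply: (le_trans (ip_norm_le XU.2 Lg)).
  by rewrite mulrC ler_wpM2l ?sqrtr_ge0//; exact: X1norm_ge_snd.
Qed.

Lemma bounded_ip_fst g : L2 0 1 g ->
  bounded_functional X1 X1norm (fun U => ip 0 1 U.1 g) (Num.sqrt (ip 0 1 g g)).
Proof.
move=> Lg; split; first exact: sqrtr_ge0.
- by move=> k U V /X1_L2[LU _ _] /X1_L2[LV _ _]; exact: ip_lin.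
- move=> U XU; have [LU _ _] := X1_L2 XU; apply: (le_trans (ip_norm_le LU Lg)).
  by rewrite mulrC ler_wpM2l ?sqrtr_ge0//; exact: X1norm_ge_fst.
Qed.

Lemma bounded_trace a : 0 < a < 1 -> bounded_functional X1 X1norm
  (fun U => crep 0 1 U.1 a) (Num.sqrt (ip 0 1 (chi a) (chi a))).
Proof.
move=> /andP[a0 a1]; have aI : a \in `[0, 1] by rewrite in_itv/= !ltW.
have E U : X1 U -> crep 0 1 U.1 a = ip 0 1 (wderiv 0 1 U.1) (chi a).
  by move=> XU; have [_ _ _ _ ->] := H10_prim ltr01 XU.1.
have Lc : L2 0 1 (chi a) by exact: L2_chi.
split; first exact: sqrtr_ge0.
- move=> k U V XU XV; rewrite (E _ (X1_lin k XU XV)) E// E//.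
  exact: ip_wderiv_lin.
- move=> U XU; have [_ _ LU] := X1_L2 XU; rewrite E//; apply: (le_trans (ip_norm_le LU Lc)).
  by rewrite mulrC ler_wpM2l ?sqrtr_ge0//; exact: X1norm_ge_wderiv.
Qed.

(** Half of the energy derivative. Integration by parts cancels the terms in v_x and u_xx, leaving
    the jump of u_x times v(a), both equal to [al]. *)
Lemma energy_dissipation a U W : 0 < a < 1 -> A1 a U W ->
  energy_form W U = - crep 0 1 W.1 a ^+ 2.
Proof.
move=> a01 HA; have [ux [vx [al [c D]]]] := A1_data a01 HA.
have [a0 a1] := andP a01.
have [Lu Lv Lw Lg Lux Lvx uE u1 vE v1 wE alE uxE e1 e2 e3] := D.
rewrite -e3 energy_formC /energy_form -e1 -e2.
have Lpv : L2 0 1 (prim 0 1 vx) by exact: L2_prim.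
have Lpg : L2 0 1 (prim 0 1 W.2) by exact: L2_prim.
rewrite (ae_eq_ipl Lv Lpv Lg vE).
have Lc : L2 0 1 (cst c) by exact: L2_cst.
have L1 : L2 0 1 (cst (1 : R)) by exact: L2_cst.
have La : L2 0 1 (chi a) by exact: L2_chi.
have Lj := L2_jump a 0 1; have Laj := L2Z al Lj.
have Lcg := L2D Lc Lpg; have Lall := L2D Lcg Laj.
rewrite (ae_eq_ipl Lux Lall Lvx uxE).
rewrite (ipDl Lcg Laj Lvx) (ipDl Lc Lpg Lvx) (ipZl al Lj Lvx) (ipBl L1 La Lvx).
have i1 k : ip 0 1 (cst k) vx = 0 by rewrite ip_cstl// v1 mulr0.
have ia : ip 0 1 (chi a) vx = al by rewrite ipC alE.
have := prim_by_parts0 ler01 Lvx Lg v1; rewrite (ipC _ _ vx) => ->.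
rewrite !i1 ia; move: (ip 0 1 _ _) => p; ring.
Qed.

(** Projection of u_tt = u_xx - v(a) delta_a on one sine: an oscillator driven by the velocity at
    [a]. *)
Lemma modal_forcing a U W n : 0 < a < 1 -> A1 a U W -> (0 < n)%N ->
  ip 0 1 W.2 (sn n) = - (n%:R * pi) ^+ 2 * ip 0 1 U.1 (sn n) - crep 0 1 W.1 a * sn n a.
Proof.
move=> a01 HA n0; have [ux [vx [al [c D]]]] := A1_data a01 HA.
have [a0 a1] := andP a01; have aI : a \in `[0, 1] by rewrite in_itv/= !ltW.
have [Lu Lv Lw Lg Lux Lvx uE u1 vE v1 wE alE uxE e1 e2 e3] := D; rewrite -e3.
have k0 := @frequency_neq0 R _ n0.
have Lpg : L2 0 1 (prim 0 1 W.2) by exact: L2_prim.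
have Lpu : L2 0 1 (prim 0 1 ux) by exact: L2_prim.
have Ls : L2 0 1 (@sn R n) by exact: L2_sn.
have Lcn : L2 0 1 (@cn R n) by exact: L2_cn.
rewrite (ae_eq_ipl Lu Lpu Ls uE) ip_prim_sn//.
have Lc : L2 0 1 (cst c) by exact: L2_cst.
have L1 : L2 0 1 (cst (1 : R)) by exact: L2_cst.
have La : L2 0 1 (chi a) by exact: L2_chi.
have Lj := L2_jump a 0 1; have Laj := L2Z al Lj.
have Lcg := L2D Lc Lpg; have Lall := L2D Lcg Laj.
rewrite (ae_eq_ipl Lux Lall Lcn uxE).
rewrite (ipDl Lcg Laj Lcn) (ipDl Lc Lpg Lcn) (ipZl al Lj Lcn) (ipBl L1 La Lcn).
rewrite !ip_cst_cn// ip_prim_cn//.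
have -> : ip 0 1 (chi a) (cn n) = sn n a / (n%:R * pi) by rewrite ipC -(prim_cn (l := 1)).

move: (ip 0 1 _ _) (sn n a) => p s; move: (n%:R * pi) k0 => k k0; by field.
Qed.

End Energy.

(** * Evolution of the modes, the trace and the energy *)

Section Evolution.
Context {R : realType} (a : R) (a01 : 0 < a < 1) (S : R -> @state R -> @state R).
Context (HS : generates_contraction_semigroup X1 X1norm (A1 a) S).
Implicit Types (t r x : R) (f g : R -> R) (U W : @state R).
Local Notation mu := (@lebesgue_measure R).

(* The orbits are frozen for negative times so that these functions are continuous
   on the whole line. *)
Definition mode_fst U n t : R := ip 0 1 (S (Num.max t 0) U).1 (sn n).
Definition mode_snd U n t : R := ip 0 1 (S (Num.max t 0) U).2 (sn n).
Definition trace U t : R := crep 0 1 (S (Num.max t 0) U).1 a.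
Definition energy U t : R := X1norm (S (Num.max t 0) U) ^+ 2.

Context (U W : @state R) (HA : A1 a U W).

Let HG : generator X1 X1norm S U W.
Proof. exact/(HS.2 U W). Qed.

Let XU : X1 U. Proof. by have [] := HG. Qed.
Let XW : X1 W. Proof. by have [] := HG. Qed.

Lemma orbit_A1 t : 0 <= t -> A1 a (S t U) (S t W).
Proof. by move=> t0; apply/(HS.2 _ _); exact: (orbit_generator X1_seminorm HS.1 HG t0).1. Qed.

Lemma max0E t : 0 <= t -> Num.max t 0 = t.
Proof. by move=> t0; exact/max_idPl. Qed.

Lemma continuous_mode_fst n : continuous (mode_fst U n).
Proof. exact: (orbit_continuous X1_seminorm HS.1 (bounded_ip_fst (@L2_sn R n 0 1)) XU). Qed.

Lemma continuous_mode_snd n : continuous (mode_snd U n).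
Proof. exact: (orbit_continuous X1_seminorm HS.1 (bounded_ip_snd (@L2_sn R n 0 1)) XU). Qed.

Lemma continuous_trace : continuous (trace U).
Proof. exact: (orbit_continuous X1_seminorm HS.1 (bounded_trace a01) XU). Qed.

Lemma continuous_trace_derivative : continuous (trace W).
Proof. exact: (orbit_continuous X1_seminorm HS.1 (bounded_trace a01) XW). Qed.

Lemma continuous_energy : continuous (energy U).
Proof.
have c := orbit_norm_continuous X1_seminorm HS.1 XU.
by move=> t; rewrite /energy; apply: cvgM; exact: c.
Qed.

Lemma is_derive_max0 t (f : R -> R) b : 0 < t -> is_derive t (1 : R) f b ->
  is_derive t (1 : R) (fun s => f (Num.max s 0)) b.
Proof.
move=> t0; apply: is_derive_near; near=> s; rewrite max0E//.
by apply: ltW; near: s; exact: lt_nbhsr.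
Unshelve. all: by end_near. Qed.

Lemma is_derive_trace t : 0 < t -> is_derive t (1 : R) (trace U) (trace W t).
Proof.
move=> t0; rewrite /trace [in crep _ _ _ _]max0E ?ltW//.
apply: (is_derive_max0 (f := fun s => crep 0 1 (S s U).1 a) t0).
exact: (is_derive_orbit X1_seminorm HS.1 HG (bounded_trace a01) t0).
Qed.

Lemma is_derive_mode_fst n t : 0 < t ->
  is_derive t (1 : R) (mode_fst U n) (mode_snd U n t).
Proof.
move=> t0; have [[[_ _ _ [H1 _ _]] _] [HW _] E _] := orbit_A1 (ltW t0).
have [Lw _ _ _ _] := H10_prim ltr01 HW.
rewrite /mode_snd max0E ?ltW// -(ae_eq_ipl Lw H1.1 (L2_sn n 0 1) E).
apply: (is_derive_max0 (f := fun s => ip 0 1 (S s U).1 (sn n)) t0).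
exact: (is_derive_orbit X1_seminorm HS.1 HG (bounded_ip_fst (@L2_sn R n 0 1)) t0).
Qed.

Lemma is_derive_mode_snd n t : (0 < n)%N -> 0 < t ->
  is_derive t (1 : R) (mode_snd U n)
    (- (n%:R * pi) ^+ 2 * mode_fst U n t - trace W t * sn n a).
Proof.
move=> n0 t0; rewrite /mode_fst /trace !max0E ?ltW//.
rewrite -(modal_forcing a01 (orbit_A1 (ltW t0)) n0).
apply: (is_derive_max0 (f := fun s => ip 0 1 (S s U).2 (sn n)) t0).
exact: (is_derive_orbit X1_seminorm HS.1 HG (bounded_ip_snd (@L2_sn R n 0 1)) t0).
Qed.

(** Near t, |S s U|^2 = |S s U - S t U|^2 + 2 (S s U, S t U) - |S t U|^2: the first term has
    derivative 0 and the second is a bounded functional of the orbit. *)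
Lemma is_derive_energy t : 0 < t ->
  is_derive t (1 : R) (energy U) (- 2 * trace W t ^+ 2).
Proof.
move=> t0; have t0' := ltW t0; have st := semigroup_stable HS.1.
have Xt : X1 (S t U) by exact: st.
rewrite /energy /trace max0E//.
apply: (is_derive_max0 (f := fun s => X1norm (S s U) ^+ 2) t0).
have d1 : is_derive t (1 : R) (fun s => X1norm (S s U - S t U) ^+ 2) 0.
  have [rho [rho0 Hr]] := orbit_lipschitz_near X1_seminorm HS.1 HG t0.
  apply: (is_derive_modulus rho0); near=> s => sn.
  have N0 : X1norm (S t U - S t U) = 0.
    by rewrite subrr -[0 : @state R](scale0r U) (seminorm_scale X1_seminorm)// normr0 mul0r.
  rewrite N0 expr0n/= subr0 mul0r subr0 ger0_norm ?sqr_ge0//.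
  by move: sn; near: s.
have d2 := is_derive_orbit X1_seminorm HS.1 HG (bounded_energy_form Xt) t0.
have d3 := is_derive_add (is_derive_add d1 (is_derive_scale 2 d2)) (is_derive_const t (- energy_form (S t U) (S t U))).
rewrite (energy_dissipation a01 (orbit_A1 t0')) add0r addr0 mulrN -mulNr in d3.
apply: (is_derive_near _ d3); near=> s.
have Xs : X1 (S s U) by apply: st => //; apply: ltW; near: s; exact: lt_nbhsr.
have Xd := semiX_sub X1_seminorm Xs Xt.
rewrite (X1norm_form Xd) (X1norm_form Xs).
have e Z : X1 Z -> energy_form (S s U - S t U) Z = energy_form (S s U) Z - energy_form (S t U) Z.
  by move=> XZ; exact: (functionalB (bounded_energy_form XZ)).
rewrite e// ![energy_form _ (S s U - S t U)]energy_formC !e//.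
rewrite [energy_form (S t U) (S s U)]energy_formC.
move: (energy_form _ _) (energy_form _ _) (energy_form _ _) => p q r; ring.
Unshelve. all: by end_near. Qed.

Lemma is_derive_reflect t r f b : is_derive (t - r) (1 : R) f b ->
  is_derive r (1 : R) (fun r => f (t - r)) (- b).
Proof.
have affine x : t - x = -1 * x + t by rewrite mulN1r addrC.
move=> d; rewrite -mulN1r; under eq_fun do rewrite affine.
by apply: is_derive_comp_affine; rewrite -affine.
Qed.

Lemma energy_balance t : 0 <= t ->
  X1norm U ^+ 2 - X1norm (S t U) ^+ 2 = 2 * ip 0 t (trace W) (trace W).
Proof.
move=> t0; have cW := continuous_trace_derivative.
have c2 : continuous (fun s => - 2 * trace W s ^+ 2).
  by move=> s; apply: cvgM; [exact: cvg_cst|apply: cvgM; exact: cW].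
have := int_FTC t0 (within_continuous c2) (within_continuous continuous_energy).
have -> : \int[mu]_(x in `]0, t[) (- 2 * trace W x ^+ 2) = - 2 * ip 0 t (trace W) (trace W).
  have LW : L2 0 t (trace W) by exact: continuous_L2.
  have i := ip_integrable LW LW; rewrite /ip -RintegralZl//.
have E0 : energy U 0 = X1norm U ^+ 2.
  rewrite /energy max0E//; congr (_ ^+ 2).
  have X0 := semigroup_stable HS.1 (lexx 0) XU.
  by apply: (null_norm X1_seminorm); split => //; exact: (semigroup_0 HS.1 XU).
have Et : energy U t = X1norm (S t U) ^+ 2 by rewrite /energy max0E.
have d y : y \in `]0, t[ -> is_derive y (1 : R) (energy U) (- 2 * trace W y ^+ 2).
  by rewrite in_itv/= => /andP[y0 _]; exact: is_derive_energy.
by move=> /(_ d); rewrite E0 Et mulNr => /eqP; rewrite eqr_oppLR opprB => /eqP ->.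
Qed.

(* Integrating the damping term by parts replaces the velocity of the trace by
   the trace itself. *)
Lemma mode_duhamel n t : (0 < n)%N -> 0 <= t ->
  mode_fst U n t = cn n t * mode_fst U n 0 + sn n t / (n%:R * pi) * mode_snd U n 0
    - sn n a * \int[mu]_(r in `]0, t[) ((trace U r - trace U 0) * cn n (t - r)).
Proof.
move=> n0 t0.
have k0 := @frequency_neq0 R _ n0.
set b := sn n a; set k := (n%:R * pi : R) in k0 *.
have ds r : is_derive r (1 : R) (fun r => sn n (t - r)) (- (k * cn n (t - r))).
  by apply: is_derive_reflect; exact: is_derive_sn.
have dc r : is_derive r (1 : R) (fun r => cn n (t - r)) (k * sn n (t - r)).
  by rewrite -[k * _]opprK; apply: is_derive_reflect; exact: is_derive_cn.
have cs : continuous (fun r => sn n (t - r)) by move=> r; exact: is_derive_continuous (ds r).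
have cc : continuous (fun r => cn n (t - r)) by move=> r; exact: is_derive_continuous (dc r).
have cB : continuous (fun r => trace U r - trace U 0).
  by move=> r; apply: cvgB; [exact: continuous_trace|exact: cvg_cst].
have cf : continuous (fun r => - b * ((trace U r - trace U 0) * cn n (t - r))).
  by move=> r; apply: cvgM; [exact: cvg_cst|apply: cvgM; [exact: cB|exact: cc]].
(* By the equations of the mode, this function of r has derivative [- b] times the integrand. Its
   last term is the boundary term of the integration by parts; it vanishes at r = 0 with the
   increment of the trace and at r = t with the sine. *)
have cF : continuous (fun r => mode_fst U n r * cn n (t - r) +
    k^-1 * (mode_snd U n r * sn n (t - r)) +
    (b / k) * ((trace U r - trace U 0) * sn n (t - r))).
  move=> r; apply: cvgD; first apply: cvgD.
  - by apply: cvgM; [exact: continuous_mode_fst|exact: cc].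
  - by apply: cvgM; [exact: cvg_cst|apply: cvgM; [exact: continuous_mode_snd|exact: cs]].
  - by apply: cvgM; [exact: cvg_cst|apply: cvgM; [exact: cB|exact: cs]].
have := int_FTC t0 (within_continuous cf) (within_continuous cF).
have -> : \int[mu]_(r in `]0, t[) (- b * ((trace U r - trace U 0) * cn n (t - r))) =
    - b * \int[mu]_(r in `]0, t[) ((trace U r - trace U 0) * cn n (t - r)).
  have LB := continuous_L2 0 t cB.
  have Lc := continuous_L2 0 t cc.
  by rewrite RintegralZl//; exact: (ip_integrable LB Lc).
move: (Rintegral _ _ _) => I; rewrite !subrr !subr0 cn0 sn0 !mulr0 mul0r !addr0 mulr1 mulr0 addr0.
move=> H; have {}H : - b * I = mode_fst U n t -
    (mode_fst U n 0 * cn n t + k^-1 * (mode_snd U n 0 * sn n t)).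
  apply: H => y; rewrite in_itv/= => /andP[y0 yt].
  have d1 := is_derive_mul (is_derive_mode_fst n y0) (dc y).
  have d2 := is_derive_mul (is_derive_mode_snd n0 y0) (ds y).
  have d3 := is_derive_mul (is_derive_sub (is_derive_trace y0) (is_derive_const y (trace U 0))) (ds y).
  apply: is_derive_congr (is_derive_add (is_derive_add d1 (is_derive_scale k^-1 d2)) (is_derive_scale (b / k) d3)) _.
  rewrite -/k -/b; move: (mode_fst U n y) (mode_snd U n y) (trace W y) (trace U y - trace U 0) (cn n (t - y)) (sn n (t - y)) => p q al B c s.
  by move: (k) k0 => kk kk0; field.
have -> : mode_fst U n t = - b * I + (mode_fst U n 0 * cn n t + k^-1 * (mode_snd U n 0 * sn n t)).
  by rewrite H subrK.
move: (mode_fst U n 0) (mode_snd U n 0) (cn n t) (sn n t) => p q c s; ring.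
Qed.

End Evolution.

(** * Reflections and the formula of d'Alembert *)

Section Reflections.
Context {R : realType}.
Implicit Types (c d k t x y : R) (f g F G P : R -> R) (n : nat).
Local Notation mu := (@lebesgue_measure R).

Lemma continuous_affine_comp k l f : continuous f -> continuous (fun x => f (k * x + l)).
Proof.
move=> cf x; apply: (@continuous_comp _ _ _ (fun x => k * x + l) f); last exact: cf.
exact: (is_derive_continuous (is_derive_affine x k l)).
Qed.

Lemma continuous_shift k f : continuous f -> continuous (fun x => f (x + k)).
Proof.
by move=> cf x; have := @continuous_affine_comp 1 k f cf x; under eq_fun do rewrite mul1r.
Qed.

Lemma continuous_shiftl k f : continuous f -> continuous (fun x => f (k + x)).
Proof.
by move=> cf; have := continuous_shift (k := k) cf; under eq_fun do rewrite addrC.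
Qed.

Lemma continuous_reflect k f : continuous f -> continuous (fun x => f (k - x)).
Proof.
move=> cf x; have := @continuous_affine_comp (-1) k f cf x.
by under eq_fun do rewrite mulN1r addrC.
Qed.

Lemma is_derive_shift x k f (b : R) : is_derive (x + k) (1 : R) f b ->
  is_derive x (1 : R) (fun y => f (y + k)) b.
Proof.
have affine y : y + k = 1 * y + k by rewrite mul1r.
move=> d; rewrite -[b]mul1r; under eq_fun do rewrite affine.
by apply: is_derive_comp_affine; rewrite -affine.
Qed.

Lemma ip_shift c d k f g : continuous f -> continuous g -> c <= d ->
  ip c d (fun x => f (x + k)) (fun x => g (x + k)) = ip (c + k) (d + k) f g.
Proof.
move=> cf cg cd.
have cfg : continuous (fun x => f x * g x) by move=> x; apply: cvgM; [exact: cf|exact: cg].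
have Lfg := continuous_L2 (c + k) (d + k) cfg.
have cp := prim_continuous Lfg.
have D y : y \in `]c, d[ -> is_derive y (1 : R)
    (fun x => prim (c + k) (d + k) (fun x => f x * g x) (x + k)) (f (y + k) * g (y + k)).
  rewrite in_itv/= => /andP[cy yd].
  have H : y + k \in `](c + k), (d + k)[ by rewrite in_itv/= !ltrD2r cy.
  exact: is_derive_shift (prim_derive Lfg H (cfg (y + k))).
have := int_FTC cd (within_continuous (continuous_shift (k := k) cfg))
  (within_continuous (continuous_shift (k := k) cp)) D.
rewrite prim_d prim_c subr0; exact.
Qed.

Lemma ip_reflect c d k f g : continuous f -> continuous g -> c <= d ->
  ip c d (fun x => f (k - x)) (fun x => g (k - x)) = ip (k - d) (k - c) f g.
Proof.
move=> cf cg cd.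
have cfg : continuous (fun x => f x * g x) by move=> x; apply: cvgM; [exact: cf|exact: cg].
have Lfg := continuous_L2 (k - d) (k - c) cfg.
have cp := prim_continuous Lfg.
have cp' : continuous (fun x => - prim (k - d) (k - c) (fun x => f x * g x) (k - x)).
  by move=> x; apply: cvgN; exact: (continuous_reflect (k := k) cp).
have D y : y \in `]c, d[ -> is_derive y (1 : R)
    (fun x => - prim (k - d) (k - c) (fun x => f x * g x) (k - x)) (f (k - y) * g (k - y)).
  rewrite in_itv/= => /andP[cy yd].
  have H : k - y \in `](k - d), (k - c)[ by rewrite in_itv/= !ltrD2l !ltrN2 cy yd.
  have := is_derive_opp (is_derive_reflect (prim_derive Lfg H (cfg (k - y)))).
  by rewrite opprK.
have := int_FTC cd (within_continuous (continuous_reflect (k := k) cfg)) (within_continuous cp') D.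
rewrite prim_d prim_c oppr0 sub0r opprK; exact.
Qed.

Lemma snN n x : sn n (- x) = - sn n x.
Proof. by rewrite /sn mulrN sinN. Qed.

Lemma cnN n x : cn n (- x) = cn n x.
Proof. by rewrite /cn mulrN cosN. Qed.

Lemma snD n x y : sn n (x + y) = sn n x * cn n y + cn n x * sn n y.
Proof. by rewrite /sn mulrDr sinD /cn; congr (_ + _); rewrite mulrC. Qed.

Lemma cnD n x y : cn n (x + y) = cn n x * cn n y - sn n x * sn n y.
Proof. by rewrite /cn mulrDr cosD /sn. Qed.

Lemma cn2 n : cn n 2 = 1 :> R.
Proof.
rewrite -[2]/(1 + 1) cnD -![sn n 1]/(sn n (1%:R)) sn_nat mulr0 subr0.
by rewrite -expr2 -[RHS](cos2Dsin2 (n%:R * pi * 1)) -/(cn n 1) -/(sn n 1%:R) sn_nat expr0n/= addr0.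
Qed.

Lemma sn_period n x : sn n (x + 2) = sn n x.
Proof. by rewrite snD cn2 (sn_nat n 2) mulr0 addr0 mulr1. Qed.

Lemma cn_period n x : cn n (x + 2) = cn n x.
Proof. by rewrite cnD cn2 (sn_nat n 2) mulr0 subr0 mulr1. Qed.

(** Periodicity between [-1, 1] and [1, 3] suffices: the arguments t + x and t - x, for t in [0, 2]
    and x in [0, 1], stay in [-1, 3]. *)
Definition periodic_on F := forall y, -1 <= y <= 1 -> F (y + 2) = F y.

Lemma ip_period F G t : continuous F -> continuous G -> periodic_on F -> periodic_on G ->
  0 <= t <= 2 -> ip (t - 1) (t + 1) F G = ip (-1) 1 F G.
Proof.
move=> cF cG pF pG /andP[t0 t2].
have LF c d := continuous_L2 c d cF; have LG c d := continuous_L2 c d cG.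
rewrite (@ip_cat _ (t - 1) 1 (t + 1))//; [|lra|lra].
rewrite (@ip_cat _ (-1) (t - 1) 1)//; [|lra|lra].
rewrite addrC; congr (_ + _).
have -> : ip (-1) (t - 1) F G = ip (-1) (t - 1) (fun x => F (x + 2)) (fun x => G (x + 2)).
  by apply: eq_ip => x; rewrite in_itv/= => /andP[x1 x2]; rewrite ?pF ?pG//; lra.
rewrite ip_shift//; last lra.
have -> : -1 + 2 = 1 :> R by lra.
by have -> : t - 1 + 2 = t + 1 by lra.
Qed.

Lemma ip_sym F G (e : R) : continuous F -> continuous G ->
  (forall x, 0 < x < 1 -> F (- x) * G (- x) = e * (F x * G x)) ->
  ip (-1) 1 F G = (1 + e) * ip 0 1 F G.
Proof.
move=> cF cG H.
have LF c d := continuous_L2 c d cF; have LG c d := continuous_L2 c d cG.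
rewrite (@ip_cat _ (-1) 0 1)//.
have := @ip_reflect 0 1 0 F G cF cG ler01; rewrite sub0r subrr => <-.
have -> : ip 0 1 (fun x => F (0 - x)) (fun x => G (0 - x)) = ip 0 1 (fun x => e * F x) G.
  by apply: eq_Rintegral => x; rewrite inE/= in_itv/= => x01; rewrite !sub0r H// mulrA.
by rewrite ipZl// mulrDl mul1r addrC.
Qed.

Lemma ip_sn_shift c d F n k : L2 c d F ->
  ip c d F (fun y => sn n (y - k)) = cn n k * ip c d F (sn n) - sn n k * ip c d F (cn n).
Proof.
move=> LF; have Ls := @L2_sn R n c d; have Lc := @L2_cn R n c d.
rewrite -(ipZr _ Ls LF) -(ipZr _ Lc LF) -(ipBr (L2Z _ Ls) (L2Z _ Lc) LF).
by apply: eq_ip => // y _; rewrite snD snN cnN; ring.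
Qed.

Lemma ip_cn_shift c d F n k : L2 c d F ->
  ip c d F (fun y => cn n (y - k)) = cn n k * ip c d F (cn n) + sn n k * ip c d F (sn n).
Proof.
move=> LF; have Ls := @L2_sn R n c d; have Lc := @L2_cn R n c d.
rewrite -(ipZr _ Ls LF) -(ipZr _ Lc LF) -(ipDr (L2Z _ Lc) (L2Z _ Ls) LF).
by apply: eq_ip => // y _; rewrite cnD snN cnN; ring.
Qed.

(** The substitutions y = t + x and y = t - x join the two integrals into one over [t - 1, t + 1], a
    full period. *)
Lemma dalembert_coef F n t : continuous F -> periodic_on F -> 0 <= t <= 2 ->
  ip 0 1 (fun x => F (t + x) - F (t - x)) (sn n) =
  cn n t * ip (-1) 1 F (sn n) - sn n t * ip (-1) 1 F (cn n).
Proof.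
move=> cF pF t02; have cs := @continuous_sn R n.
have cG : continuous (fun y => sn n (y - t)) by exact: continuous_shift.
have pG : periodic_on (fun y => sn n (y - t)).
  by move=> y _; rewrite addrAC sn_period.
have LF c d := continuous_L2 c d cF; have LG c d := continuous_L2 c d cG.
have Ls c d := @L2_sn R n c d.
have LFs : L2 0 1 (fun x => F (t + x)).
  by apply: continuous_L2; exact: continuous_shiftl.
have LFr : L2 0 1 (fun x => F (t - x)) by apply: continuous_L2; exact: continuous_reflect.
rewrite ipBl//.
have -> : ip 0 1 (fun x => F (t + x)) (sn n) =
    ip 0 1 (fun x => F (x + t)) (fun x => sn n (x + t - t)).
  by apply: eq_ip => x _; [rewrite addrC|rewrite addrK].
have -> : ip 0 1 (fun x => F (t - x)) (sn n) =
    ip 0 1 (fun x => F (t - x)) (fun x => - sn n (t - x - t)).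
  by apply: eq_ip => // x _; rewrite -snN; congr (sn n _); ring.
have LGr : L2 0 1 (fun x => sn n (t - x - t)).
  by apply: continuous_L2; exact: (continuous_reflect (k := t) cG).
rewrite ipNr// (@ip_shift 0 1 t F _ cF cG ler01) (@ip_reflect 0 1 t F _ cF cG ler01).
rewrite opprK add0r subr0 addrC (addrC 1 t) -ip_cat//; [|lra|lra].
by rewrite (ip_period cF cG pF pG t02) ip_sn_shift.
Qed.

Lemma trace_coef_shift F G a : continuous F -> continuous G -> periodic_on F -> periodic_on G ->
  -1 <= a <= 1 -> ip 0 2 (fun t => F (t + a)) (fun t => G (t + a)) = ip (-1) 1 F G.
Proof.
move=> cF cG pF pG a1; have a02 : 0 <= 1 + a <= 2 by lra.
rewrite ip_shift// -(ip_period cF cG pF pG a02) add0r.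
have -> : 1 + a - 1 = a by lra.
by have -> : 1 + a + 1 = 2 + a by lra.
Qed.

(** Taking the trace at [a] multiplies the m-th Fourier coefficients by 2 sin(m pi a) up to sign,
    which is the origin of the weights in the observability estimate. *)
Lemma trace_coef F m a : continuous F -> periodic_on F -> 0 <= a <= 1 ->
  ip 0 2 (fun t => F (t + a) - F (t - a)) (sn m) = - (2 * sn m a * ip (-1) 1 F (cn m)) /\
  ip 0 2 (fun t => F (t + a) - F (t - a)) (cn m) = 2 * sn m a * ip (-1) 1 F (sn m).
Proof.
move=> cF pF a01; have cs := @continuous_sn R m; have cc := @continuous_cn R m.
have LF c d := continuous_L2 c d cF.
have Ls c d := @L2_sn R m c d; have Lc c d := @L2_cn R m c d.
have LFs k : L2 0 2 (fun x => F (x + k)) by apply: continuous_L2; exact: continuous_shift.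
have key k G : continuous G -> (forall y, G (y + 2) = G y) -> -1 <= k <= 1 ->
    ip 0 2 (fun t => F (t + k)) G = ip (-1) 1 F (fun y => G (y - k)).
  move=> cG pG k1; have cG' := continuous_shift (k := - k) cG.
  have pG' : periodic_on (fun y => G (y - k)) by move=> y _; rewrite addrAC pG.
  rewrite -(trace_coef_shift cF cG' pF pG' k1).
  by apply: eq_ip => // x _; rewrite addrK.
have a1 : -1 <= a <= 1 by lra.
have a2 : -1 <= - a <= 1 by lra.
rewrite !ipBl// (key a (sn m))//; last exact: sn_period.
rewrite (key (- a) (sn m))//; last exact: sn_period.
rewrite (key a (cn m))//; last exact: cn_period.
rewrite (key (- a) (cn m))//; last exact: cn_period.
rewrite !ip_sn_shift// !ip_cn_shift// snN cnN.
move: (ip _ _ _ _) (ip _ _ _ _) (sn m a) (cn m a) => p q s c; split; ring.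
Qed.

(* The extension of P from [0, 1] to [-1, 3] that is 2-periodic and odd (e = -1)
   or even (e = 1), for P constant on both sides of [0, 1]. *)
Definition parity_ext (e : R) P y : R :=
  P y + e * P (- y) + e * P (2 - y) + P (y - 2) - (1 + e) / 2 * P 1.

Lemma continuous_parity_ext e P : continuous P -> continuous (parity_ext e P).
Proof.
move=> cP; have cst_mul (f : R -> R) : continuous f -> continuous (fun x => e * f x).
  by move=> cf x; apply: cvgM; [exact: cvg_cst|exact: cf].
have c0 : continuous (fun x => P (- x)).
  by have := continuous_reflect (k := 0) cP; under eq_fun do rewrite sub0r.
move=> x; apply: cvgB; last exact: cvg_cst.
apply: cvgD; first apply: cvgD; first apply: cvgD.
- exact: cP.
- exact: (cst_mul _ c0).
- exact: (cst_mul _ (continuous_reflect (k := 2) cP)).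
- exact: (continuous_shift (k := -2) cP).
Qed.

Section ParityExtension.
Context (e : R) (P : R -> R) (P0 : forall y, y <= 0 -> P y = 0).
Context (P1 : forall y, 1 <= y -> P y = P 1) (ee : e * e = 1) (eP : e * P 1 = P 1).

(** The hypothesis [eP] covers both parities: in the odd case it says that [P] vanishes at 1, so
    that no jump appears there. *)
Lemma parity_extE y : 0 <= y <= 1 -> parity_ext e P y = P y.
Proof.
move=> y01; rewrite /parity_ext (P0 (y := - y)) ?(P1 (y := 2 - y)) ?(P0 (y := y - 2)); move: eP; lra.
Qed.

Lemma parity_extN y : -1 <= y <= 1 -> parity_ext e P (- y) = e * parity_ext e P y.
Proof.
move=> y01; rewrite /parity_ext opprK (P1 (y := 2 - y)) ?(P1 (y := 2 + y)); [|lra|lra].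
rewrite (P0 (y := y - 2)) ?(P0 (y := - y - 2)); [|lra|lra].
have : e * (e * P (- y)) = P (- y) by rewrite mulrA ee mul1r.
have : e * (e * P 1) = P 1 by rewrite mulrA ee mul1r.
move: eP; lra.
Qed.

Lemma parity_ext_period : periodic_on (parity_ext e P).
Proof.
move=> y y1; rewrite /parity_ext addrK.
have -> : 2 - (y + 2) = - y by ring.
rewrite (P1 (y := y + 2)) ?(P0 (y := - (y + 2))) ?(P1 (y := 2 - y)) ?(P0 (y := y - 2)); move: eP; lra.
Qed.

Lemma ip_parity_ext (g : R) G : continuous P -> continuous G ->
  (forall x, G (- x) = g * G x) ->
  ip (-1) 1 (parity_ext e P) G = (1 + e * g) * ip 0 1 P G.
Proof.
move=> cP cG GN; rewrite (ip_sym (e := e * g))//; last 2 first.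
- exact: continuous_parity_ext.
- by move=> x x01; rewrite parity_extN ?GN; [ring|lra].
congr (_ * _); apply: eq_ip => // x; rewrite in_itv/= => x01.
by rewrite parity_extE//; lra.
Qed.

End ParityExtension.

Section RetardedSource.
Context (B : R -> R) (cB : continuous B) (B0 : forall y, y <= 0 -> B y = 0).

(* On [-1, 3] and for t <= 2, the even 2-periodic function equal to
   B (t - y) + B (t - (2 - y)) on [0, 2]. *)
Definition source_ext t y : R :=
  B (t - `|y|) + B (t - `|y - 2|) + B (t - `|y + 2|) + B (t - `|y - 4|).

Lemma continuous_source_ext t : continuous (source_ext t).
Proof.
have c k : continuous (fun y => B (t - `|y + k|)).
  move=> y; apply: (@continuous_comp _ _ _ (fun y => `|y + k|) (fun z => B (t - z))).
    apply: (@continuous_comp _ _ _ (fun y => y + k) (fun z => `|z|)); last exact: norm_continuous.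
    by apply: cvgD; [exact: cvg_id|exact: cvg_cst].
  exact: (continuous_reflect (k := t) cB).
have c0 : continuous (fun y => B (t - `|y|)).
  by have := c 0; under eq_fun do rewrite addr0.
move=> y; apply: cvgD; first apply: cvgD; first apply: cvgD.
- exact: c0.
- exact: c.
- exact: c.
- exact: c.
Qed.

Lemma source_extE t y : 0 <= t <= 2 -> 0 <= y <= 2 ->
  source_ext t y = B (t - y) + B (t - (2 - y)).
Proof.
move=> t2 y2; rewrite /source_ext [ `|y|]ger0_norm ?[ `|y - 2|]ler0_norm; [|lra|lra].
rewrite [ `|y + 2|]ger0_norm ?[ `|y - 4|]ler0_norm; [|lra|lra].
rewrite (B0 (y := t - (y + 2))) ?(B0 (y := t - - (y - 4))) ?opprB ?addr0//; lra.
Qed.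

Lemma source_extN t y : 0 <= t <= 2 -> -1 <= y <= 1 ->
  source_ext t (- y) = source_ext t y.
Proof.
move=> t2 y2; rewrite /source_ext normrN.
have -> : `|- y - 2| = `|y + 2| by rewrite -normrN opprD !opprK.
have -> : `|- y + 2| = `|y - 2| by rewrite -normrN opprD opprK.
rewrite [ `|- y - 4|]ler0_norm ?[ `|y - 4|]ler0_norm; [|lra|lra].
rewrite (B0 (y := t - - (- y - 4))) ?(B0 (y := t - - (y - 4))); lra.
Qed.

Lemma source_ext_period t : 0 <= t <= 2 -> periodic_on (source_ext t).
Proof.
move=> t2 y y1; rewrite /source_ext addrK.
have -> : y + 2 - 4 = y - 2 by ring.
rewrite [ `|y + 2 + 2|]ger0_norm ?[ `|y - 4|]ler0_norm; [|lra|lra].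
rewrite (B0 (y := t - (y + 2 + 2))) ?(B0 (y := t - - (y - 4))); lra.
Qed.

(** Reflecting in y = 1 unfolds the two terms of the source into B (t - y) over [0, 2], and
    causality of [B] cuts the integral at t. *)
Lemma ip_source_ext n t : 0 <= t <= 2 ->
  ip (-1) 1 (source_ext t) (sn n) = 0 /\
  ip (-1) 1 (source_ext t) (cn n) = 2 * ip 0 t B (fun r => cn n (t - r)).
Proof.
move=> t2; have cE : continuous (source_ext t) by exact: continuous_source_ext.
have [t0 t2'] := andP t2.
have cc := @continuous_cn R n.
split.
  rewrite (ip_sym (e := -1)) ?subrr ?mul0r//; first exact: continuous_sn.
  by move=> x x01; rewrite source_extN ?snN//; [ring|lra].
rewrite (ip_sym (e := 1))//; last first.
  by move=> x x01; rewrite source_extN ?cnN//; [ring|lra].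
congr (_ * _).
have cB1 := continuous_reflect (k := t) cB.
have cB2 : continuous (fun y => B (t - (2 - y))) by exact: (continuous_reflect (k := 2) cB1).
have L1 c d := continuous_L2 c d cB1; have L2' c d := continuous_L2 c d cB2.
have Lc c d := @L2_cn R n c d.
rewrite (@eq_ip _ 0 1 _ (fun y => B (t - y) + B (t - (2 - y))) _ (cn n))//; last first.
  by move=> y; rewrite in_itv/= => y1; rewrite source_extE//; lra.
rewrite ipDl//.
have -> : ip 0 1 (fun y => B (t - (2 - y))) (cn n) =
    ip 0 1 (fun y => B (t - (2 - y))) (fun y => cn n (2 - y)).
  by apply: eq_ip => // y _; rewrite addrC cn_period cnN.
rewrite (@ip_reflect 0 1 2 _ _ cB1 cc ler01).
have -> : 2 - 1 = 1 :> R by ring.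
rewrite subr0 -ip_cat//; last by lra.
rewrite (@ip_cat _ 0 t 2)//.
have -> : ip t 2 (fun y => B (t - y)) (cn n) = 0.
  rewrite (@eq_ip _ _ _ _ (fun y => 0 * B (t - y)) _ (cn n))// ?ipZl ?mul0r//.
  by move=> y; rewrite in_itv/= => /andP[ty _]; rewrite B0 ?mul0r//; lra.
rewrite addr0.
have := @ip_reflect 0 t t B (fun r => cn n (t - r)) cB (continuous_reflect (k := t) cc) t0.
rewrite subrr subr0 => <-.
by apply: eq_ip => // y _; congr (cn n _); ring.
Qed.

End RetardedSource.

End Reflections.

(** * Observability of the modes *)

Section DelayedVelocity.
Context {R : realType} (al B : R -> R) (cal : continuous al) (cB : continuous B).
Context (B0 : forall t, t <= 0 -> B t = 0).
Context (dB : forall t : R, 0 < t -> is_derive t (1 : R) B (al t)).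
Implicit Types (k t : R).

(* The rate of change of t |-> B (t - k). *)
Definition delayed k : R -> R := glue 0 k 2 (cst 0) (fun t => al (t - k)).

Lemma L2_delayed k : 0 <= k <= 2 -> L2 0 2 (delayed k).
Proof.
move=> /andP[k0 k2]; apply: L2_glue => //; first exact: (@L2_cst _ _ _ 0).
by apply: continuous_L2; exact: continuous_shift.
Qed.

Lemma prim_delayed k t : 0 <= k <= 2 -> 0 <= t <= 2 -> prim 0 2 (delayed k) t = B (t - k).
Proof.
move=> k02 /andP[t0 t2]; have [k0 k2] := andP k02; have Ld := L2_delayed k02.
have left s : s <= k -> prim 0 2 (delayed k) s = 0.
  move=> sk; rewrite (prim_sub_l _ _ sk k2).
  rewrite (@eq_prim _ 0 k _ (cst 0)); last by move=> x xI; rewrite /delayed glue_l.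
  by rewrite /prim ip_cstl ?mul0r//; exact: L2_chi.
case: (leP t k) => tk; first by rewrite left// B0// subr_le0.
rewrite (prim_sub_r Ld k0 (ltW tk) t2) left// add0r.
rewrite (@eq_prim _ k 2 _ (fun x => al (x - k))); last first.
  by move=> x xI; rewrite /delayed glue_r.
have cal' : continuous (fun x => al (x - k)) by exact: continuous_shift.
have cB' : continuous (fun x => B (x - k)) by exact: continuous_shift.
have D y : y \in `]k, 2[ -> is_derive y (1 : R) (fun x => B (x - k)) (al (y - k)).
  rewrite in_itv/= => /andP[ky _].
  by apply: is_derive_shift; apply: dB; rewrite subr_gt0.
have tI : t \in `[k, 2] by rewrite in_itv/= (ltW tk).
have := prim_FTC (within_continuous cal') (within_continuous cB') D tI.
by rewrite subrr (B0 (lexx 0)) add0r => ->.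
Qed.

Lemma ip_delayed_le k : 0 <= k <= 2 ->
  ip 0 2 (delayed k) (delayed k) <= ip 0 2 al al.
Proof.
move=> /andP[k0 k2].
have cal' : continuous (fun x => al (x - k)) by exact: continuous_shift.
rewrite ip_glue//; [|exact: (@L2_cst _ _ _ 0)|exact: continuous_L2].
rewrite [X in X + _]ip_cstl ?mul0r; last exact: (@L2_cst _ _ _ 0).
rewrite add0r (@ip_shift _ k 2 (- k) al al)// subrr.
by apply: ip_itv_le; [exact: continuous_L2|lra|lra|lra].
Qed.

End DelayedVelocity.

(** * The damped trace and the observability inequality *)

Section Observability.
Context {R : realType} (a : R) (a01 : 0 < a < 1) (S : R -> @state R -> @state R).
Context (HS : generates_contraction_semigroup X1 X1norm (A1 a) S).
Context (U W : @state R) (HA : A1 a U W).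
Implicit Types (t x y : R).

Let HG : generator X1 X1norm S U W.
Proof. exact/(HS.2 U W). Qed.

Let XU : X1 U. Proof. by have [] := HG. Qed.

Lemma orbit0 l C : bounded_functional X1 X1norm l C -> l (S (Num.max 0 0) U) = l U.
Proof.
move=> bl; rewrite max0E//; have X0 := semigroup_stable HS.1 (lexx 0) XU.
apply/eqP; rewrite -subr_eq0 -(functionalB bl)// -normr_le0.
have [_ _ lb] := bl; apply: (le_trans (lb _ (semiX_sub X1_seminorm X0 XU))).
by rewrite (semigroup_0 HS.1 XU) mulr0.
Qed.

Lemma mode_fst0 n : mode_fst S U n 0 = ip 0 1 U.1 (sn n).
Proof. exact: (orbit0 (bounded_ip_fst (@L2_sn R n 0 1))). Qed.

Lemma mode_snd0 n : mode_snd S U n 0 = ip 0 1 U.2 (sn n).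
Proof. exact: (orbit0 (bounded_ip_snd (@L2_sn R n 0 1))). Qed.

Definition position := prim 0 1 (wderiv 0 1 U.1).
Definition momentum := prim 0 1 U.2.
(** The profile F for which F(t + x) - F(t - x) is the undamped wave with the data of [U]: half the
    sum of the odd extension of the position and the even extension of a primitive of the
    velocity. *)
Definition free_wave y : R := 2^-1 * (parity_ext (-1) position y + parity_ext 1 momentum y).
(** Subtracting the initial value makes this function vanish for t <= 0, so the waves emitted at [a]
    are causal. *)
Definition displacement t : R := trace a S U t - trace a S U 0.

Lemma position_facts : [/\ continuous position, forall y, y <= 0 -> position y = 0,
  forall y, 1 <= y -> position y = position 1, position 1 = 0 &
  forall n, ip 0 1 position (sn n) = ip 0 1 U.1 (sn n)].
Proof.
have [Lu Lux uE ux1 _] := H10_prim ltr01 XU.1.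
split => //; first exact: prim_continuous.
- by move=> y; exact: prim_le.
- by move=> y; exact: prim_ge.
- by move=> n; rewrite (ae_eq_ipl Lu (L2_prim 0 1 Lux) (@L2_sn R n 0 1) uE).
Qed.

Lemma momentum_facts : [/\ continuous momentum, forall y, y <= 0 -> momentum y = 0 &
  forall y, 1 <= y -> momentum y = momentum 1].
Proof.
have Lv := XU.2; split; first exact: prim_continuous.
- by move=> y; exact: prim_le.
- by move=> y; exact: prim_ge.
Qed.

Let mN1 : -1 * -1 = 1 :> R. Proof. by rewrite mulrNN mulr1. Qed.
Let m11 : 1 * 1 = 1 :> R. Proof. exact: mulr1. Qed.

Lemma free_wave_facts : continuous free_wave /\ periodic_on free_wave.
Proof.
have [cP P0 P1 P10 _] := position_facts; have [cQ Q0 Q1] := momentum_facts.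
split.
  move=> y; apply: cvgM; first exact: cvg_cst.
  by apply: cvgD; exact: continuous_parity_ext.
have eP : -1 * position 1 = position 1 by rewrite P10 mulr0.
have eQ : 1 * momentum 1 = momentum 1 by exact: mul1r.
by move=> y yI; rewrite /free_wave (parity_ext_period P0 P1 eP)// (parity_ext_period Q0 Q1 eQ).
Qed.

Lemma ip_free_wave n : (0 < n)%N ->
  ip (-1) 1 free_wave (sn n) = ip 0 1 U.1 (sn n) /\
  ip (-1) 1 free_wave (cn n) = - (ip 0 1 U.2 (sn n) / (n%:R * pi)).
Proof.
move=> n0; have [cP P0 P1 P10 Pu] := position_facts; have [cQ Q0 Q1] := momentum_facts.
have eP : -1 * position 1 = position 1 by rewrite P10 mulr0.
have eQ : 1 * momentum 1 = momentum 1 by exact: mul1r.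
have Lo := continuous_L2 (-1) 1 (continuous_parity_ext (e := -1) cP).
have Le := continuous_L2 (-1) 1 (continuous_parity_ext (e := 1) cQ).
have Ls := @L2_sn R n (-1) 1; have Lc := @L2_cn R n (-1) 1; have Loe := L2D Lo Le.
have sN x : sn n (- x) = -1 * sn n x :> R by rewrite snN mulN1r.
have cN x : cn n (- x) = 1 * cn n x :> R by rewrite cnN mul1r.
have cs := @continuous_sn R n; have cc := @continuous_cn R n.
rewrite /free_wave (ipZl _ Loe Ls) (ipZl _ Loe Lc) !(ipDl Lo Le)//.
rewrite (ip_parity_ext P0 P1 mN1 eP cP cs sN) (ip_parity_ext P0 P1 mN1 eP cP cc cN).
rewrite (ip_parity_ext Q0 Q1 m11 eQ cQ cs sN) (ip_parity_ext Q0 Q1 m11 eQ cQ cc cN).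
rewrite Pu /momentum ip_prim_cn//; last exact: XU.2.
by move: (ip _ _ _ _) (ip _ _ _ _) (ip _ _ _ _) (_ / _) => p q r z; split; lra.
Qed.

Lemma displacement_facts : continuous displacement /\ forall t, t <= 0 -> displacement t = 0.
Proof.
split.
  by move=> t; apply: cvgB; [exact: (continuous_trace a01 HS HA)|exact: cvg_cst].
by move=> t t0; rewrite /displacement /trace (max_idPr t0) max0E// subrr.
Qed.

(* The free wave plus the waves emitted at a, together with their reflections at
   0 and 1. *)
Definition dalembert t x : R := (free_wave (t + x) - free_wave (t - x)) +
  2^-1 * (source_ext displacement t (a + x) - source_ext displacement t (a - x)).

Lemma continuous_dalembert t : continuous (dalembert t).
Proof.
have [cF _] := free_wave_facts; have [cD _] := displacement_facts.
have cE := @continuous_source_ext R _ cD t.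
move=> x; apply: cvgD; first apply: cvgB.
- exact: (continuous_shiftl (k := t) cF).
- exact: (continuous_reflect (k := t) cF).
- apply: cvgM; first exact: cvg_cst.
  by apply: cvgB; [exact: (continuous_shiftl (k := a) cE)|exact: (continuous_reflect (k := a) cE)].
Qed.

(** [dalembert_coef] serves twice: for the free part, and for the emitted part with [a] in the place
    of the time. The result is the formula of [mode_duhamel]. *)
Lemma dalembert_modes n t : (0 < n)%N -> 0 <= t <= 2 ->
  ip 0 1 (dalembert t) (sn n) = mode_fst S U n t.
Proof.
move=> n0 t2; have [t0 _] := andP t2.
have [cF pF] := free_wave_facts; have [cD D0] := displacement_facts.
have cE := @continuous_source_ext R _ cD t.
have pE := source_ext_period D0 t2.
have a2 : 0 <= a <= 2 by move: a01; lra.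
have [es ec] := ip_source_ext cD D0 n t2.
have [fs fc] := ip_free_wave n0.
have L k (f : R -> R) : continuous f -> L2 0 1 (fun x => f (k + x) - f (k - x)).
  move=> cf; apply: continuous_L2 => x; apply: cvgB; first exact: (continuous_shiftl (k := k) cf).
  exact: (continuous_reflect (k := k) cf).
have Ls := @L2_sn R n 0 1.
rewrite /dalembert (ipDl (L t _ cF) (L2Z _ (L a _ cE)) Ls) (ipZl _ (L a _ cE) Ls).
rewrite (dalembert_coef n cF pF t2) (dalembert_coef n cE pE a2) fs fc es ec.
rewrite (mode_duhamel a01 HS HA n0 t0) mode_fst0 mode_snd0.
rewrite -/(ip 0 t displacement (fun r => cn n (t - r))).
have k0 := @frequency_neq0 R _ n0.
move: (ip _ _ _ _) (ip _ _ _ _) (ip _ _ _ _) => p q r.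
move: (cn n t) (sn n t) (cn n a) (sn n a) => c s c' s'; move: (n%:R * pi) k0 => k k0.
by field.
Qed.

(** Equal sine coefficients give equality almost everywhere, and [dalembert t] is the continuous
    representative. *)
Lemma trace_dalembert t : 0 <= t <= 2 -> trace a S U t = dalembert t a.
Proof.
move=> t2; have [t0 _] := andP t2; have aI : a \in `[0, 1] by rewrite in_itv/=; move: a01; lra.
have Xt : X1 (S t U) by exact: (semigroup_stable HS.1).
have [Lu _ _] := X1_L2 Xt.
have cd := @continuous_dalembert t; have Ld := continuous_L2 0 1 cd.
have Ldu := L2B Ld Lu.
have E : ae_eq_on 0 1 (fun x => dalembert t x - (S t U).1 x) (cst 0).
  apply: sine_uniqueness => // n n0; rewrite (ipBl Ld Lu (@L2_sn R n 0 1)).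
  by rewrite dalembert_modes// /mode_fst max0E// subrr.
rewrite /trace max0E//; apply: (crepE ltr01 (within_continuous cd) _ aI).
by move: E; apply: ae_imp => x h xI; apply/eqP; rewrite -subr_eq0 (h xI).
Qed.

(** D'Alembert's formula at x = a. The coefficient 3/2 is 1 for the displacement itself plus 1/2 for
    the wave emitted at the same instant; 2 a and 2 - 2 a are the times of a round trip from [a] to
    the ends 0 and 1. *)
Lemma trace_identity t : 0 <= t <= 2 ->
  free_wave (t + a) - free_wave (t - a) = trace a S U 0 + (3 / 2 * displacement t
    - 2^-1 * (displacement (t - 2 * a) + displacement (t - (2 - 2 * a)))).
Proof.
move=> t2; have [cD D0] := displacement_facts.
have e1 : source_ext displacement t (a + a) =
    displacement (t - 2 * a) + displacement (t - (2 - 2 * a)).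
  by rewrite (source_extE D0 t2); [congr (displacement _ + displacement _); ring|move: a01; lra].
have e2 : source_ext displacement t (a - a) = displacement t.
  have z2 : 0 <= (0 : R) <= 2 by rewrite lexx ler0n.
  by rewrite subrr (source_extE D0 t2 z2) !subr0 (D0 (t - 2)) ?addr0//; lra.
have e3 : trace a S U t = trace a S U 0 + displacement t by rewrite /displacement subrKC.
have := trace_dalembert t2; rewrite /dalembert e1 e2 e3.
move: (displacement _) (displacement _) (displacement _) (trace _ _ _ _) (free_wave _) (free_wave _) => *; lra.
Qed.

(** The time derivative of the free trace, computed from the right-hand side of [trace_identity],
    hence from the velocity that is damped. *)
Definition trace_rate t : R := 3 / 2 * trace a S W t
  - 2^-1 * (delayed (trace a S W) (2 * a) t + delayed (trace a S W) (2 - 2 * a) t).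

Let cW : continuous (trace a S W).
Proof. exact: (continuous_trace_derivative a01 HS HA). Qed.

Let dD t : 0 < t -> is_derive t (1 : R) displacement (trace a S W t).
Proof.
move=> t0; have := is_derive_sub (is_derive_trace a01 HS HA t0) (is_derive_const t (trace a S U 0)).
by rewrite subr0.
Qed.

Lemma ip_add_le (c d : R) (f g : R -> R) : L2 c d f -> L2 c d g ->
  ip c d (fun x => f x + g x) (fun x => f x + g x) <= 2 * ip c d f f + 2 * ip c d g g.
Proof.
move=> Lf Lg; have Ls := L2D Lf Lg; have Ld := L2B Lf Lg.
have := ip_ge0 c d (fun x => f x - g x).
rewrite (ipBl Lf Lg Ld) !(ipBr Lf Lg)// (ipDl Lf Lg Ls) !(ipDr Lf Lg)//.
rewrite (ipC _ _ g f); move: (ip _ _ _ _) (ip _ _ _ _) (ip _ _ _ _) => p q r; lra.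
Qed.

Lemma trace_rate_facts : [/\ L2 0 2 trace_rate,
  ip 0 2 trace_rate trace_rate <= 13 / 2 * ip 0 2 (trace a S W) (trace a S W) &
  forall t, 0 <= t <= 2 -> prim 0 2 trace_rate t =
    (free_wave (t + a) - free_wave (t - a)) - (free_wave a - free_wave (- a))].
Proof.
have [cD D0] := displacement_facts.
have k1 : 0 <= 2 * a <= 2 by move: a01; lra.
have k2 : 0 <= 2 - 2 * a <= 2 by move: a01; lra.
have L0 := continuous_L2 0 2 cW.
have L1 := L2_delayed cW k1; have L2' := L2_delayed cW k2.
have L12 := L2D L1 L2'; have L3 := L2Z (3 / 2) L0; have L4 := L2Z (2^-1) L12.
have L5 := L2B L3 L4; have L4' := L2N L4.
split.
- exact: L5.
(* The constant is 2 (9/4) + 2 (1/4) 4 = 13/2, the sum of the two delayed terms having squared norm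
   at most 4 times that of the velocity. *)
- have := ip_add_le L3 L4'; rewrite -[X in X <= _]/(ip 0 2 trace_rate trace_rate) => /le_trans; apply.
  rewrite (ipNl L4 L4') (ipNr L4 L4) opprK.
  rewrite (ipZl _ L0 L3) (ipZr _ L0 L0) (ipZl _ L12 L4) (ipZr _ L12 L12).
  have := ip_add_le L1 L2'; have := ip_delayed_le cW k1; have := ip_delayed_le cW k2.
  move: (ip _ _ _ _) (ip _ _ _ _) (ip _ _ _ _) (ip _ _ _ _) => p q r s; lra.
- have key t : 0 <= t <= 2 -> prim 0 2 trace_rate t = 3 / 2 * displacement t
    - 2^-1 * (displacement (t - 2 * a) + displacement (t - (2 - 2 * a))).
    move=> t2; rewrite /trace_rate (primB t L3 L4) (primZ _ t L0) (primZ _ t L12) (primD t L1 L2').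
    rewrite !(prim_delayed cW cD D0 dD)//; congr (_ * _ - _).
    have D y : y \in `]0, 2[ -> is_derive y (1 : R) displacement (trace a S W y).
      by rewrite in_itv/= => /andP[y0 _]; exact: dD.
    have tI : t \in `[0, 2] by rewrite in_itv/=.
    have := prim_FTC (within_continuous cW) (within_continuous cD) D tI.
    by rewrite (D0 0)// add0r => ->.
  move=> t t2; rewrite key// (trace_identity t2).
  have := @trace_identity 0; rewrite !add0r => -> //; last by rewrite lexx ler0n.
  rewrite (D0 0)// (D0 (- (2 * a))); last by move: a01; lra.
  rewrite (D0 (- (2 - 2 * a))); last by move: a01; lra.
  move: (displacement _) (displacement _) (displacement _) (trace _ _ _ _) => *; lra.
Qed.

(** Integration by parts over [0, 2] from [trace_coef]; the factor m pi so produced gives the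
    coefficients their energy normalization. *)
Lemma trace_rate_modes m : (0 < m)%N ->
  ip 0 2 trace_rate (sn m) = - (2 * sn m a * (m%:R * pi * ip 0 1 U.1 (sn m))) /\
  ip 0 2 trace_rate (cn m) = 2 * sn m a * ip 0 1 U.2 (sn m).
Proof.
move=> m0; have [Lh _ ph] := trace_rate_facts; have [cF pF] := free_wave_facts.
have k0 := @frequency_neq0 R _ m0.
have a1 : 0 <= a <= 1 by move: a01; lra.
have [ts tc] := trace_coef m cF pF a1; have [fs fc] := ip_free_wave m0.
have Ls := @L2_sn R m 0 2; have Lc := @L2_cn R m 0 2.
have L1 : L2 0 2 (cst (1 : R)) by exact: L2_cst.
have LK : L2 0 2 (fun t => free_wave (t + a) - free_wave (t - a)).
  apply: continuous_L2 => t; apply: cvgB; first exact: (continuous_shift (k := a) cF).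
  exact: (continuous_shift (k := - a) cF).
pose K0 := free_wave a - free_wave (- a).
have I2 : (2 : R) \in `[0, 2] by rewrite in_itv/= lexx ler0n.
have pK g : L2 0 2 g -> ip 0 2 (prim 0 2 trace_rate) g =
    ip 0 2 (fun t => free_wave (t + a) - free_wave (t - a)) g - K0 * ip 0 2 (cst 1) g.
  move=> Lg; rewrite -(ipZl K0 L1 Lg) -(ipBl LK (L2Z K0 L1) Lg).
  by apply: eq_ip => // x; rewrite in_itv/= => x2 /=; rewrite ph ?mulr1//; lra.
(* The free trace is 2-periodic, so there is no boundary term at t = 2. *)
have p2 : prim 0 2 trace_rate 2 = 0.
  rewrite ph ?lexx ?ler0n// [2 + a]addrC [2 - a]addrC.
  by rewrite !pF ?subrr//; move: a01; lra.
have is0 : ip 0 2 (cst 1) (sn m) = 0 :> R.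
  by rewrite ip_cstl// prim_sn// cn2 subrr mul0r mulr0.
have ic0 : ip 0 2 (cst 1) (cn m) = 0 :> R.
  by rewrite ip_cstl// prim_cn// (sn_nat m 2) mul0r mulr0.
have ibs := prim_by_parts0 (ler0n R 2) Lh Ls p2; have ibc := prim_by_parts0 (ler0n R 2) Lh Lc p2.
rewrite pK// is0 mulr0 subr0 ts in ibs.
rewrite pK// ic0 mulr0 subr0 tc in ibc.
have e1 : ip 0 2 trace_rate (prim 0 2 (sn m)) =
    (m%:R * pi)^-1 * (ip 0 2 trace_rate (cst 1) - ip 0 2 trace_rate (cn m)).
  rewrite -(ipBr L1 Lc Lh) -(ipZr _ (L2B L1 Lc) Lh).
  by apply: eq_ip => // x; rewrite in_itv/= => x2; rewrite prim_sn 1?mulrC// in_itv/=; lra.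
have e2 : ip 0 2 trace_rate (prim 0 2 (cn m)) = (m%:R * pi)^-1 * ip 0 2 trace_rate (sn m).
  rewrite -(ipZr _ Ls Lh).
  by apply: eq_ip => // x; rewrite in_itv/= => x2; rewrite prim_cn 1?mulrC// in_itv/=; lra.
rewrite e1 fc ip1r -prim_d p2 sub0r in ibs; rewrite e2 fs in ibc.
move: ibs ibc; move: (ip 0 2 _ _) (ip 0 2 _ _) (ip 0 1 _ _) (ip 0 1 _ _) (sn m a) => p q u v s.
move: (m%:R * pi) k0 => k k0 ibs ibc; split.
  have -> : 2 * s * (k * u) = k * (2 * s * u) by ring.
  by rewrite ibc; field.
have -> : 2 * s * v = k * - (2 * s * - (v / k)) by field.
by rewrite ibs; field.
Qed.

(** Bessel's inequality on [0, 2], where all modes have norm 1, once for the sines and once for the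
    cosines. Together they give (1/4) (13/2 + 13/2) = 13/4 times the integral of the squared
    velocity; 4 times this integral is twice the energy drop. *)
Lemma observability M :
  \sum_(1 <= m < M.+1) sn m a ^+ 2 *
    ((m%:R * pi * ip 0 1 U.1 (sn m)) ^+ 2 + ip 0 1 U.2 (sn m) ^+ 2)
  <= 2 * (X1norm U ^+ 2 - X1norm (S 2 U) ^+ 2).
Proof.
have [Lh hh _] := trace_rate_facts.
rewrite (energy_balance a01 HS HA (ler0n R 2)).
have half : (2%:R / 2 : R) = 1 by rewrite divff// pnatr_eq0.
have kap : (0 : R) < 2%:R / 2 by rewrite half.
have bs := bessel M kap (fun i => @L2_sn R i 0 2) Lh (@orthogonal_sn R 2).
have bc := bessel M kap (fun i => @L2_cn R i 0 2) Lh (@orthogonal_cn R 2).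
rewrite half mul1r in bs; rewrite half mul1r in bc.
have -> : \sum_(1 <= m < M.+1) sn m a ^+ 2 *
    ((m%:R * pi * ip 0 1 U.1 (sn m)) ^+ 2 + ip 0 1 U.2 (sn m) ^+ 2) =
  4^-1 * ((\sum_(1 <= m < M.+1) ip 0 2 trace_rate (sn m) ^+ 2) +
   (\sum_(1 <= m < M.+1) ip 0 2 trace_rate (cn m) ^+ 2)).
  rewrite -big_split mulr_sumr; apply: eq_big_nat => m /andP[m1 _].
  have [-> ->] := trace_rate_modes m1.
  move: (ip _ _ _ _) (ip _ _ _ _) (sn m a) (m%:R * pi) => p q s k /=.
  rewrite -[Algebra.Algebra_add__canonical__Monoid_ComLaw R _ _]/(_ + _); by field.
have := ip_ge0 0 2 (trace a S W).
move: bs bc hh; move: (\sum_(_ <= _ < _) _) (\sum_(_ <= _ < _) _) (ip _ _ _ _) (ip _ _ _ _) => p q r s; lra.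
Qed.

End Observability.

(** * The envelope and the decay rate *)

Section Envelope.
Context {R : realType} (u : nat -> R) (u0 : forall n, 0 <= u n) (w : R -> R).
Context (Hw : is_lower_convex_envelope u w).
Implicit Types (x y t : R).

Lemma hull_snd_ge0 (p : R^o * R^o) : closed_convex_hull u p -> 0 <= p.2.
Proof.
pose C : set (R^o * R^o) := [set p | 0 <= p.2].
have cC : closed C.
  rewrite -[C]/((@snd R^o R^o) @^-1` [set x | 0 <= x]).
  by apply: (closed_comp (fun p _ => @cvg_snd _ _ _ _ _)); exact: closed_ge.
have sub : smallest (@convex_set R (R^o * R^o)%type)
    [set (n%:R, u n) | n in [set n | (0 < n)%N]] `<=` C.
  apply: smallest_sub; last by move=> _ [n _ <-]; exact: u0.
  move=> x y l; rewrite !inE => x0 y0.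
  rewrite /C/=; apply: addr_ge0; apply: mulr_ge0 => //.
  by rewrite /unstable.onem subr_ge0; exact: le1.
by move=> hp; have := closureS sub hp; rewrite -(closure_id C).1.
Qed.

Lemma envelope_le n : (0 < n)%N -> w n%:R <= u n.
Proof.
move=> n0; have [H _ _ _] := Hw; have n1 : 1 <= n%:R :> R by rewrite ler1n.
by apply: (H _ n1).2; apply: subset_closure; apply: sub_gen_smallest; exists n.
Qed.

Lemma envelope_lt x y : 0 <= x -> x < y -> w y < w x.
Proof.
move=> x0 xy; have [_ H _ _] := Hw; apply: H => //; rewrite in_itv/= andbT//.
exact: le_trans (ltW xy).
Qed.

Lemma envelope_le_homo x y : 0 <= x -> x <= y -> w y <= w x.
Proof.
by move=> x0; rewrite le_eqVlt => /orP[/eqP->//|xy]; apply: ltW; exact: envelope_lt.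
Qed.

(** Strict decrease upgrades w (t + 1) >= 0, read off the hull since t + 1 >= 1. *)
Lemma envelope_gt0 t : 0 <= t -> 0 < w t.
Proof.
move=> t0; have [H _ _ _] := Hw.
have t1 : 1 <= t + 1 by rewrite lerDr.
apply: le_lt_trans (envelope_lt t0 (_ : t < t + 1)); last by rewrite ltrDl.
exact: (hull_snd_ge0 (H _ t1).1).
Qed.

Lemma phi_lt x y : 0 < x -> x < y -> phi w y < phi w x.
Proof.
move=> x0 xy; have y0 := lt_trans x0 xy.
rewrite /phi ltr_pdivrMr ?exprn_gt0// mulrAC ltr_pdivlMr ?exprn_gt0//.
apply: ltr_pM.
- exact: ltW (envelope_gt0 (ltW y0)).
- by rewrite sqr_ge0.
- exact: envelope_lt (ltW x0) xy.
- by rewrite ltr_pXn2r// nnegrE ltW.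
Qed.

Lemma phi_surj y : 0 < y -> exists2 x, 0 < x & phi w x = y.
Proof.
move=> y0; have w1 := envelope_gt0 (ler01 : 0 <= 1); have w0 := envelope_gt0 (lexx 0).
have [b b1 hb] : exists2 b : R, 1 <= b & phi w b <= y.
  (* For this b, w b <= w 0 <= y b <= y b^2. *)
  exists (1 + w 0 / y); first by rewrite lerDl divr_ge0 ?(ltW w0) ?(ltW y0).
  have q0 : 0 <= w 0 / y by rewrite divr_ge0 ?(ltW w0) ?(ltW y0).
  set b := 1 + w 0 / y; have b1 : 1 <= b by rewrite lerDl.
  have b0 : 0 < b by apply: lt_le_trans b1.
  rewrite /phi ler_pdivrMr ?exprn_gt0//.
  apply: (le_trans (envelope_le_homo (lexx 0) (ltW b0))).
  have : w 0 <= y * b by rewrite /b mulrDr mulrCA divff ?gt_eqF// !mulr1 lerDr ltW.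
  move=> /le_trans; apply; rewrite ler_pM2l// expr2 -[leLHS]mulr1.
  by rewrite ler_pM2l.
have [c [c0 c1 hc]] : exists c : R, [/\ 0 < c, c <= 1 & y <= phi w c].
  (* For this c <= 1, phi c >= w 1 / c^2 >= w 1 / c >= y. *)
  exists (1 + y / w 1)^-1.
  have q0 : 0 <= y / w 1 by rewrite divr_ge0 ?(ltW w1) ?(ltW y0).
  have e1 : 1 <= 1 + y / w 1 by rewrite lerDl.
  have e0 : 0 < 1 + y / w 1 by apply: lt_le_trans e1.
  split; [by rewrite invr_gt0|by rewrite invf_le1|].
  rewrite /phi exprVn invrK.
  have h : w 1 <= w (1 + y / w 1)^-1.
    by apply: envelope_le_homo; rewrite ?invf_le1// invr_ge0 ltW.
  apply: (@le_trans _ _ (w 1 * (1 + y / w 1) ^+ 2)); last by rewrite ler_wpM2r ?sqr_ge0.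
  apply: (@le_trans _ _ (w 1 * (1 + y / w 1))).
    by rewrite mulrDr mulrCA divff ?gt_eqF// !mulr1 lerDr ltW.
  by rewrite ler_pM2l// expr2 -[leLHS]mulr1 ler_pM2l.
have cb : c <= b by exact: le_trans b1.
have [_ _ cw _] := Hw.
have cphi : {within `[c, b], continuous (phi w)}.
  apply: (@continuous_in_subspaceT _ _ `[c, b]%classic) => x.
  rewrite inE/= in_itv/= => /andP[cx _]; have x0 := lt_le_trans c0 cx.
  have [cwo _] := (continuous_within_itvcyP 0 w).1 cw.
  apply: cvgM; first by apply: cwo; rewrite in_itv/= x0.
  apply: cvgV; first by rewrite expf_neq0// gt_eqF.
  by apply: cvgM; exact: cvg_id.
have [|x] := @IVT R (phi w) c b y cb cphi.
  by rewrite ge_min le_max hb hc orbT.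
rewrite in_itv/= => /andP[cx _] e; exists x => //; exact: lt_le_trans cx.
Qed.

(** Surjectivity of [phi w] onto the positive half-line ensures that the partial inverse never
    returns its default value there. *)
Lemma phi_invP y : 0 < y -> 0 < phi_inv w y /\ phi w (phi_inv w y) = y.
Proof.
move=> y0.
have s : set_surj `]0, +oo[%classic `]0, +oo[%classic (phi w).
  move=> z /=; rewrite in_itv/= andbT => z0; have [x x0 e] := phi_surj z0.
  by exists x => //=; rewrite in_itv/= x0.
have yI : y \in `]0, +oo[%classic by rewrite inE/= in_itv/= y0.
split; last by have := surjpK (fun=> 0) s yI.
have := surjpinv_image_sub (dflt := fun=> 0) s.
move=> /(_ (phi_inv w y)) /=; rewrite in_itv/= andbT; apply.
by exists y => //=; rewrite in_itv/= y0.
Qed.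

Lemma phi_inv_le x y : 0 < x -> 0 < y -> phi w x <= y -> phi_inv w y <= x.
Proof.
move=> x0 y0 xy; have [p0 pe] := phi_invP y0; rewrite leNgt; apply/negP => lt.
by have := lt_le_trans (phi_lt x0 lt) xy; rewrite pe ltxx.
Qed.

End Envelope.

(** * From observability to the decay rate *)

Section Decay.
Context {R : realType} (a : R) (a01 : 0 < a < 1) (w : R -> R).
Context (Hw : is_lower_convex_envelope (fun n : nat => sin (n%:R * pi * a) ^+ 2) w).
Implicit Types (D : R) (U W : @state R).

(* The high modes of v and u_x are controlled by the norm of W, the jump of u_x at
   a being bounded by interpolation; with the factor 10 the modes beyond M carry
   less than half of the energy. *)
Lemma low_modes_ge U W D M : A1 a U W -> 0 < X1norm U -> X1norm W <= D ->
  10 * D <= M.+1%:R * X1norm U -> X1norm U <= D ->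
  X1norm U ^+ 2 <= 4 * (\sum_(1 <= m < M.+1)
    ((m%:R * pi * ip 0 1 U.1 (sn m)) ^+ 2 + ip 0 1 U.2 (sn m) ^+ 2)).
Proof.
move=> HA N0 WD MD UD; have [ux [vx [al [c Dt]]]] := A1_data a01 HA.
have a1 : 0 <= a <= 1 by move: a01; lra.
have aI : a \in `[0, 1] by rewrite in_itv/=.
have [[[HU _ _ HU2] _] XW _ _] := HA.
have [Lu Lv Lw Lg Lux Lvx uE u1 vE v1 wE alE uxE e1 e2 e3] := Dt.
set N := X1norm U in N0 MD UD *.
have D0 : 0 < D := lt_le_trans N0 UD.
have eN : N ^+ 2 = ip 0 1 ux ux + ip 0 1 U.2 U.2 by rewrite /N X1norm_sqr// e1.
have eW : X1norm W ^+ 2 = ip 0 1 vx vx + ip 0 1 W.2 W.2 by rewrite X1norm_sqr// e2.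
have WD2 : X1norm W ^+ 2 <= D ^+ 2 by rewrite ler_sqr ?nnegrE ?X1norm_ge0// ltW.
have Lpv : L2 0 1 (prim 0 1 vx) by exact: L2_prim.
have vv : ip 0 1 (prim 0 1 vx) (prim 0 1 vx) = ip 0 1 U.2 U.2.
  by rewrite (ae_eq_ip Lv Lpv Lv Lpv vE vE).
have vs n : ip 0 1 (prim 0 1 vx) (sn n) = ip 0 1 U.2 (sn n).
  by rewrite (ae_eq_ipl Lv Lpv (@L2_sn R n 0 1) vE).
have uc n : (0 < n)%N -> ip 0 1 ux (cn n) = n%:R * pi * ip 0 1 U.1 (sn n).
  move=> n0; have Lpu : L2 0 1 (prim 0 1 ux) by exact: L2_prim.
  have k0 := @frequency_neq0 R _ n0.
  by rewrite (ae_eq_ipl Lu Lpu (@L2_sn R n 0 1) uE) ip_prim_sn// mulrC divfK.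
have st := sine_tail M Lvx v1.
have [q qE] : exists q : R, q = (M.+1%:R * pi)^-1 by exists (M.+1%:R * pi)^-1.
have ct := cosine_tail qE a1 Lux Lg u1 uxE.
have := prim_sqr_le Lvx aI; rewrite -alE vv => al2.
have sv : Num.sqrt (ip 0 1 U.2 U.2) <= N by exact: X1norm_ge_snd.
have svx : Num.sqrt (ip 0 1 vx vx) <= D.
  by apply: le_trans WD; rewrite e2; exact: X1norm_ge_wderiv.
have al3 : al ^+ 2 <= 2 * (N * D).
  apply: (le_trans al2); rewrite -mulrA ler_pM2l//.
  by apply: ler_pM; rewrite ?sqrtr_ge0.
have q0 : 0 < q by rewrite qE invr_gt0 mulr_gt0// pi_gt0.
(* Here [q] is 1 / ((M + 1) pi), so q D <= N / (10 pi), and pi >= 2. *)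
have qD : 20 * (q * D) <= N.
  have p2 : 2 <= pi :> R by exact: pi_ge2.
  rewrite qE mulrCA mulrC ler_pdivrMr ?mulr_gt0 ?pi_gt0//.
  have : 10 * D * 2 <= M.+1%:R * N * pi.
    by apply: ler_pM => //; rewrite ?mulr_ge0 ?(ltW D0).
  move: (M.+1%:R) pi => m p; nra.
have q2 : ip 0 1 vx vx / (M.+1%:R * pi) ^+ 2 = q ^+ 2 * ip 0 1 vx vx.
  by rewrite qE exprVn mulrC.
rewrite vv q2 in st.
rewrite (eq_bigr (fun i => ip 0 1 U.2 (sn i) ^+ 2)) in st; last by move=> i _; rewrite vs.
rewrite big_split/= in st *.
have -> : \sum_(1 <= m < M.+1) (m%:R * pi * ip 0 1 U.1 (sn m)) ^+ 2 =
    \sum_(1 <= m < M.+1) ip 0 1 ux (cn m) ^+ 2.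
  by apply: eq_big_nat => m /andP[m1 _]; rewrite uc.
have g0 := ip_ge0 0 1 W.2; have vx0 := ip_ge0 0 1 vx.
rewrite eN; move: st ct eN eW; move: (\sum_(_ <= _ < _) _) (\sum_(_ <= _ < _) _).
move: g0 vx0; move: (ip _ _ ux ux) (ip _ _ U.2 _) (ip _ _ vx _) (ip _ _ W.2 _).
move=> x y z g g0 z0 s1 s2 st ct eN eW.
(* The tails amount to at most (2/400 + 8/20) N^2, the second fraction being due to the jump; what
   remains exceeds N^2 / 2. *)
have b1 : q ^+ 2 * (z + g) <= (q * D) ^+ 2.
  by rewrite exprMn ler_wpM2l ?sqr_ge0// -eW.
have b2 : (q * D) ^+ 2 <= (N / 20) ^+ 2.
  by rewrite ler_sqr ?nnegrE ?divr_ge0 ?mulr_ge0 ?(ltW q0) ?(ltW D0) ?(ltW N0)// ler_pdivlMr// mulrC.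
have b3 : q * al ^+ 2 <= q * (2 * (N * D)) by rewrite ler_pM2l.
have b4 : q * D * N <= N / 20 * N by rewrite ler_pM2r// ler_pdivlMr// mulrC.
have b5 : 0 <= q ^+ 2 * z by rewrite mulr_ge0 ?sqr_ge0.
have b6 : q * (2 * (N * D)) = 2 * (q * D * N) by ring.
have b7 : (N / 20) ^+ 2 = N ^+ 2 / 400 by field.
have b8 : N / 20 * N = N ^+ 2 / 20 by field.
rewrite b7 in b2; rewrite b8 in b4; rewrite b6 in b3; rewrite mulrDr in b1.
rewrite -mulrA in ct; rewrite -[4 * q * _]mulrA in ct.
move: (q * D * N) (q * al ^+ 2) ((q * D) ^+ 2) (q ^+ 2 * z) (q ^+ 2 * g) (N ^+ 2) (sqr_ge0 N) b1 b2 b3 b4 b5 ct st eN.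
move=> k1 k2 k3 k4 k5 k6; lra.
Qed.

(** With [M] the integer part of x = 10 D / N, for N the norm of [U], the modes up to [M] have
    weights sin(m pi a)^2 >= w m >= w x, while M + 1 > x satisfies [low_modes_ge]. The constant 8 is
    the product of 4 from there and 2 from [observability]. *)
Lemma decay_step S U W D : generates_contraction_semigroup X1 X1norm (A1 a) S ->
  A1 a U W -> 0 < X1norm U -> X1norm W <= D -> X1norm U <= D ->
  w (10 * D / X1norm U) * X1norm U ^+ 2 <= 8 * (X1norm U ^+ 2 - X1norm (S 2 U) ^+ 2).
Proof.
move=> HS HA N0 WD UD.
have u0 n : 0 <= sin (n%:R * pi * a) ^+ 2 :> R by exact: sqr_ge0.
set x := 10 * D / X1norm U.
have x0 : 0 <= x by rewrite divr_ge0 ?mulr_ge0 ?(ltW N0)// (le_trans (ltW N0)).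
have /andP[Mx xM] := truncn_itv x0; set M := Num.truncn x in Mx xM.
have MD : 10 * D <= M.+1%:R * X1norm U by rewrite -ler_pdivrMr// ltW.
have low := low_modes_ge HA N0 WD MD UD; have obs := observability a01 HS HA M.
have wx := envelope_gt0 u0 Hw x0.
have : w x * (\sum_(1 <= m < M.+1)
    ((m%:R * pi * ip 0 1 U.1 (sn m)) ^+ 2 + ip 0 1 U.2 (sn m) ^+ 2)) <=
  \sum_(1 <= m < M.+1) sn m a ^+ 2 *
    ((m%:R * pi * ip 0 1 U.1 (sn m)) ^+ 2 + ip 0 1 U.2 (sn m) ^+ 2).
  rewrite mulr_sumr; apply: ler_sum_nat => m /andP[m1 mM].
  rewrite ler_wpM2r ?addr_ge0 ?sqr_ge0//; apply: le_trans (envelope_le Hw m1).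
  apply: (envelope_le_homo Hw (ler0n R m)); apply: le_trans Mx.
  by rewrite ler_nat -ltnS.
move: low obs; move: (\sum_(_ <= _ < _) _) (\sum_(_ <= _ < _) _) (X1norm U ^+ 2) => p q r low obs le1.
have := ler_wpM2l (ltW wx) low; rewrite mulrCA => le2.
apply: (le_trans le2); move: (w x * p) le1 => k le1; lra.
Qed.

Lemma phi_decay S U W D t : generates_contraction_semigroup X1 X1norm (A1 a) S ->
  A1 a U W -> X1norm W <= D -> X1norm U <= D -> 0 <= t -> 0 < X1norm (S t U) ->
  phi w (10 * D / X1norm (S t U)) <= 1 / (t + 1).
Proof.
move=> HS HA WD UD t0 N0.
have u0 n : 0 <= sin (n%:R * pi * a) ^+ 2 :> R by exact: sqr_ge0.
have HG : generator X1 X1norm S U W by exact/(HS.2 U W).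
have [XU XW _] := HG; have st := semigroup_stable HS.1.
have mono s s' : 0 <= s -> s <= s' -> X1norm (S s' U) <= X1norm (S s U).
  move=> s0 ss; have h0 : 0 <= s' - s by rewrite subr_ge0.
  have := null_norm X1_seminorm (semigroupD HS.1 h0 s0 XU).
  by rewrite subrK => ->; apply: (semigroup_contraction HS.1) => //; exact: st.
set N := X1norm (S t U) in N0 *.
have D0 : 0 < D.
  apply: (lt_le_trans N0); apply: le_trans UD; exact: (semigroup_contraction HS.1).
have x0 : 0 < 10 * D / N by rewrite divr_gt0// mulr_gt0.
have wx := envelope_gt0 u0 Hw (ltW x0).
have t2 : 0 <= t / 2 by rewrite divr_ge0.
have /andP[nt tn] := truncn_itv t2; set n := Num.truncn (t / 2) in nt tn.
pose e k := X1norm (S (2 *+ k) U) ^+ 2.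
have k0 k : 0 <= (2 *+ k : R) by rewrite mulrn_wge0.
(* Each interval starts at 2 k <= t, where the norm is still at least [N]; only the last one may end
   after t. *)
have step k : (k < n.+1)%N -> w (10 * D / N) * N ^+ 2 <= 8 * (e k - e k.+1).
  move=> kn; have HAk := orbit_A1 HS HA (k0 k).
  have kt : 2 *+ k <= t.
    have : (k%:R : R) <= t / 2 by apply: le_trans nt; rewrite ler_nat -ltnS.
    by rewrite ler_pdivlMr// -mulr_natl; lra.
  have Nk : N <= X1norm (S (2 *+ k) U) by exact: mono.
  have Nk0 := lt_le_trans N0 Nk.
  have [cW cU] := orbit_contraction HS.1 HG (k0 k).
  have := decay_step HS HAk Nk0 (le_trans cW WD) (le_trans cU UD).
  rewrite -(null_norm X1_seminorm (semigroupD HS.1 (ler0n R 2) (k0 k) XU)) -mulrS.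
  apply: le_trans; apply: ler_pM.
  - exact: ltW.
  - exact: sqr_ge0.
  - apply: (envelope_le_homo Hw).
      by rewrite divr_ge0 ?mulr_ge0 ?(ltW D0) ?X1norm_ge0.
    by rewrite ler_pM2l ?mulr_gt0// lef_pV2 ?posrE.
  - by rewrite ler_sqr ?nnegrE ?(ltW N0) ?(ltW Nk0).
have sum : n.+1%:R * (w (10 * D / N) * N ^+ 2) <= 8 * D ^+ 2.
  have tel m : (m <= n.+1)%N -> m%:R * (w (10 * D / N) * N ^+ 2) <= 8 * (e 0 - e m).
    elim: m => [|m IH] mn; first by rewrite mul0r subrr mulr0.
    have := IH (ltnW mn); have := step m mn; have -> : m.+1%:R = m%:R + 1 :> R by rewrite natr1.
    rewrite (mulrDl m%:R 1) mul1r.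
    move: (w _ * _) => q; move: (_ * q) => p; lra.
  apply: (le_trans (tel _ (leqnn _))); rewrite ler_pM2l//.
  have en : 0 <= e n.+1 by exact: sqr_ge0.
  have e0 : e 0%N <= D ^+ 2.
    rewrite /e mulr0n ler_sqr ?nnegrE ?X1norm_ge0 ?(ltW D0)//.
    by apply: le_trans UD; exact: (semigroup_contraction HS.1 (lexx 0)).
  lra.
have t1 : 0 < t + 1 by rewrite ltr_wpDl.
(* From t < 2 (n + 1) and 1 <= n + 1. *)
have n3 : t + 1 <= 3 * n.+1%:R.
  have n1 : (1 : R) <= n.+1%:R by rewrite ler1n.
  move: tn; rewrite ltr_pdivrMr//; move: n1; move: (n.+1%:R) => m; lra.
rewrite /phi ler_pdivrMr ?exprn_gt0// div1r ler_pdivlMl//.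
(* The claim becomes (t + 1) w(10 D / N) N^2 <= 100 D^2; the sum over the intervals gives it with 3
   times 8, that is 24. *)
have -> : (10 * D / N) ^+ 2 = 100 * (D ^+ 2 / N ^+ 2) by field; rewrite gt_eqF.
have wN : 0 <= w (10 * D / N) * N ^+ 2 by rewrite mulr_ge0 ?sqr_ge0 ?(ltW wx).
move: wN sum; move: (w (10 * D / N)) => v wN sum.
rewrite mulrA ler_pdivlMr ?exprn_gt0// -mulrA.
have := ler_wpM2r wN n3; have := sqr_ge0 D; move: sum.
move: (v * _) (D ^+ 2) (n.+1%:R) => p q m; lra.
Qed.

End Decay.

Theorem theorem4p3p7 (R : realType) (a : R) (ha : 0 < a < 1)
    (ha_irr : irrational a) :
  exists C : R, 0 < C /\
    forall w : R -> R,
      is_lower_convex_envelope (fun n : nat => sin (n%:R * pi * a) ^+ 2) w ->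
    forall S : R -> state -> state,
      generates_contraction_semigroup X1 X1norm (A1 a) S ->
    forall U0 : state, DA1 a U0 ->
    forall t : R, 0 <= t ->
      X1norm (S t U0) <= C / phi_inv w (1 / (t + 1)) * DA1norm a U0.
Proof.
(* The factor fixed in [low_modes_ge], where it makes the tails small. *)
exists 10; split => // w Hw S HS U0 DU t t0.
have u0 n : 0 <= sin (n%:R * pi * a) ^+ 2 :> R by exact: sqr_ge0.
have y0 : 0 < 1 / (t + 1) by rewrite divr_gt0// ltr_wpDl.
have [p0 _] := phi_invP u0 Hw y0.
have [W [HA XU WD UD]] := DA1_image ha DU.
have D0 : 0 <= DA1norm a U0 by exact: sqrtr_ge0.
(* The argument of [phi] divides by the norm at time t; when that norm is zero the bound is
   immediate. *)
have [N0|] := ltP 0 (X1norm (S t U0)); last first.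
  by move=> /le_trans; apply; rewrite mulr_ge0 ?divr_ge0 ?(ltW p0).
have Dp : 0 < DA1norm a U0.
  by apply: (lt_le_trans N0); apply: le_trans UD; exact: (semigroup_contraction HS.1).
have x0 : 0 < 10 * DA1norm a U0 / X1norm (S t U0) by rewrite divr_gt0 ?mulr_gt0.
have := phi_inv_le u0 Hw x0 y0 (phi_decay ha Hw HS HA WD UD t0 N0).
by rewrite ler_pdivlMr// mulrC -ler_pdivlMr// mulrAC.
Qed.
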